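(* Let $a=\{a_n\}_{n\in\mathbb{N}}$ be a complex sequence with $\sum_{n=1}^\infty|a_n|<\infty$, and define for $x>0$ $$f(x)=\sum_{n=1}^\infty\frac{a_n}{\sinh(\pi n/2)}\,\mathrm{Im}\left[J^2_{in/2}(x)\right].$$ For $x>0$ and $n\in\mathbb{N}$ let $$\Omega_n(x)=\int_0^\pi\left[x\,\mathbf{K}_0\big(2x\cosh u\big)-\frac{1}{\pi\cosh u}\right]\sinh(2u)\sin(nu)\,du.$$ Then for every $n\in\mathbb{N}$, $$a_n=\sinh(\pi n)\int_0^\infty\Omega_n(x)f(x)\,dx,$$ and the integral converges absolutely.
   Context: $J_{in/2}$ is the Bessel function of the first kind of imaginary order $in/2$; $\mathrm{Im}$ denotes the imaginary part. $\mathbf{K}_0$ is the Struve-type function $\mathbf{K}_0=\mathbf{H}_0-Y_0$, given for $x>0$ by $\mathbf{K}_0(x)=\frac{2}{\pi}\int_0^\infty e^{-x\sinh t}\,dt$. *)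

(* Defs.v *)
From Stdlib Require Import Reals Factorial.
From Coquelicot Require Import Coquelicot.
Open Scope R_scope.

(* Limit of a complex sequence, taken componentwise (meaningful when it converges). *)
Definition Clim (u : nat -> C) : C :=
  (real (Lim_seq (fun m => Re (u m))), real (Lim_seq (fun m => Im (u m)))).

Definition Cseries (u : nat -> C) : C := Clim (fun N => sum_n u N).

Definition cpow_pos (y : R) (z : C) : C :=
  (exp (Re z * ln y) * cos (Im z * ln y), exp (Re z * ln y) * sin (Im z * ln y)).

Fixpoint Cpoch (z : C) (m : nat) : C :=
  match m with
  | O => z
  | S m' => Cmult (Cpoch z m') (Cplus z (RtoC (INR (S m'))))
  end.

(* Reciprocal Gamma function via Gauss' limit formula:
   1/Gamma(z) = lim_m z(z+1)...(z+m) / (m! m^z). *)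
Definition rGamma (z : C) : C :=
  Clim (fun m => Cdiv (Cpoch z m) (Cmult (RtoC (INR (Factorial.fact m))) (cpow_pos (INR m) z))).

Definition BesselJ (nu : C) (x : R) : C :=
  Cseries (fun k =>
    Cmult (RtoC ((-1) ^ k * (x / 2) ^ (2 * k) / INR (Factorial.fact k)))
          (Cmult (cpow_pos (x / 2) nu) (rGamma (Cplus nu (RtoC (INR k + 1)))))).

(* Struve-type function K_0 = H_0 - Y_0, for x > 0:
   K_0(x) = (2/pi) int_0^oo exp(-x sinh t) dt. *)
Definition StruveK0 (x : R) : R :=
  2 / PI * RInt_gen (fun t => exp (- (x * sinh t))) (at_point 0) (Rbar_locally p_infty).

Definition Omega (n : nat) (x : R) : R :=
  RInt (fun u => (x * StruveK0 (2 * x * cosh u) - 1 / (PI * cosh u))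
                 * sinh (2 * u) * sin (INR n * u)) 0 PI.

Definition ffun (a : nat -> C) (x : R) : C :=
  Cseries (fun k =>
    let n := S k in
    Cmult (a n)
      (RtoC (Im (Cmult (BesselJ (0, INR n / 2) x) (BesselJ (0, INR n / 2) x))
             / sinh (PI * INR n / 2)))).

(* Main.v *)
Require Import Defs.
From Stdlib Require Import Reals Lra Lia Psatz.
From Coquelicot Require Import Coquelicot.
Open Scope R_scope.

(* With Y s = (1/2) Im J_{i tau}(2 e^{s/2})^2, the transform int_0^oo e^{-y} Y (l + ln y) dy solves, in l, the
   same second-order equation as e^{-z} K_{i tau}(z), z = 2 e^l; both behave alike as l -> -oo, because
   |Gamma (1 + i tau)|^2 = pi tau / sinh (pi tau), so they are proportional. Subordination turns the Gaussian
   transform into a Laplace transform, and writing y K_0(y) - 2/pi as a mixture of exponentials turns that into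
   int_0^oo (x K_0(2 x cosh u) - 1/(pi cosh u)) Im J_{i tau}(x)^2 dx
     = const * int cos (tau t) / (cosh u + cosh (t/2)) dt.
   For tau = m/2 the last integral is a multiple of sin (m u) / sinh u, so orthogonality of the sines on [0, pi]
   isolates a_n. The energy estimate |J_{i tau}|^2 <= 2 sinh (pi tau) / (pi tau) bounds the terms of f uniformly,
   which justifies exchanging the sum with the integral. *)

(** * Integrals of exponentially dominated functions over the line *)

(** The square of a Bessel function satisfies only a third-order equation. The Gaussian transform
    precedes the Laplace transform because the weight [e^(-y) dy] lowers the order: in
    [Y'' = 2 MM - 4 omega Y] the extra quantity has [MM' = e^s Y], and one integration by parts
    against the weight turns the transform of [MM] into a multiple of that of [Y]. At -oo the
    resulting equation has exponents [+- i tau], so no nonzero solution is [O(e^l)] there, and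
    agreement of the leading terms up to [O(e^l)] decides everything. All integrals are taken in
    logarithmic variables ([x = 2 e^(s/2)], [y = e^r]): powers at 0 become exponential decay at -oo,
    and Bessel's equation loses its first-order term. One class of integrands, [Good], and one
    Fubini theorem then suffice. The term [1/(pi cosh u)] removes the limit [2/pi] of [y K_0(y)] at
    infinity. It makes the kernel absolutely integrable, so that mere boundedness of [Im J^2] is
    enough. The reciprocal Gamma function is given by Gauss' limit, while the asymptotics come from
    Euler's integral; a concentration estimate links the two. *)

Definition cont (f : R -> R) := forall x, continuous f x.

Definition cont2 (F : R -> R -> R) :=
  forall x y, continuity_2d_pt F x y.

Definition dominated (d C : R) (f : R -> R) :=
  forall x, Rabs (f x) <= C * exp (- (d * Rabs x)).

(** Exponential decay is the common form of the integrands once a half-line integral has been moved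
    to a logarithmic variable. The existential rate keeps the class closed under sums, shifts,
    rescaling and bounded continuous factors. *)
Definition Good (f : R -> R) :=
  cont f /\ exists d C, 0 < d /\ dominated d C f.

(* Integral over the whole line; symmetric truncations suffice because it is only
   used on exponentially dominated functions. *)
Definition IR (f : R -> R) : R :=
  real (Lim_seq (fun n => RInt f (- INR n) (INR n))).

Lemma exp_le_mono x y : x <= y -> exp x <= exp y.
Proof.
intros H. destruct (Req_dec x y) as [->|Hn]; [apply Rle_refl |].
left. apply exp_increasing. lra.
Qed.

Lemma cont_ex_RInt (f : R -> R) (a b : R) : cont f -> ex_RInt f a b.
Proof. intros H. apply @ex_RInt_continuous. intros; apply H. Qed.

Lemma cont_comp (f g : R -> R) : cont f -> cont g -> cont (fun x => f (g x)).
Proof. intros Hf Hg x. apply (continuous_comp g f); [apply Hg | apply Hf]. Qed.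

Lemma cont_of_ex_derive (f : R -> R) : (forall x, ex_derive f x) -> cont f.
Proof. intros H x. now apply @ex_derive_continuous. Qed.

Lemma cont_Rabs (f : R -> R) : cont f -> cont (fun x => Rabs (f x)).
Proof. intros H. apply (cont_comp Rabs f); [intros x; apply continuous_Rabs | exact H]. Qed.

Lemma cont_mult (f g : R -> R) : cont f -> cont g -> cont (fun x => f x * g x).
Proof. intros Hf Hg x. apply @continuous_mult; [apply Hf | apply Hg]. Qed.

Lemma cont_plus (f g : R -> R) : cont f -> cont g -> cont (fun x => f x + g x).
Proof. intros Hf Hg x. apply @continuous_plus; [apply Hf | apply Hg]. Qed.

Lemma cont_minus (f g : R -> R) : cont f -> cont g -> cont (fun x => f x - g x).
Proof. intros Hf Hg x. apply @continuous_minus; [apply Hf | apply Hg]. Qed.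

Lemma cont_opp (f : R -> R) : cont f -> cont (fun x => - f x).
Proof. intros Hf x. apply @continuous_opp. apply Hf. Qed.

Lemma RInt_diff (f : R -> R) (a b c e : R) : cont f ->
  RInt f a b = RInt f a c + RInt f c e + RInt f e b.
Proof.
intros Hf.
rewrite <- (RInt_Chasles f a e b), <- (RInt_Chasles f a c e); auto using cont_ex_RInt.
Qed.

Lemma dominated_nonneg d C f : dominated d C f -> 0 <= C.
Proof.
intros H. specialize (H 0).
assert (H1 := exp_pos (- (d * Rabs 0))). assert (H2 := Rabs_pos (f 0)). nra.
Qed.

Lemma is_RInt_FTC (F f : R -> R) a b :
  (forall x, is_derive F x (f x)) -> cont f -> is_RInt f a b (F b - F a).
Proof. intros HF Hf. apply (is_RInt_derive F f a b); intros x _; [apply HF | apply Hf]. Qed.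

Lemma RInt_exp_decay d a b : d <> 0 ->
  is_RInt (fun x => exp (- (d * x))) a b (/ d * exp (- (d * a)) - / d * exp (- (d * b))).
Proof.
intros Hd.
replace (/ d * exp (- (d * a)) - / d * exp (- (d * b)))
  with (- / d * exp (- (d * b)) - - / d * exp (- (d * a))) by ring.
apply (is_RInt_FTC (fun x => - / d * exp (- (d * x)))).
- intros x. auto_derive; [exact I |]. field. exact Hd.
- apply cont_of_ex_derive. intros x. auto_derive. exact I.
Qed.

Lemma tail_right d C f M a b : 0 < d -> cont f -> dominated d C f ->
  0 <= M -> M <= a -> a <= b -> Rabs (RInt f a b) <= C / d * exp (- (d * M)).
Proof.
intros Hd Hf HC HM Ha Hb.
assert (HC0 := dominated_nonneg _ _ _ HC).
eapply Rle_trans; [apply abs_RInt_le; [exact Hb | now apply cont_ex_RInt] |].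
assert (He : is_RInt (fun x => scal C (exp (- (d * x)))) a b
   (scal C (/ d * exp (- (d * a)) - / d * exp (- (d * b))))).
{ apply @is_RInt_scal. apply RInt_exp_decay. lra. }
apply Rle_trans with (RInt (fun x => scal C (exp (- (d * x)))) a b).
- apply RInt_le; try assumption.
  + apply cont_ex_RInt. now apply cont_Rabs.
  + eexists; exact He.
  + intros x Hx. eapply Rle_trans; [apply HC |].
    rewrite (Rabs_pos_eq x) by lra. apply Rle_refl.
- rewrite (is_RInt_unique _ _ _ _ He).
  assert (H1 : exp (- (d * a)) <= exp (- (d * M))).
  { destruct (Req_dec a M) as [->|Hn]; [lra|]. left. apply exp_increasing. nra. }
  assert (H2 := exp_pos (- (d * b))).
  unfold Rdiv. rewrite Rmult_assoc. apply Rmult_le_compat_l; [exact HC0 |].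
  assert (0 < / d) by now apply Rinv_0_lt_compat. nra.
Qed.

Lemma cont_reflect f : cont f -> cont (fun x => f (- x)).
Proof.
intros Hf. apply (cont_comp f Ropp); [exact Hf|].
apply cont_of_ex_derive. intros x. auto_derive. exact I.
Qed.

Lemma RInt_reflect (f : R -> R) a b : cont f ->
  RInt (fun x => f (- x)) a b = RInt f (- b) (- a).
Proof.
intros Hf.
rewrite <- (opp_RInt_swap f (-a) (-b)) by now apply cont_ex_RInt.
replace (- a) with (-1 * a + 0) by ring. replace (- b) with (-1 * b + 0) by ring.
rewrite <- (RInt_comp_lin f (-1) 0 a b) by now apply cont_ex_RInt.
rewrite <- (RInt_opp (fun y => scal (-1) (f (-1 * y + 0)))).
- apply RInt_ext. intros x _. unfold opp, scal; simpl; unfold mult; simpl.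
  replace (-1 * x + 0) with (- x) by ring. ring.
- apply @ex_RInt_scal. apply cont_ex_RInt.
  apply (cont_comp f (fun y => -1 * y + 0)); [exact Hf |].
  apply cont_of_ex_derive. intros x. auto_derive. exact I.
Qed.

Lemma tail_left d C f M a b : 0 < d -> cont f -> dominated d C f ->
  0 <= M -> b <= - M -> a <= b -> Rabs (RInt f a b) <= C / d * exp (- (d * M)).
Proof.
intros Hd Hf HC HM Ha Hb.
replace (RInt f a b) with (RInt (fun x => f (- x)) (- b) (- a)).
- apply tail_right; try assumption; try lra.
  + now apply cont_reflect.
  + intros x. specialize (HC (-x)). now rewrite Rabs_Ropp in HC.
- rewrite RInt_reflect by assumption. now rewrite !Ropp_involutive.
Qed.

Lemma RInt_two_tails d C f M a b a' b' : 0 < d -> cont f -> dominated d C f ->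
  0 <= M -> a <= - M -> M <= b -> a' <= a -> b <= b' ->
  Rabs (RInt f a' b' - RInt f a b) <= 2 * C / d * exp (- (d * M)).
Proof.
intros Hd Hf HC HM Ha Hb Ha' Hb'.
rewrite (RInt_diff f a' b' a b) by assumption.
replace (RInt f a' a + RInt f a b + RInt f b b' - RInt f a b)
  with (RInt f a' a + RInt f b b') by ring.
eapply Rle_trans; [apply Rabs_triang |].
replace (2 * C / d * exp (- (d * M)))
  with (C / d * exp (- (d * M)) + C / d * exp (- (d * M))) by (field; lra).
apply Rplus_le_compat.
- eapply tail_left; eauto.
- eapply tail_right; eauto.
Qed.

Lemma exp_neg_small (d K eps : R) : 0 < d -> 0 <= K -> 0 < eps ->
  exists M, 0 <= M /\ forall x, M <= x -> K * exp (- (d * x)) < eps.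
Proof.
intros Hd HK He.
set (y := (K + 1) / eps).
assert (Hy : 0 < y) by (apply Rdiv_lt_0_compat; lra).
exists (Rmax 0 (ln y / d)). split; [apply Rmax_l |]. intros x Hx.
assert (H1 : exp (- (d * x)) <= / y).
{ rewrite <- (exp_ln (/ y)) by now apply Rinv_0_lt_compat.
  rewrite ln_Rinv by assumption.
  assert (H2 : ln y <= d * x).
  { replace (ln y) with (d * (ln y / d)) at 1 by (field; lra).
    apply Rmult_le_compat_l; [lra |]. eapply Rle_trans; [apply Rmax_r | exact Hx]. }
  destruct (Req_dec (- (d * x)) (- ln y)) as [->|Hn]; [lra |].
  left. apply exp_increasing. lra. }
apply Rle_lt_trans with (K * / y).
- apply Rmult_le_compat_l; lra.
- unfold y. rewrite Rinv_div. unfold Rdiv.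
  apply Rmult_lt_reg_r with (K + 1); [lra |].
  replace (K * (eps * / (K + 1)) * (K + 1)) with (K * eps) by (field; lra). nra.
Qed.

Lemma IR_lim d C f : 0 < d -> cont f -> dominated d C f ->
  is_lim_seq (fun n => RInt f (- INR n) (INR n)) (IR f).
Proof.
intros Hd Hf HC.
assert (HC0 := dominated_nonneg _ _ _ HC).
assert (Hex : ex_finite_lim_seq (fun n => RInt f (- INR n) (INR n))).
{ apply ex_lim_seq_cauchy_corr. intros eps.
  destruct (exp_neg_small d (2 * C / d) eps Hd) as [M [HM HM']];
    [apply Rdiv_le_0_compat; lra | apply eps |].
  destruct (nfloor_ex M HM) as [N [HN1 HN2]].
  assert (HE : forall n m, (S N <= n)%nat -> (n <= m)%nat ->
     Rabs (RInt f (- INR m) (INR m) - RInt f (- INR n) (INR n)) < eps).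
  { intros n m Hn Hm. apply le_INR in Hn. rewrite S_INR in Hn. apply le_INR in Hm.
    eapply Rle_lt_trans; [apply (RInt_two_tails d C f M); auto; lra |]. apply HM'. lra. }
  exists (S N). intros n m Hn Hm.
  destruct (Compare_dec.le_lt_dec n m) as [H|H].
  - rewrite Rabs_minus_sym. now apply HE.
  - apply HE; lia. }
apply Lim_seq_correct' in Hex. exact Hex.
Qed.

(** The error depends on [d] and [C] only, hence is uniform in any parameter of the integrand, and
    the endpoints need not be symmetric. The Fubini theorems use the first feature, substitutions
    the second. *)
Lemma IR_tail d C f M a b : 0 < d -> cont f -> dominated d C f ->
  0 <= M -> a <= - M -> M <= b ->
  Rabs (RInt f a b - IR f) <= 2 * C / d * exp (- (d * M)).
Proof.
intros Hd Hf HC HM Ha Hb.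
assert (H := IR_lim d C f Hd Hf HC).
assert (H2 : is_lim_seq (fun n => Rabs (RInt f (- INR n) (INR n) - RInt f a b))
   (Rabs (IR f - RInt f a b))).
{ apply (is_lim_seq_abs _ (IR f - RInt f a b)).
  apply (is_lim_seq_minus' _ _ _ _ H (is_lim_seq_const _)). }
rewrite Rabs_minus_sym.
refine (is_lim_seq_le_loc _ _ _ _ _ H2 (is_lim_seq_const _)).
destruct (nfloor_ex (Rmax (- a) b)) as [N [HN1 HN2]].
{ apply Rle_trans with b; [lra | apply Rmax_r]. }
exists (S N). intros n Hn. apply le_INR in Hn. rewrite S_INR in Hn.
assert (- a <= Rmax (- a) b) by apply Rmax_l.
assert (b <= Rmax (- a) b) by apply Rmax_r.
apply (RInt_two_tails d C f M); auto; lra.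
Qed.

Lemma IR_le_const d C f : 0 < d -> cont f -> dominated d C f -> Rabs (IR f) <= 2 * C / d.
Proof.
intros Hd Hf HC.
assert (H := IR_tail d C f 0 0 0 Hd Hf HC).
rewrite RInt_point in H. unfold zero in H; simpl in H.
replace (0 - IR f) with (- IR f) in H by ring.
rewrite Rabs_Ropp, Rmult_0_r, Ropp_0, exp_0, Rmult_1_r in H. apply H; lra.
Qed.

(** Frees [IR] from the symmetric truncations of its definition: shifts and dilations of the
    variable are read off from shifted or dilated endpoints. *)
Lemma IR_unique f (a b : nat -> R) (l : R) : Good f ->
  is_lim_seq a m_infty -> is_lim_seq b p_infty ->
  is_lim_seq (fun n => RInt f (a n) (b n)) l -> IR f = l.
Proof.
intros [Hf [d [C [Hd HC]]]] Ha Hb Hl.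
assert (HC0 := dominated_nonneg _ _ _ HC).
assert (H : is_lim_seq (fun n => RInt f (a n) (b n)) (IR f)).
{ apply is_lim_seq_spec. intros eps.
  destruct (exp_neg_small d (2 * C / d) eps Hd) as [M [HM HM']];
    [apply Rdiv_le_0_compat; lra | apply eps |].
  apply is_lim_seq_spec in Ha. apply is_lim_seq_spec in Hb.
  generalize (filter_and _ _ (Ha (- M)) (Hb M)). apply filter_imp.
  intros n [H1 H2]. eapply Rle_lt_trans; [apply (IR_tail d C f M); auto; lra |].
  apply HM'. lra. }
apply is_lim_seq_unique in H. apply is_lim_seq_unique in Hl. rewrite Hl in H. now injection H.
Qed.

Lemma is_lim_seq_opp_INR : is_lim_seq (fun n => - INR n) m_infty.
Proof. apply (is_lim_seq_opp _ p_infty). apply is_lim_seq_INR. Qed.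

Lemma IR_shift f c : Good f -> IR (fun x => f (x + c)) = IR f.
Proof.
intros Hf. symmetry.
apply (IR_unique f (fun n => - INR n + c) (fun n => INR n + c)); try assumption.
- apply (is_lim_seq_plus _ _ m_infty c); [apply is_lim_seq_opp_INR | apply is_lim_seq_const | reflexivity].
- apply (is_lim_seq_plus _ _ p_infty c); [apply is_lim_seq_INR | apply is_lim_seq_const | reflexivity].
- apply is_lim_seq_ext with (fun n => RInt (fun x => f (x + c)) (- INR n) (INR n)).
  + intros n. generalize (RInt_comp_lin f 1 c (- INR n) (INR n)). intros H.
    rewrite !Rmult_1_l in H. rewrite <- H by (apply cont_ex_RInt; apply Hf).
    apply RInt_ext. intros x _. now rewrite !Rmult_1_l.
  + destruct Hf as [Hc [d [C [Hd HC]]]].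
    apply (IR_lim d (C * exp (d * Rabs c)) (fun x => f (x + c))); try assumption.
    * apply (cont_comp f (fun x => x + c)); [exact Hc |].
      apply cont_of_ex_derive. intros x. auto_derive. exact I.
    * intros x. eapply Rle_trans; [apply HC |].
      rewrite Rmult_assoc, <- exp_plus.
      apply Rmult_le_compat_l; [eapply dominated_nonneg; eauto |].
      apply exp_le_mono. assert (Rabs x <= Rabs (x + c) + Rabs c).
      { replace x with ((x + c) + (- c)) at 1 by ring. rewrite <- (Rabs_Ropp c). apply Rabs_triang. }
      nra.
Qed.

Lemma IR_ext f g : (forall x, f x = g x) -> IR f = IR g.
Proof.
intros H. unfold IR. f_equal. apply Lim_seq_ext. intros n. apply RInt_ext. intros; apply H.
Qed.

Lemma Good_ext f g : (forall x, f x = g x) -> Good f -> Good g.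
Proof.
intros H [Hc [d [C [Hd HC]]]]. split.
- intros x. apply continuous_ext with f; [exact H | apply Hc].
- exists d, C. split; [exact Hd |]. intros x. rewrite <- H. apply HC.
Qed.

Lemma Good_IR_lim f : Good f -> is_lim_seq (fun n => RInt f (- INR n) (INR n)) (IR f).
Proof. intros [Hc [d [C [Hd HC]]]]. eapply IR_lim; eauto. Qed.

Lemma dominated_weaken d d' C f : 0 < d' -> d' <= d -> dominated d C f -> dominated d' C f.
Proof.
intros H1 H2 H x. eapply Rle_trans; [apply H |].
apply Rmult_le_compat_l; [eapply dominated_nonneg; eauto |].
apply exp_le_mono. assert (Hx := Rabs_pos x). nra.
Qed.

Lemma Good_plus f g : Good f -> Good g -> Good (fun x => f x + g x).
Proof.
intros [Hf [d1 [C1 [Hd1 HC1]]]] [Hg [d2 [C2 [Hd2 HC2]]]].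
assert (Hm : 0 < Rmin d1 d2) by (now apply Rmin_glb_lt).
split; [now apply cont_plus |].
exists (Rmin d1 d2), (C1 + C2). split; [exact Hm |].
apply (dominated_weaken _ (Rmin d1 d2)) in HC1; [| exact Hm | apply Rmin_l].
apply (dominated_weaken _ (Rmin d1 d2)) in HC2; [| exact Hm | apply Rmin_r].
intros x. eapply Rle_trans; [apply Rabs_triang |].
specialize (HC1 x). specialize (HC2 x). lra.
Qed.

Lemma Good_mult_bounded f g B : Good f -> cont g -> (forall x, Rabs (g x) <= B) ->
  Good (fun x => f x * g x).
Proof.
intros [Hf [d [C [Hd HC]]]] Hg HB. split; [now apply cont_mult |].
exists d, (C * B). split; [exact Hd |]. intros x. rewrite Rabs_mult.
replace (C * B * exp (- (d * Rabs x))) with (C * exp (- (d * Rabs x)) * B) by ring.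
apply Rmult_le_compat; try apply Rabs_pos; [apply HC | apply HB].
Qed.

Lemma Good_scal c f : Good f -> Good (fun x => c * f x).
Proof.
intros H. apply Good_ext with (fun x => f x * c); [intros; ring |].
apply Good_mult_bounded with (Rabs c); [exact H | | intros; apply Rle_refl].
intros x. apply continuous_const.
Qed.

Lemma Good_opp f : Good f -> Good (fun x => - f x).
Proof. intros H. apply Good_ext with (fun x => -1 * f x); [intros; ring | now apply Good_scal]. Qed.

Lemma Good_minus f g : Good f -> Good g -> Good (fun x => f x - g x).
Proof. intros Hf Hg. apply Good_plus; [exact Hf | now apply Good_opp]. Qed.

Lemma Good_le f g : cont f -> Good g -> (forall x, Rabs (f x) <= g x) -> Good f.
Proof.
intros Hf [_ [d [C [Hd HC]]]] H. split; [exact Hf |]. exists d, C. split; [exact Hd |].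
intros x. eapply Rle_trans; [apply H |]. eapply Rle_trans; [apply Rle_abs | apply HC].
Qed.

Lemma Good_Rabs f : Good f -> Good (fun x => Rabs (f x)).
Proof.
intros [Hf [d [C [Hd HC]]]]. split; [now apply cont_Rabs |]. exists d, C.
split; [exact Hd |]. intros x. rewrite Rabs_Rabsolu. apply HC.
Qed.

Lemma Good_reflect f : Good f -> Good (fun x => f (- x)).
Proof.
intros [Hf [d [C [Hd HC]]]]. split; [now apply cont_reflect |].
exists d, C. split; [exact Hd |]. intros x. specialize (HC (-x)). now rewrite Rabs_Ropp in HC.
Qed.

Lemma Good_shift f c : Good f -> Good (fun x => f (x + c)).
Proof.
intros [Hc [d [C [Hd HC]]]]. split.
- apply (cont_comp f (fun x => x + c)); [exact Hc |].
  apply cont_of_ex_derive. intros x. auto_derive. exact I.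
- exists d, (C * exp (d * Rabs c)). split; [exact Hd |].
  intros x. eapply Rle_trans; [apply HC |].
  rewrite Rmult_assoc, <- exp_plus.
  apply Rmult_le_compat_l; [eapply dominated_nonneg; eauto |].
  apply exp_le_mono. assert (Rabs x <= Rabs (x + c) + Rabs c).
  { replace x with ((x + c) + (- c)) at 1 by ring. rewrite <- (Rabs_Ropp c). apply Rabs_triang. }
  nra.
Qed.

Lemma IR_reflect f : cont f -> IR (fun x => f (- x)) = IR f.
Proof.
intros Hf. unfold IR. f_equal. apply Lim_seq_ext. intros n.
rewrite RInt_reflect by assumption. now rewrite Ropp_involutive.
Qed.

Lemma IR_eq_lim f (l : R) : Good f ->
  is_lim_seq (fun n => RInt f (- INR n) (INR n)) l -> IR f = l.
Proof.
intros Hf Hl. apply is_lim_seq_unique in Hl. unfold IR. now rewrite Hl.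
Qed.

Lemma IR_plus f g : Good f -> Good g -> IR (fun x => f x + g x) = IR f + IR g.
Proof.
intros Hf Hg. apply IR_eq_lim; [now apply Good_plus |].
apply is_lim_seq_ext with
  (fun n => RInt f (- INR n) (INR n) + RInt g (- INR n) (INR n)).
- intros n. symmetry. apply (RInt_plus f g); apply cont_ex_RInt; [apply Hf | apply Hg].
- apply (is_lim_seq_plus' _ _ (IR f) (IR g)); now apply Good_IR_lim.
Qed.

Lemma IR_scal c f : Good f -> IR (fun x => c * f x) = c * IR f.
Proof.
intros Hf. apply IR_eq_lim; [now apply Good_scal |].
apply is_lim_seq_ext with (fun n => c * RInt f (- INR n) (INR n)).
- intros n. symmetry. apply (RInt_scal f _ _ c). apply cont_ex_RInt; apply Hf.
- apply (is_lim_seq_scal_l _ c (IR f)). now apply Good_IR_lim.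
Qed.

Lemma IR_minus f g : Good f -> Good g -> IR (fun x => f x - g x) = IR f - IR g.
Proof.
intros Hf Hg.
rewrite (IR_ext _ (fun x => f x + -1 * g x)) by (intros; ring).
rewrite IR_plus, IR_scal; [ring | assumption | assumption | now apply Good_scal].
Qed.

Lemma IR_le f g : Good f -> Good g -> (forall x, f x <= g x) -> IR f <= IR g.
Proof.
intros Hf Hg H.
assert (H1 := Good_IR_lim f Hf). assert (H2 := Good_IR_lim g Hg).
refine (is_lim_seq_le _ _ _ _ _ H1 H2).
intros n. apply RInt_le; [| apply cont_ex_RInt; apply Hf | apply cont_ex_RInt; apply Hg | auto].
assert (H3 := pos_INR n). lra.
Qed.

Lemma IR_abs_le f g : cont f -> Good g -> (forall x, Rabs (f x) <= g x) -> Rabs (IR f) <= IR g.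
Proof.
intros Hf Hg H. assert (Hf' := Good_le f g Hf Hg H).
apply Rabs_le. split.
- replace (- IR g) with (-1 * IR g) by ring. rewrite <- IR_scal by assumption.
  apply IR_le; [now apply Good_scal | assumption |].
  intros x. specialize (H x). apply Rabs_le_between in H. lra.
- apply IR_le; try assumption. intros x. specialize (H x). apply Rabs_le_between in H. lra.
Qed.

Lemma IR_FTC (F f : R -> R) (lm lp : R) : Good f -> (forall x, is_derive F x (f x)) ->
  is_lim F m_infty lm -> is_lim F p_infty lp -> IR f = lp - lm.
Proof.
intros Hf HF Hm Hp. apply IR_eq_lim; [exact Hf |].
apply is_lim_seq_ext with (fun n => F (INR n) - F (- INR n)).
- intros n. symmetry. apply is_RInt_unique. apply is_RInt_FTC; [exact HF | apply Hf].
- apply (is_lim_seq_minus' _ _ lp lm).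
  + apply (is_lim_comp_seq F _ p_infty lp Hp); [| apply is_lim_seq_INR].
    now exists 0%nat.
  + apply (is_lim_comp_seq F _ m_infty lm Hm); [| apply is_lim_seq_opp_INR].
    now exists 0%nat.
Qed.

Lemma dominated_lim d C f : 0 < d -> dominated d C f -> is_lim f m_infty 0 /\ is_lim f p_infty 0.
Proof.
intros Hd HC. assert (HC0 := dominated_nonneg _ _ _ HC).
assert (K : forall eps : posreal, exists M, forall x, M <= Rabs x -> Rabs (f x - 0) < eps).
{ intros eps. destruct (exp_neg_small d C eps Hd HC0) as [M [_ HM]]; [apply eps |].
  exists M. intros x Hx. rewrite Rminus_0_r. eapply Rle_lt_trans; [apply HC | now apply HM]. }
split; apply is_lim_spec; intros eps; destruct (K eps) as [M HM].
- exists (- M). intros x Hx. apply HM. rewrite <- Rabs_Ropp. eapply Rle_trans; [| apply Rle_abs]. lra.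
- exists M. intros x Hx. apply HM. eapply Rle_trans; [| apply Rle_abs]. lra.
Qed.

(** The working form of integration by parts: an identity between integrals is proved by exhibiting
    an antiderivative that itself decays. *)
Lemma IR_derive_0 (F f : R -> R) : Good f -> Good F -> (forall x, is_derive F x (f x)) -> IR f = 0.
Proof.
intros Hf [_ [d [C [Hd HC]]]] HF. destruct (dominated_lim d C F Hd HC) as [H1 H2].
rewrite (IR_FTC F f 0 0 Hf HF H1 H2). ring.
Qed.

Ltac good :=
  match goal with
  | H : Good ?f |- Good ?f => exact H
  | |- Good (fun _ => _ + _) => apply Good_plus; good
  | |- Good (fun _ => _ - _) => apply Good_minus; good
  | |- Good (fun _ => - _) => apply Good_opp; good
  | |- Good (fun _ => ?c * _) => apply Good_scal; good
  end.

(** * Fubini and differentiation under the integral sign *)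

Lemma cont2_slice_r F x : cont2 F -> cont (fun y => F x y).
Proof.
intros H y. apply continuity_pt_filterlim. intros eps He.
destruct (H x y (mkposreal eps He)) as [dl Hd]. exists dl. split; [apply dl |].
intros z [_ Hz]. apply Hd; [rewrite Rminus_diag, Rabs_R0; apply dl | exact Hz].
Qed.

Lemma cont2_slice_l F y : cont2 F -> cont (fun x => F x y).
Proof.
intros H x. apply continuity_pt_filterlim. intros eps He.
destruct (H x y (mkposreal eps He)) as [dl Hd]. exists dl. split; [apply dl |].
intros z [_ Hz]. apply Hd; [exact Hz | rewrite Rminus_diag, Rabs_R0; apply dl].
Qed.

Lemma cont2_swap F : cont2 F -> cont2 (fun x y => F y x).
Proof. intros H x y eps. destruct (H y x eps) as [dl Hd]. exists dl. auto. Qed.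

Lemma RInt_param_cont_le F a b : cont2 F -> a <= b -> cont (fun y => RInt (fun x => F x y) a b).
Proof.
intros HF Hab y. apply continuity_pt_filterlim. intros eps He.
(* The [+ 1] keeps the divisor positive when [a = b]; the factor 2 leaves room for the strict
   inequality. *)
assert (He' : 0 < eps / (2 * (b - a + 1))) by (apply Rdiv_lt_0_compat; lra).
destruct (uniform_continuity_2d_1d F a b y (fun x _ => HF x y) (mkposreal _ He')) as [dl Hd].
exists dl. split; [apply dl |]. intros z [_ Hz].
simpl. unfold Rdist.
assert (E : forall t, ex_RInt (fun x => F x t) a b) by (intros t; apply cont_ex_RInt, cont2_slice_l, HF).
rewrite <- (RInt_minus (fun x => F x z) (fun x => F x y)) by apply E.
eapply Rle_lt_trans.
- apply (abs_RInt_le_const _ a b (eps / (2 * (b - a + 1)))); [exact Hab | apply @ex_RInt_minus; apply E |].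
  intros t Ht. left. apply Rabs_lt_between' in Hz.

  apply Hd; try lra. rewrite Rminus_diag, Rabs_R0. apply dl.
- apply Rlt_le_trans with ((b - a + 1) * (eps / (2 * (b - a + 1))) * 2).
  + nra.
  + right. field. lra.
Qed.

Lemma RInt_param_cont F a b : cont2 F -> cont (fun y => RInt (fun x => F x y) a b).
Proof.
intros HF. destruct (Rle_dec a b) as [H|H]; [now apply RInt_param_cont_le |].
intros y. apply continuous_ext with (fun y => - RInt (fun x => F x y) b a).
- intros z. apply (opp_RInt_swap (fun x => F x z)). apply cont_ex_RInt, cont2_slice_l, HF.
- apply (cont_opp (fun y => RInt (fun x => F x y) b a)). apply RInt_param_cont_le; [exact HF | lra].
Qed.

Lemma RInt_derive_upper f a b : cont f -> is_derive (fun t => RInt f a t) b (f b).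
Proof.
intros Hf. apply is_derive_RInt with a; [| apply Hf].
apply filter_forall. intros t. apply @RInt_correct. now apply cont_ex_RInt.
Qed.

(** As functions of the upper limit [b], both sides have derivative [RInt (fun y => F b y) c e] and
    vanish at [b = a]. *)
Lemma Fubini_rect F a b c e : cont2 F ->
  RInt (fun x => RInt (fun y => F x y) c e) a b = RInt (fun y => RInt (fun x => F x y) a b) c e.
Proof.
intros HF.
assert (HD : forall t, is_derive (fun t => RInt (fun y => RInt (fun x => F x y) a t) c e) t
   (RInt (fun y => F t y) c e)).
{ intros t.
  assert (HD0 : forall z y, is_derive (fun u => RInt (fun x => F x y) a u) z (F z y)).
  { intros z y. apply (RInt_derive_upper (fun x => F x y)). now apply cont2_slice_l. }
  rewrite (RInt_ext (fun y => F t y) (fun y => Derive (fun u => RInt (fun x => F x y) a u) t)).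
  2:{ intros y _. symmetry. apply is_derive_unique. apply HD0. }
  apply (is_derive_RInt_param (fun u y => RInt (fun x => F x y) a u)).
  - apply filter_forall. intros z y _. eexists. apply HD0.
  - intros y _. apply continuity_2d_pt_ext with F; [| apply HF].
    intros u v. symmetry. apply is_derive_unique. apply HD0.
  - apply filter_forall. intros z. apply cont_ex_RInt. now apply RInt_param_cont. }
apply is_RInt_unique.
replace (RInt (fun y => RInt (fun x => F x y) a b) c e) with
 (RInt (fun y => RInt (fun x => F x y) a b) c e - RInt (fun y => RInt (fun x => F x y) a a) c e).
- apply (is_RInt_FTC (fun t => RInt (fun y => RInt (fun x => F x y) a t) c e)); [exact HD |].
  apply (RInt_param_cont (fun y x => F x y)). now apply cont2_swap.
- rewrite (RInt_ext (fun y => RInt (fun x => F x y) a a) (fun _ => 0)).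
  2:{ intros y _. exact (RInt_point a (fun x : R => F x y)). }
  rewrite RInt_const. unfold scal; simpl; unfold mult; simpl. ring.
Qed.

Definition udom d C (F : R -> R -> R) := forall x y, Rabs (F x y) <= C * exp (- (d * Rabs x)).

Lemma udom_Good d C F y : 0 < d -> cont2 F -> udom d C F -> Good (fun x => F x y).
Proof.
intros Hd HF HC. split; [now apply cont2_slice_l |]. exists d, C. split; [exact Hd |].
intros x. apply HC.
Qed.

Lemma IR_param_cont d C F : 0 < d -> cont2 F -> udom d C F -> cont (fun y => IR (fun x => F x y)).
Proof.
intros Hd HF HC y. apply continuity_pt_filterlim. intros eps He.
assert (HC0 : 0 <= C) by (apply (dominated_nonneg d C (fun x => F x 0)); intros x; apply HC).
destruct (exp_neg_small d (2 * C / d) (eps / 3) Hd) as [M [HM0 HM]];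
  [apply Rdiv_le_0_compat; lra | lra |].
specialize (HM M (Rle_refl _)).
assert (H1 := RInt_param_cont F (- M) M HF y).
apply continuity_pt_filterlim in H1.
destruct (H1 (eps / 3)) as [dl [Hd0 Hdl]]; [lra |].
exists dl. split; [exact Hd0 |]. intros z Hz. specialize (Hdl z Hz).
assert (T : forall t, Rabs (RInt (fun x => F x t) (- M) M - IR (fun x => F x t)) < eps / 3).
{ intros t. eapply Rle_lt_trans; [apply (IR_tail d C _ M); try lra | exact HM].
  - now apply cont2_slice_l.
  - intros x. apply HC. }
assert (T1 := T y). assert (T2 := T z).
apply Rabs_lt_between in T1. apply Rabs_lt_between in T2. apply Rabs_lt_between in Hdl.
apply Rabs_lt_between. lra.
Qed.

Lemma Good_exp_abs d C : 0 < d -> Good (fun x => C * exp (- (d * Rabs x))).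
Proof.
intros Hd. apply Good_scal. split.
- apply (cont_comp (fun y => exp (- (d * y))) Rabs); [| intros x; apply continuous_Rabs].
  apply cont_of_ex_derive. intros x. auto_derive. exact I.
- exists d, 1. split; [exact Hd |]. intros x. rewrite Rabs_pos_eq; [lra |].
  left; apply exp_pos.
Qed.

(** Truncate the unbounded variable, use [Fubini_rect], and let the truncation grow; [IR_tail] makes
    the error uniform in [y], so it survives the integral over the compact interval. *)
Lemma Fubini_mixed d C F a b : 0 < d -> cont2 F -> udom d C F ->
  Good (fun x => RInt (fun y => F x y) a b) /\
  IR (fun x => RInt (fun y => F x y) a b) = RInt (fun y => IR (fun x => F x y)) a b.
Proof.
intros Hd HF HC.
assert (HC0 : 0 <= C) by (apply (dominated_nonneg d C (fun x => F x 0)); intros x; apply HC).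
assert (HG : Good (fun x => RInt (fun y => F x y) a b)).
{ split; [apply (RInt_param_cont (fun y x => F x y)); now apply cont2_swap |].
  exists d, (C * Rabs (b - a)). split; [exact Hd |]. intros x.
  assert (K : forall a b, a <= b -> Rabs (RInt (fun y => F x y) a b)
     <= C * Rabs (b - a) * exp (- (d * Rabs x))).
  { intros a0 b0 Hab. rewrite (Rabs_pos_eq (b0 - a0)) by lra.
    eapply Rle_trans; [apply (abs_RInt_le_const _ a0 b0 (C * exp (- (d * Rabs x)))); [exact Hab | |] |].
    - now apply cont_ex_RInt, cont2_slice_r.
    - intros t _. apply HC.
    - right; ring. }
  destruct (Rle_dec a b) as [H|H]; [now apply K |].
  assert (E := opp_RInt_swap (fun y => F x y) b a (cont_ex_RInt _ _ _ (cont2_slice_r F x HF))).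
  rewrite <- E. rewrite Rabs_Ropp, Rabs_minus_sym. apply K. lra. }
split; [exact HG |].
apply IR_eq_lim; [exact HG |].
apply is_lim_seq_ext with
  (fun n => RInt (fun y => RInt (fun x => F x y) (- INR n) (INR n)) a b).
{ intros n. symmetry. now apply Fubini_rect. }
assert (Hcont := IR_param_cont d C F Hd HF HC).
apply is_lim_seq_spec. intros eps.
assert (He : 0 < eps / (Rabs (b - a) + 1)).
{ apply Rdiv_lt_0_compat; [apply eps | assert (H := Rabs_pos (b - a)); lra]. }
destruct (exp_neg_small d (2 * C / d) _ Hd (Rdiv_le_0_compat (2 * C) d ltac:(lra) Hd) He) as [M [HM0 HM]].
destruct (nfloor_ex M HM0) as [N [HN1 HN2]].
exists (S N). intros n Hn. apply le_INR in Hn. rewrite S_INR in Hn.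
specialize (HM (INR n) ltac:(lra)).
assert (E1 : forall a b, ex_RInt (fun y => RInt (fun x => F x y) (- INR n) (INR n)) a b)
  by (intros; apply cont_ex_RInt; now apply RInt_param_cont).
assert (E2 : forall a b, ex_RInt (fun y => IR (fun x => F x y)) a b) by (intros; now apply cont_ex_RInt).
assert (K : forall a b, a <= b -> Rabs (RInt (fun y => RInt (fun x => F x y) (- INR n) (INR n)) a b
    - RInt (fun y => IR (fun x => F x y)) a b) <= (b - a) * (2 * C / d * exp (- (d * INR n)))).
{ intros a0 b0 Hab.
  rewrite <- (RInt_minus (fun y => RInt (fun x => F x y) (- INR n) (INR n))
     (fun y => IR (fun x => F x y))) by auto.
  apply abs_RInt_le_const; [exact Hab | apply @ex_RInt_minus; auto |].
  intros t _.
  apply (IR_tail d C (fun x => F x t) (INR n)); try lra.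
  - now apply cont2_slice_l.
  - intros x. apply HC. }
assert (K' : Rabs (RInt (fun y => RInt (fun x => F x y) (- INR n) (INR n)) a b
    - RInt (fun y => IR (fun x => F x y)) a b) <= Rabs (b - a) * (2 * C / d * exp (- (d * INR n)))).
{ destruct (Rle_dec a b) as [H|H].
  - rewrite (Rabs_pos_eq (b - a)) by lra. now apply K.
  - rewrite <- (opp_RInt_swap (fun y => RInt (fun x => F x y) (- INR n) (INR n)) b a) by auto.
    rewrite <- (opp_RInt_swap (fun y => IR (fun x => F x y)) b a) by auto.
    unfold opp; simpl. rewrite <- Rabs_Ropp.
    replace (- (- RInt (fun y => RInt (fun x => F x y) (- INR n) (INR n)) b a -
      - RInt (fun y => IR (fun x => F x y)) b a)) with
      (RInt (fun y => RInt (fun x => F x y) (- INR n) (INR n)) b a -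
       RInt (fun y => IR (fun x => F x y)) b a) by ring.
    rewrite (Rabs_minus_sym b a), (Rabs_pos_eq (a - b)) by lra. apply K. lra. }
eapply Rle_lt_trans; [exact K' |].
assert (Hp := Rabs_pos (b - a)).
apply Rle_lt_trans with (Rabs (b - a) * (eps / (Rabs (b - a) + 1))).
- apply Rmult_le_compat_l; lra.
- apply Rmult_lt_reg_r with (Rabs (b - a) + 1); [lra |].
  replace (Rabs (b - a) * (eps / (Rabs (b - a) + 1)) * (Rabs (b - a) + 1))
    with (Rabs (b - a) * eps) by (field; lra).
  assert (He' := cond_pos eps). nra.
Qed.

Definition udom2 d C (F : R -> R -> R) :=
  forall x y, Rabs (F x y) <= C * (exp (- (d * Rabs x)) * exp (- (d * Rabs y))).

Lemma udom2_udom d C F : 0 < d -> udom2 d C F -> 0 <= C /\ udom d C F.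
Proof.
intros Hd H.
assert (HC : 0 <= C).
{ specialize (H 0 0). rewrite Rabs_R0, Rmult_0_r, Ropp_0, exp_0 in H.
  assert (H1 := Rabs_pos (F 0 0)). lra. }
split; [exact HC |]. intros x y. eapply Rle_trans; [apply H |].
apply Rmult_le_compat_l; [exact HC |].
rewrite <- (Rmult_1_r (exp (- (d * Rabs x)))) at 2.
apply Rmult_le_compat_l; [left; apply exp_pos |].
rewrite <- exp_0. apply exp_le_mono. assert (H1 := Rabs_pos y). nra.
Qed.

Lemma udom2_swap d C F : udom2 d C F -> udom2 d C (fun x y => F y x).
Proof. intros H x y. rewrite (Rmult_comm (exp _)). apply H. Qed.

Lemma IR_inner_Good d C F : 0 < d -> cont2 F -> udom2 d C F -> Good (fun x => IR (fun y => F x y)).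
Proof.
intros Hd HF HC. split.
- apply (IR_param_cont d C (fun y x => F x y)); [exact Hd | now apply cont2_swap |].
  apply udom2_udom; [exact Hd | now apply udom2_swap].
- exists d, (2 * C / d). split; [exact Hd |]. intros x.
  replace (2 * C / d * exp (- (d * Rabs x))) with (2 * (C * exp (- (d * Rabs x))) / d)
    by (field; lra).
  apply IR_le_const; [exact Hd | now apply cont2_slice_r |].
  intros y. rewrite Rmult_assoc. apply HC.
Qed.

(** The tail of the inner integral in [y] carries both the small factor [e^(-d n)] and the decay in
    [x], so it remains small after the outer integration. *)
Lemma Fubini_IR d C F : 0 < d -> cont2 F -> udom2 d C F ->
  IR (fun x => IR (fun y => F x y)) = IR (fun y => IR (fun x => F x y)).
Proof.
intros Hd HF HC.
destruct (udom2_udom d C F Hd HC) as [HC0 HU].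
assert (HG := IR_inner_Good d C F Hd HF HC).
assert (HG' := IR_inner_Good d C _ Hd (cont2_swap _ HF) (udom2_swap _ _ _ HC)).
symmetry. apply IR_eq_lim; [exact HG' |].
apply is_lim_seq_ext with (fun n => IR (fun x => RInt (fun y => F x y) (- INR n) (INR n))).
{ intros n. now apply (Fubini_mixed d C). }
assert (Hb := Good_exp_abs d (2 * C / d) Hd).
set (B := IR (fun x => 2 * C / d * exp (- (d * Rabs x)))).
assert (HB : 0 <= B).
{ eapply Rle_trans; [apply Rabs_pos |].
  apply (IR_abs_le (fun x => IR (fun y => F x y))); [apply HG | exact Hb |].
  intros x. replace (2 * C / d * exp (- (d * Rabs x))) with (2 * (C * exp (- (d * Rabs x))) / d)
    by (field; lra).
  apply IR_le_const; [exact Hd | now apply cont2_slice_r |].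
  intros y. rewrite Rmult_assoc. apply HC. }
apply is_lim_seq_spec. intros eps.
destruct (exp_neg_small d B eps Hd HB) as [M [HM0 HM]]; [apply eps |].
destruct (nfloor_ex M HM0) as [N [HN1 HN2]].
exists (S N). intros n Hn. apply le_INR in Hn. rewrite S_INR in Hn.
specialize (HM (INR n) ltac:(lra)).
destruct (Fubini_mixed d C F (- INR n) (INR n) Hd HF HU) as [HGn _].
rewrite <- IR_minus by assumption.
eapply Rle_lt_trans; [| exact HM].
unfold B. rewrite Rmult_comm, <- IR_scal by exact Hb.
apply IR_abs_le; [apply Good_minus; assumption | now apply Good_scal |].
intros x.
replace (exp (- (d * INR n)) * (2 * C / d * exp (- (d * Rabs x)))) with
  (2 * (C * exp (- (d * Rabs x))) / d * exp (- (d * INR n))) by (field; lra).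
apply IR_tail; try lra; [now apply cont2_slice_r |].
intros y. rewrite Rmult_assoc. apply HC.
Qed.

(** Retraction onto [[a, b]]. Composing the parameter with it turns hypotheses on a compact
    parameter interval into the global ones that the continuity and Fubini lemmas ask for, without
    changing values inside the interval. *)
Definition clamp a b y := Rmax a (Rmin b y).

Lemma clamp_in a b y : a <= b -> a <= clamp a b y <= b.
Proof. intros H. unfold clamp, Rmax, Rmin. repeat destruct (Rle_dec _ _); lra. Qed.

Lemma clamp_id a b y : a <= y <= b -> clamp a b y = y.
Proof. intros H. unfold clamp, Rmax, Rmin. repeat destruct (Rle_dec _ _); lra. Qed.

Lemma clamp_lip a b y z : Rabs (clamp a b y - clamp a b z) <= Rabs (y - z).
Proof.
unfold clamp, Rmax, Rmin. unfold Rabs.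
repeat destruct (Rle_dec _ _); repeat destruct (Rcase_abs _); lra.
Qed.

Lemma cont2_clamp F a b : a <= b -> (forall x y, a <= y <= b -> continuity_2d_pt F x y) ->
  cont2 (fun x y => F x (clamp a b y)).
Proof.
intros Hab H x y eps. destruct (H x (clamp a b y) (clamp_in a b y Hab) eps) as [dl Hd].
exists dl. intros u v Hu Hv. apply Hd; [exact Hu |].
eapply Rle_lt_trans; [apply clamp_lip | exact Hv].
Qed.

(** Difference quotients are avoided: exchanging [IR] with the integral of [f1] over [[a, q]] writes
    the left-hand function as a constant plus an integral of a continuous function, and the
    fundamental theorem differentiates it. *)
Lemma is_derive_IR (f f1 : R -> R -> R) a b d C p : a < p < b -> 0 < d ->
  (forall x q, a <= q <= b -> is_derive (f x) q (f1 x q)) ->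
  (forall x q, a <= q <= b -> continuity_2d_pt f1 x q) ->
  (forall x q, a <= q <= b -> Rabs (f1 x q) <= C * exp (- (d * Rabs x))) ->
  (forall q, a <= q <= b -> Good (fun x => f x q)) ->
  is_derive (fun q => IR (fun x => f x q)) p (IR (fun x => f1 x p)).
Proof.
intros Hp Hd Hder Hcont Hdom HG.
set (g := fun x q => f1 x (clamp a b q)).
assert (Hg : cont2 g) by (apply cont2_clamp; [lra | exact Hcont]).
assert (Hgd : udom d C g) by (intros x q; apply Hdom, clamp_in; lra).
assert (HI := IR_param_cont d C g Hd Hg Hgd).
rewrite (IR_ext (fun x => f1 x p) (fun x => g x p)).
2:{ intros x. unfold g. now rewrite clamp_id by lra. }
apply is_derive_ext_loc with
  (fun q => IR (fun x => f x a) + RInt (fun q => IR (fun x => g x q)) a q).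
- assert (He : 0 < Rmin (p - a) (b - p)) by (apply Rmin_glb_lt; lra).
  exists (mkposreal _ He). intros q Hq.
  assert (Hq' : a <= q <= b).
  { unfold ball in Hq; simpl in Hq; unfold AbsRing_ball, abs, minus, plus, opp in Hq; simpl in Hq.
    assert (H1 := Rmin_l (p - a) (b - p)). assert (H2 := Rmin_r (p - a) (b - p)).
    apply Rabs_lt_between in Hq. lra. }
  destruct (Fubini_mixed d C g a q Hd Hg Hgd) as [G1 G2].
  rewrite <- G2.
  replace (IR (fun x => f x q)) with (IR (fun x => f x a) + (IR (fun x => f x q) - IR (fun x => f x a)))
    by ring.
  rewrite <- IR_minus by (apply HG; lra).
  f_equal. apply IR_ext. intros x. apply is_RInt_unique.
  apply is_RInt_ext with (f1 x).
  { intros t. rewrite Rmin_left, Rmax_right by lra. intros Ht. unfold g. now rewrite clamp_id by lra. }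
  apply (is_RInt_derive (f x) (f1 x)).
  + intros t. rewrite Rmin_left, Rmax_right by lra. intros Ht. apply Hder. lra.
  + intros t. rewrite Rmin_left, Rmax_right by lra. intros Ht.
    apply continuity_pt_filterlim. intros eps Heps.
    destruct (Hcont x t ltac:(lra) (mkposreal eps Heps)) as [dl Hdl]. exists dl.
    split; [apply dl |]. intros z [_ Hz].
    apply Hdl; [rewrite Rminus_diag, Rabs_R0; apply dl | exact Hz].
- replace (IR (fun x => g x p)) with (plus 0 (IR (fun x => g x p))) by (apply Rplus_0_l).
  apply @is_derive_plus; [apply @is_derive_const |].
  now apply (RInt_derive_upper (fun q => IR (fun x => g x q))).
Qed.

Lemma continuity_pt_of_ex_derive (f : R -> R) x : ex_derive f x -> continuity_pt f x.
Proof.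
intros H. apply continuity_pt_filterlim. exact (ex_derive_continuous f x H).
Qed.

Lemma continuity_2d_pt_fst (g : R -> R) x y : continuity_pt g x ->
  continuity_2d_pt (fun u _ => g u) x y.
Proof. intros H. apply (continuity_1d_2d_pt_comp g); [exact H | apply continuity_2d_pt_id1]. Qed.

Lemma continuity_2d_pt_snd (g : R -> R) x y : continuity_pt g y ->
  continuity_2d_pt (fun _ v => g v) x y.
Proof. intros H. apply (continuity_1d_2d_pt_comp g); [exact H | apply continuity_2d_pt_id2]. Qed.

Ltac cont_1d := apply continuity_pt_of_ex_derive; auto_derive.

Ltac cont_2d :=
  lazymatch goal with
  | |- cont2 _ => intros ? ?; cont_2d
  | |- continuity_2d_pt (fun _ _ => ?c) _ _ => apply continuity_2d_pt_const
  | |- continuity_2d_pt (fun u _ => u) _ _ => apply continuity_2d_pt_id1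
  | |- continuity_2d_pt (fun _ v => v) _ _ => apply continuity_2d_pt_id2
  | |- continuity_2d_pt Rplus _ _ => apply (continuity_2d_pt_plus (fun u _ => u) (fun _ v => v)); cont_2d
  | |- continuity_2d_pt Rminus _ _ => apply (continuity_2d_pt_minus (fun u _ => u) (fun _ v => v)); cont_2d
  | |- continuity_2d_pt Rmult _ _ => apply (continuity_2d_pt_mult (fun u _ => u) (fun _ v => v)); cont_2d
  | |- continuity_2d_pt (fun u v => _ + _) _ _ => apply continuity_2d_pt_plus; cont_2d
  | |- continuity_2d_pt (fun u v => _ - _) _ _ => apply continuity_2d_pt_minus; cont_2d
  | |- continuity_2d_pt (fun u v => _ * _) _ _ => apply continuity_2d_pt_mult; cont_2d
  | |- continuity_2d_pt (fun u v => - _) _ _ => apply continuity_2d_pt_opp; cont_2d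
  | |- continuity_2d_pt (fun u v => _ / _) _ _ => unfold Rdiv; apply continuity_2d_pt_mult; cont_2d
  | |- continuity_2d_pt (fun u v => / _) _ _ => apply continuity_2d_pt_inv; [cont_2d |]
  | |- continuity_2d_pt (fun u v => exp _) _ _ =>
      apply (continuity_1d_2d_pt_comp exp); [cont_1d; exact I | cont_2d]
  | |- continuity_2d_pt (fun u v => cos _) _ _ =>
      apply (continuity_1d_2d_pt_comp cos); [cont_1d; exact I | cont_2d]
  | |- continuity_2d_pt (fun u v => sin _) _ _ =>
      apply (continuity_1d_2d_pt_comp sin); [cont_1d; exact I | cont_2d]
  | |- continuity_2d_pt (fun u v => cosh _) _ _ =>
      apply (continuity_1d_2d_pt_comp cosh); [cont_1d; exact I | cont_2d]
  | |- continuity_2d_pt (fun u v => sinh _) _ _ =>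
      apply (continuity_1d_2d_pt_comp sinh); [cont_1d; exact I | cont_2d]
  | _ => idtac
  end.

(** The weight [e^(-y) dy] in the variable [y = e^r]; it coincides with the later Gamma weight
    [gam_w 1]. *)
Definition phi r := exp (r - exp r).

Lemma mul_minus_exp_le a r : 0 < a -> a * r - exp r <= a * ln a - a.
Proof.
intros Ha.
assert (H := exp_ineq1_le (r - ln a)).
unfold Rminus in H. rewrite exp_plus, exp_Ropp, exp_ln in H by assumption.
assert (H1 : a * (1 + (r - ln a)) <= exp r).
{ apply Rmult_le_reg_l with (/ a); [now apply Rinv_0_lt_compat |].
  rewrite <- Rmult_assoc, Rinv_l, Rmult_1_l by lra. lra. }
nra.
Qed.

(* [y^a e^(-y) <= K] with [y = e^r] *)
Lemma exp_minus_exp_bound a : 0 <= a -> exists K, 0 < K /\ forall r, exp (a * r - exp r) <= K.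
Proof.
intros Ha. destruct (Req_dec a 0) as [->|Hn].
- exists 1. split; [lra |]. intros r. rewrite <- exp_0. apply exp_le_mono.
  assert (H := exp_pos r). lra.
- exists (exp (a * ln a - a)). split; [apply exp_pos |]. intros r. apply exp_le_mono.
  apply mul_minus_exp_le. lra.
Qed.

(** In [y = e^r] this is [y e^(-y) <= K y^(-b)]. The freedom in [b] allows the power to be chosen
    according to the sign of the argument. *)
Lemma phi_bound b : -1 <= b -> exists K, 0 < K /\ forall r, phi r <= K * exp (- (b * r)).
Proof.
intros Hb. destruct (exp_minus_exp_bound (1 + b) ltac:(lra)) as [K [HK H]].
exists K. split; [exact HK |]. intros r. unfold phi.
replace (r - exp r) with (((1 + b) * r - exp r) + - (b * r)) by ring. rewrite exp_plus.
apply Rmult_le_compat_r; [left; apply exp_pos | apply H].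
Qed.

Lemma Good_of_two_sided f d K1 K2 : 0 < d -> cont f ->
  (forall x, Rabs (f x) <= K1 * exp (d * x)) -> (forall x, Rabs (f x) <= K2 * exp (- (d * x))) -> Good f.
Proof.
intros Hd Hc H1 H2. split; [exact Hc |]. exists d, (Rmax K1 K2). split; [exact Hd |].
intros x. unfold Rabs at 2. destruct (Rcase_abs x) as [Hx|Hx].
- eapply Rle_trans; [apply H1 |]. replace (- (d * - x)) with (d * x) by ring.
  apply Rmult_le_compat_r; [left; apply exp_pos | apply Rmax_l].
- eapply Rle_trans; [apply H2 |].
  apply Rmult_le_compat_r; [left; apply exp_pos | apply Rmax_r].
Qed.

Lemma Good_exp_phi a : 0 < a -> Good (fun r => exp (a * r - exp r)).
Proof.
intros Ha. destruct (exp_minus_exp_bound (a + a) ltac:(lra)) as [K [HK H]].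
apply Good_of_two_sided with a 1 K; [lra | | |].
- apply cont_of_ex_derive. intros x. auto_derive. exact I.
- intros x. rewrite Rabs_pos_eq by (left; apply exp_pos). rewrite Rmult_1_l.
  apply exp_le_mono. assert (H1 := exp_pos x). lra.
- intros x. rewrite Rabs_pos_eq by (left; apply exp_pos).
  replace (a * x - exp x) with (((a + a) * x - exp x) + - (a * x)) by ring. rewrite exp_plus.
  apply Rmult_le_compat_r; [left; apply exp_pos | apply H].
Qed.

Lemma Good_phi : Good phi.
Proof.
apply Good_ext with (fun r => exp (1 * r - exp r)).
- intros x. now rewrite Rmult_1_l.
- apply Good_exp_phi. lra.
Qed.

Lemma phi_two_sided : exists K, 0 < K /\ forall r, phi r <= K * exp (- Rabs r).
Proof.
destruct (phi_bound 1 ltac:(lra)) as [K1 [H1 H1']].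
destruct (phi_bound (-1) ltac:(lra)) as [K2 [H2 H2']].
exists (Rmax K1 K2). split; [eapply Rlt_le_trans; [exact H1 | apply Rmax_l] |].
intros r. unfold Rabs. destruct (Rcase_abs r).
- eapply Rle_trans; [apply H2' |]. replace (- (-1 * r)) with (- - r) by ring.
  apply Rmult_le_compat_r; [left; apply exp_pos | apply Rmax_r].
- eapply Rle_trans; [apply H1' |]. rewrite Rmult_1_l.
  apply Rmult_le_compat_r; [left; apply exp_pos | apply Rmax_l].
Qed.

(** * The Fourier integrals of hyperbolic kernels *)

Lemma const_of_derive_0 f a b x y : (forall z, a < z < b -> is_derive f z 0) ->
  a < x < b -> a < y < b -> f x = f y.
Proof.
intros H Hx Hy.
assert (Hm : forall z, Rmin x y <= z <= Rmax x y -> a < z < b).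
{ intros z. unfold Rmin, Rmax. destruct (Rle_dec x y); lra. }
destruct (MVT_gen f x y (fun _ => 0)) as [z [_ Hz]].
- intros z Hz. apply H, Hm. lra.
- intros z Hz. apply continuity_pt_of_ex_derive. eexists. apply H, Hm, Hz.
- lra.
Qed.

(** Used to pass to [q = pi], where the kernel [poisson] degenerates while the closed formulas being
    compared are still continuous. *)
Lemma nonpos_at_right_end g a b : a < b -> continuity_pt g b ->
  (forall x, a < x < b -> g x <= 0) -> g b <= 0.
Proof.
intros Hab Hc H. apply Rnot_lt_le. intros Hg.
destruct (Hc (g b) Hg) as [dl [Hd Hdl]].
assert (Hm : 0 < Rmin dl (b - a)) by (apply Rmin_glb_lt; lra).
assert (H1 := Rmin_l dl (b - a)). assert (H2 := Rmin_r dl (b - a)).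
set (x := b - Rmin dl (b - a) / 2).
specialize (H x ltac:(unfold x; lra)).
assert (K : Rabs (g x - g b) < g b).
{ apply Hdl. split; [split; [exact I | unfold x; lra] |].
  unfold Rdist, x. apply Rabs_lt_between. lra. }
apply Rabs_lt_between in K. lra.
Qed.

Lemma is_lim_p_of_bound f l d K : 0 < d -> 0 <= K ->
  (forall x, 0 <= x -> Rabs (f x - l) <= K * exp (- (d * x))) -> is_lim f p_infty l.
Proof.
intros Hd HK H. apply is_lim_spec. intros eps.
destruct (exp_neg_small d K eps Hd HK) as [M [HM0 HM]]; [apply eps |].
exists M. intros x Hx. eapply Rle_lt_trans; [apply H; lra | apply HM; lra].
Qed.

Lemma is_lim_m_of_bound f l d K : 0 < d -> 0 <= K ->
  (forall x, x <= 0 -> Rabs (f x - l) <= K * exp (d * x)) -> is_lim f m_infty l.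
Proof.
intros Hd HK H. apply is_lim_spec. intros eps.
destruct (exp_neg_small d K eps Hd HK) as [M [HM0 HM]]; [apply eps |].
exists (- M). intros x Hx. eapply Rle_lt_trans; [apply H; lra |].
replace (d * x) with (- (d * (- x))) by ring. apply HM; lra.
Qed.

Lemma cosh_ge_1 t : 1 <= cosh t.
Proof.
unfold cosh. assert (H := exp_pos t). rewrite exp_Ropp.
assert (H1 : exp t + / exp t - 2 = (exp t - 1) ^ 2 / exp t) by (field; lra).
assert (H2 : 0 <= (exp t - 1) ^ 2 / exp t).
{ apply Rdiv_le_0_compat; [apply pow2_ge_0 | exact H]. }
lra.
Qed.

Lemma exp_Rabs_le_cosh t : exp (Rabs t) <= 2 * cosh t.
Proof.
unfold cosh. assert (H := exp_pos t). assert (H1 := exp_pos (- t)).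
unfold Rabs. destruct (Rcase_abs t); lra.
Qed.

Lemma Good_of_cosh f K : cont f -> (forall t, Rabs (f t) <= K / cosh t) -> Good f.
Proof.
intros Hc H. split; [exact Hc |]. exists 1, (2 * K). split; [lra |].
intros t. eapply Rle_trans; [apply H |]. rewrite Rmult_1_l, exp_Ropp.
assert (H1 := exp_Rabs_le_cosh t). assert (H3 := exp_pos (Rabs t)).
assert (HK : 0 <= K).
{ specialize (H t). assert (H4 := Rabs_pos (f t)).
  assert (H5 : 0 <= K / cosh t * cosh t) by (apply Rmult_le_pos; lra).
  unfold Rdiv in H5. rewrite Rmult_assoc, Rinv_l in H5; lra. }
apply Rmult_le_reg_r with (cosh t * exp (Rabs t)); [nra |].
replace (K / cosh t * (cosh t * exp (Rabs t))) with (K * exp (Rabs t)) by (field; lra).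
replace (2 * K * / exp (Rabs t) * (cosh t * exp (Rabs t))) with (K * (2 * cosh t)) by (field; lra).
now apply Rmult_le_compat_l.
Qed.

Lemma sinh_sq t : sinh t * sinh t = cosh t * cosh t - 1.
Proof.
assert (H := exp_pos t). unfold sinh, cosh. rewrite exp_Ropp. field. lra.
Qed.

Lemma Rabs_sinh_le_cosh t : Rabs (sinh t) <= cosh t.
Proof.
unfold sinh, cosh. assert (H := exp_pos t). assert (H1 := exp_pos (- t)).
apply Rabs_le. lra.
Qed.

Lemma is_derive_cosh t : is_derive cosh t (sinh t).
Proof. apply is_derive_Reals. apply derivable_pt_lim_cosh. Qed.

Lemma is_derive_sinh t : is_derive sinh t (cosh t).
Proof. apply is_derive_Reals. apply derivable_pt_lim_sinh. Qed.

(* [tanh (t/2)] *)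
Definition tanh_half t := 1 - 2 / (1 + exp t).

Lemma is_derive_tanh_half t : is_derive tanh_half t (/ (1 + cosh t)).
Proof.
assert (H := exp_pos t).
unfold tanh_half. auto_derive; [lra |].
unfold cosh in *. rewrite exp_Ropp in *.
field. repeat split; nra.
Qed.

Lemma tanh_half_lim_p : is_lim tanh_half p_infty 1.
Proof.
apply is_lim_p_of_bound with 1 2; try lra. intros x _.
assert (H := exp_pos x). unfold tanh_half.
replace (1 - 2 / (1 + exp x) - 1) with (- (2 / (1 + exp x))) by ring.
rewrite Rabs_Ropp, Rabs_pos_eq by (apply Rdiv_le_0_compat; lra).
rewrite Rmult_1_l, exp_Ropp. apply Rmult_le_compat_l; [lra |].
apply Rinv_le_contravar; lra.
Qed.

Lemma tanh_half_lim_m : is_lim tanh_half m_infty (-1).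
Proof.
apply is_lim_m_of_bound with 1 2; try lra. intros x _.
assert (H := exp_pos x). unfold tanh_half.
replace (1 - 2 / (1 + exp x) - -1) with (2 * exp x / (1 + exp x)) by (field; lra).
rewrite Rabs_pos_eq by (apply Rdiv_le_0_compat; lra).
rewrite Rmult_1_l. apply Rmult_le_reg_r with (1 + exp x); [lra |].
replace (2 * exp x / (1 + exp x) * (1 + exp x)) with (2 * exp x) by (field; lra). nra.
Qed.

(** [1/(1 + cosh t)] is [sech^2 (t/2) / 2], the derivative of [tanh (t/2)]. Its Fourier transform is
    the one constant through which the hyperbolic kernels are evaluated. *)
Definition sech_int tau := IR (fun t => cos (tau * t) / (1 + cosh t)).

Lemma cont_cos_lin tau : cont (fun t => cos (tau * t)).
Proof. apply cont_of_ex_derive. intros t. auto_derive. exact I. Qed.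

Lemma cont_sin_lin tau : cont (fun t => sin (tau * t)).
Proof. apply cont_of_ex_derive. intros t. auto_derive. exact I. Qed.

Lemma Rabs_cos_le_1 x : Rabs (cos x) <= 1.
Proof. apply Rabs_le. apply COS_bound. Qed.

Lemma Rabs_sin_le_1 x : Rabs (sin x) <= 1.
Proof. apply Rabs_le. apply SIN_bound. Qed.

Lemma Good_inv_1_cosh : Good (fun t => / (1 + cosh t)).
Proof.
apply Good_of_cosh with 1.
- apply cont_of_ex_derive. intros t. assert (H := cosh_ge_1 t).
  apply ex_derive_inv; [| lra]. apply @ex_derive_plus; [apply @ex_derive_const |].
  eexists. apply is_derive_cosh.
- intros t. assert (H := cosh_ge_1 t).
  rewrite Rabs_pos_eq by (left; apply Rinv_0_lt_compat; lra).
  unfold Rdiv. rewrite Rmult_1_l. apply Rinv_le_contravar; lra.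
Qed.

Lemma tanh_half_diff u t :
  sinh u / (cosh u + cosh t) = / 2 * (tanh_half (t + u) - tanh_half (t - u)).
Proof.
unfold tanh_half, sinh, cosh. replace (t - u) with (t + - u) by ring. rewrite !exp_plus, !exp_Ropp.
assert (Hu := exp_pos u). assert (Ht := exp_pos t).
set (x := exp u) in *. set (y := exp t) in *.
field. repeat split; nra.
Qed.

Lemma Good_sinh_over_cosh u : Good (fun t => sinh u / (cosh u + cosh t)).
Proof.
assert (Hu := cosh_ge_1 u).
apply Good_scal. apply Good_of_cosh with 1.
- apply cont_of_ex_derive. intros t. assert (H := cosh_ge_1 t).
  apply ex_derive_inv; [| lra]. apply @ex_derive_plus; [apply @ex_derive_const |].
  eexists. apply is_derive_cosh.
- intros t. assert (H := cosh_ge_1 t).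
  rewrite Rabs_pos_eq by (left; apply Rinv_0_lt_compat; lra).
  unfold Rdiv. rewrite Rmult_1_l. apply Rinv_le_contravar; lra.
Qed.

(* The kernel is a difference of translates of [tanh (t/2)], so one integration by parts
   reduces everything to translates of [1/(1 + cosh t)]. *)
Lemma IR_cos_sinh_cosh tau u : 0 < tau ->
  IR (fun t => cos (tau * t) * (sinh u / (cosh u + cosh t))) = sin (tau * u) / tau * sech_int tau.
Proof.
intros Ht.
set (L := fun t => / (1 + cosh t)).
assert (GL : Good L) by apply Good_inv_1_cosh.
assert (Gs : forall f c, Good f -> Good (fun t => f t * sin (tau * t + c))).
{ intros f c Hf. apply Good_mult_bounded with 1; [exact Hf | | intros; apply Rabs_sin_le_1].
  apply cont_of_ex_derive. intros t. auto_derive. exact I. }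
assert (Gc : forall f, Good f -> Good (fun t => f t * cos (tau * t))).
{ intros f Hf. apply Good_mult_bounded with 1; [exact Hf | apply cont_cos_lin | intros; apply Rabs_cos_le_1]. }
assert (GD := Good_sinh_over_cosh u).
set (D := fun t => sinh u / (cosh u + cosh t)) in *.
assert (G1 := Good_shift L u GL). assert (G2 := Good_shift L (- u) GL).
set (f := fun t => cos (tau * t) * D t + / (2 * tau) * (sin (tau * t) * (L (t + u) - L (t + - u)))).
assert (E1 : IR (fun t => sin (tau * t) * (L (t + u) - L (t + - u))) = - 2 * sin (tau * u) * sech_int tau).
{ rewrite (IR_ext _ (fun t => L (t + u) * sin (tau * t + 0) - L (t + - u) * sin (tau * t + 0)))
    by (intros; rewrite Rplus_0_r; ring).
  rewrite IR_minus by (apply (Gs (fun t => L (t + _))); assumption).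
  (* Moving the shift into the phase leaves one weight with the two phases [+- tau u]; the
     difference of the two sines is a single cosine. *)
  assert (S : forall v, IR (fun t => L (t + v) * sin (tau * t + 0)) = IR (fun s => L s * sin (tau * s + - (tau * v)))).
  { intros v. rewrite <- (IR_shift (fun s => L s * sin (tau * s + - (tau * v))) v) by now apply Gs.
    apply IR_ext. intros t. f_equal. f_equal. ring. }
  rewrite !S.
  rewrite <- IR_minus by (apply Gs; assumption).
  unfold sech_int. rewrite <- IR_scal.
  2:{ apply Good_ext with (fun t => L t * cos (tau * t)); [intros; unfold L, Rdiv; ring | auto]. }
  apply IR_ext. intros t.
  replace (- (tau * - u)) with (tau * u) by ring.
  rewrite !sin_plus, cos_neg, sin_neg. unfold L, Rdiv. ring. }
assert (GS : Good (fun t => sin (tau * t) * (L (t + u) - L (t + - u)))).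
{ apply Good_ext with (fun t => (L (t + u) - L (t + - u)) * sin (tau * t)); [intros; ring |].
  apply Good_mult_bounded with 1; [now apply Good_minus | apply cont_sin_lin | intros; apply Rabs_sin_le_1]. }
assert (GC : Good (fun t => cos (tau * t) * D t)).
{ apply Good_ext with (fun t => D t * cos (tau * t)); [intros; ring | auto]. }
assert (E0 : IR f = 0).
{ apply (IR_derive_0 (fun t => D t * (/ tau * sin (tau * t)))).
  - apply Good_plus; [exact GC | now apply Good_scal].
  - apply Good_ext with (fun t => / tau * (D t * sin (tau * t + 0))).
    + intros t. rewrite Rplus_0_r. ring.
    + apply Good_scal, Gs, GD.
  - intros t. unfold f.
    apply is_derive_ext with
      (fun t => / 2 * (tanh_half (t + u) - tanh_half (t + - u)) * (/ tau * sin (tau * t))).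
    { intros s. unfold D. now rewrite tanh_half_diff. }
    unfold D. rewrite tanh_half_diff. unfold L.
    auto_derive.
    + repeat split; try (eexists; apply is_derive_tanh_half).
    + rewrite !(is_derive_unique _ _ _ (is_derive_tanh_half _)).
      unfold Rminus. assert (H1 := cosh_ge_1 (t + u)). assert (H2 := cosh_ge_1 (t + - u)).
      field. repeat split; lra. }
unfold f in E0. rewrite IR_plus in E0; [| exact GC | now apply Good_scal].
rewrite IR_scal, E1 in E0 by exact GS.
change (IR (fun t => cos (tau * t) * D t) = sin (tau * u) / tau * sech_int tau).
transitivity (- (/ (2 * tau) * (- 2 * sin (tau * u) * sech_int tau))); [lra |].
field. lra.
Qed.

(** Keeps the denominator comparable with [cosh t] uniformly for [|q| <= b < pi], as domination
    under the integral requires. *)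
Lemma cos_cosh_lower b q t : 0 < b < PI -> - b <= q <= b ->
  (1 + cos b) / 2 * cosh t <= cos q + cosh t /\ 0 < (1 + cos b) / 2 <= 1.
Proof.
intros Hb Hq. assert (Hc := cosh_ge_1 t).
assert (H1 : cos b <= cos q).
{ assert (Hq' : cos q = cos (Rabs q)).
  { unfold Rabs. destruct (Rcase_abs q); [now rewrite cos_neg | reflexivity]. }
  rewrite Hq'. apply cos_decr_1; try lra; try apply Rabs_pos; unfold Rabs; destruct (Rcase_abs q); lra. }
assert (H2 : -1 < cos b).
{ rewrite <- cos_PI. apply cos_decreasing_1; lra. }
assert (H3 := COS_bound b). split; [nra | lra].
Qed.

(** Poisson kernel of the strip [|q| < pi]; [poisson1] and [poisson2] are its [q]-derivatives. It is
    harmonic: its second [t]-derivative is [- poisson2], which turns two [q]-derivatives of its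
    Fourier integral into multiplication by [tau^2]. *)
Definition poisson t q := sin q / (cos q + cosh t).
Definition poisson1 t q := (1 + cos q * cosh t) / (cos q + cosh t) ^ 2.
Definition poisson2 t q := sin q * (2 + cosh t * cos q - cosh t ^ 2) / (cos q + cosh t) ^ 3.

Lemma frac_cosh_bound N C D k n A : 1 <= C -> 0 < k -> k * C <= D -> Rabs N <= A * C ^ n ->
  Rabs (N / D ^ (S n)) <= (A / k ^ (S n)) / C.
Proof.
intros HC Hk HD HN.
assert (HkC : 0 < k * C) by nra.
assert (Hp : 0 < (k * C) ^ S n) by now apply pow_lt.
assert (Hp' : (k * C) ^ S n <= D ^ S n) by (apply pow_incr; lra).
unfold Rdiv at 1. rewrite Rabs_mult, (Rabs_pos_eq (/ D ^ S n)) by (left; apply Rinv_0_lt_compat; lra).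
apply Rle_trans with (A * C ^ n * / (k * C) ^ S n).
- apply Rmult_le_compat; [apply Rabs_pos | left; apply Rinv_0_lt_compat; lra | exact HN |].
  now apply Rinv_le_contravar.
- right. rewrite Rpow_mult_distr. simpl.
  assert (0 < C ^ n) by (apply pow_lt; lra). assert (0 < k ^ n) by (apply pow_lt; lra).
  field. repeat split; lra.
Qed.

Lemma poisson_bounds b : 0 < b < PI -> exists K, forall t q, - b <= q <= b ->
  Rabs (poisson t q) <= K / cosh t /\ Rabs (poisson1 t q) <= K / cosh t /\
  Rabs (poisson2 t q) <= K / cosh t /\ Rabs (sin q * sinh t / (cos q + cosh t) ^ 2) <= K / cosh t.
Proof.
intros Hb. set (k := (1 + cos b) / 2). exists (4 / k ^ 3).
intros t q Hq. destruct (cos_cosh_lower b q t Hb Hq) as [H1 H2].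
fold k in H1, H2. assert (HC := cosh_ge_1 t). assert (Hs := Rabs_sin_le_1 q).
assert (Hc := COS_bound q). assert (Hsh := Rabs_sinh_le_cosh t).
assert (k2 : k ^ 3 <= k ^ 2 <= k ^ 1).
{ split; simpl; nra. }
assert (k3 : 0 < k ^ 3) by (apply pow_lt; lra).
assert (M : forall a n, 0 <= a <= 4 -> k ^ 3 <= k ^ n -> a / k ^ n / cosh t <= 4 / k ^ 3 / cosh t).
{ intros a n Ha Hn. apply Rmult_le_compat_r; [left; apply Rinv_0_lt_compat; lra |].
  apply Rmult_le_compat; [lra | left; apply Rinv_0_lt_compat; lra | lra |]. now apply Rinv_le_contravar. }
repeat split.
- eapply Rle_trans; [| apply (M 1 1%nat); lra].
  unfold poisson. rewrite <- (pow_1 (cos q + cosh t)).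
  apply frac_cosh_bound; try lra; rewrite pow_O; lra.
- eapply Rle_trans; [| apply (M 2 2%nat); lra].
  apply frac_cosh_bound; try lra. rewrite pow_1. apply Rabs_le. nra.
- eapply Rle_trans; [| apply (M 4 3%nat); lra].
  apply frac_cosh_bound; try lra. rewrite Rabs_mult.
  apply Rle_trans with (1 * (4 * cosh t ^ 2)); [| lra].
  apply Rmult_le_compat; try apply Rabs_pos; [exact Hs |]. apply Rabs_le. nra.
- eapply Rle_trans; [| apply (M 1 2%nat); lra].
  apply frac_cosh_bound; try lra. rewrite pow_1, Rabs_mult.
  apply Rmult_le_compat; try apply Rabs_pos; lra.
Qed.

Lemma poisson_den_pos t q : - PI < q < PI -> 0 < cos q + cosh t.
Proof.
intros Hq. assert (Hr : Rabs q < PI) by (apply Rabs_def1; lra).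
destruct (cos_cosh_lower ((Rabs q + PI) / 2) q t) as [H1 H2].
- assert (H0 := Rabs_pos q). lra.
- assert (H := Rabs_maj2 q). assert (H' := Rle_abs q). lra.
- assert (H3 := cosh_ge_1 t). nra.
Qed.

Lemma is_derive_poisson t q : - PI < q < PI -> is_derive (poisson t) q (poisson1 t q).
Proof.
intros Hq. assert (H := poisson_den_pos t q Hq). unfold poisson, poisson1.
auto_derive; [lra |]. assert (Hs := sin2_cos2 q). unfold Rsqr in Hs.
apply Rmult_eq_reg_r with ((cos q + cosh t) ^ 2); [| simpl; nra].
field_simplify; [| lra | lra]. nra.
Qed.

Lemma is_derive_poisson1 t q : - PI < q < PI -> is_derive (poisson1 t) q (poisson2 t q).
Proof.
intros Hq. assert (H := poisson_den_pos t q Hq). unfold poisson1, poisson2.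
auto_derive; [apply Rgt_not_eq; nra |]. field. lra.
Qed.

Lemma is_derive_poisson_t t q : - PI < q < PI ->
  is_derive (fun s => poisson s q) t (- (sin q * sinh t / (cos q + cosh t) ^ 2)).
Proof.
intros Hq. assert (H := poisson_den_pos t q Hq). unfold poisson.
auto_derive.
- repeat split; lra.
- field. lra.
Qed.

Lemma is_derive_poisson_tt t q : - PI < q < PI ->
  is_derive (fun s => - (sin q * sinh s / (cos q + cosh s) ^ 2)) t (- poisson2 t q).
Proof.
intros Hq. assert (H := poisson_den_pos t q Hq).
unfold poisson2. auto_derive.
- repeat split. apply Rgt_not_eq. nra.
- transitivity (- (sin q * (cosh t * (cos q + cosh t) - 2 * (sinh t * sinh t)) / (cos q + cosh t) ^ 3)).
  + field. lra.
  + rewrite sinh_sq. field. lra.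
Qed.

Lemma continuity_2d_poisson1 t q : - PI < q < PI -> continuity_2d_pt poisson1 t q.
Proof.
intros Hq. assert (H := poisson_den_pos t q Hq). unfold poisson1.
apply continuity_2d_pt_ext with
  (fun t q => (1 + cos q * cosh t) * / ((cos q + cosh t) * (cos q + cosh t))).
- intros x y. unfold Rdiv. f_equal. f_equal. ring.
- cont_2d; try (cont_1d; eexists; apply is_derive_cosh). apply Rgt_not_eq. nra.
Qed.

Lemma continuity_2d_poisson2 t q : - PI < q < PI -> continuity_2d_pt poisson2 t q.
Proof.
intros Hq. assert (H := poisson_den_pos t q Hq). unfold poisson2.
apply continuity_2d_pt_ext with
  (fun t q => (sin q * (2 + cosh t * cos q - cosh t * cosh t)) *
     / ((cos q + cosh t) * ((cos q + cosh t) * (cos q + cosh t)))).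
- intros x y. unfold Rdiv. f_equal; [f_equal; ring | f_equal; ring].
- cont_2d; try (cont_1d; eexists; apply is_derive_cosh). apply Rgt_not_eq.
  apply Rmult_lt_0_compat; nra.
Qed.

Lemma cont_poisson q : - PI < q < PI -> cont (fun t => poisson t q).
Proof. intros Hq. apply cont_of_ex_derive. intros t. eexists. now apply is_derive_poisson_t. Qed.

Lemma cont_poisson_t q : - PI < q < PI ->
  cont (fun t => - (sin q * sinh t / (cos q + cosh t) ^ 2)).
Proof. intros Hq. apply cont_of_ex_derive. intros t. eexists. now apply is_derive_poisson_tt. Qed.

Lemma cont_of_continuity_2d F q : (forall t, continuity_2d_pt F t q) -> cont (fun t => F t q).
Proof.
intros H x. apply continuity_pt_filterlim. intros eps He.
destruct (H x (mkposreal eps He)) as [dl Hd]. exists dl. split; [apply dl |].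
intros z [_ Hz]. apply Hd; [exact Hz | rewrite Rminus_diag, Rabs_R0; apply dl].
Qed.

Lemma angle_interval q : - PI < q < PI -> exists b, 0 < b < PI /\ - b < q < b.
Proof.
intros Hq. exists ((Rabs q + PI) / 2).
assert (Hr : Rabs q < PI) by (apply Rabs_def1; lra).
assert (H := Rabs_maj2 q). assert (H' := Rle_abs q). lra.
Qed.

Lemma Good_poisson q : - PI < q < PI -> Good (fun t => poisson t q) /\
  Good (fun t => poisson1 t q) /\ Good (fun t => poisson2 t q) /\
  Good (fun t => - (sin q * sinh t / (cos q + cosh t) ^ 2)).
Proof.
intros Hq. destruct (angle_interval q Hq) as [b [Hb Hqb]].
destruct (poisson_bounds b Hb) as [K HK].
assert (Hq' : - b <= q <= b) by lra.
refine (conj _ (conj _ (conj _ _))); apply Good_of_cosh with K.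
- now apply cont_poisson.
- intros t. now apply HK.
- apply cont_of_continuity_2d. intros t. now apply continuity_2d_poisson1.
- intros t. now apply HK.
- apply cont_of_continuity_2d. intros t. now apply continuity_2d_poisson2.
- intros t. now apply HK.
- now apply cont_poisson_t.
- intros t. rewrite Rabs_Ropp. now apply HK.
Qed.

Lemma Good_mult_cos f tau : Good f -> Good (fun t => cos (tau * t) * f t).
Proof.
intros H. apply Good_ext with (fun t => f t * cos (tau * t)); [intros; ring |].
apply Good_mult_bounded with 1; [exact H | apply cont_cos_lin | intros; apply Rabs_cos_le_1].
Qed.

Lemma Good_mult_sin f tau : Good f -> Good (fun t => sin (tau * t) * f t).
Proof.
intros H. apply Good_ext with (fun t => f t * sin (tau * t)); [intros; ring |].
apply Good_mult_bounded with 1; [exact H | apply cont_sin_lin | intros; apply Rabs_sin_le_1].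
Qed.

Lemma cosh_bound_exp K t : 0 <= K -> K / cosh t <= 2 * K * exp (- (1 * Rabs t)).
Proof.
intros HK. rewrite Rmult_1_l, exp_Ropp.
assert (H1 := exp_Rabs_le_cosh t). assert (H3 := exp_pos (Rabs t)).
apply Rmult_le_reg_r with (cosh t * exp (Rabs t)); [nra |].
replace (K / cosh t * (cosh t * exp (Rabs t))) with (K * exp (Rabs t)) by (field; lra).
replace (2 * K * / exp (Rabs t) * (cosh t * exp (Rabs t))) with (K * (2 * cosh t)) by (field; lra).
now apply Rmult_le_compat_l.
Qed.

Lemma is_derive_IR_cosh tau (f f1 : R -> R -> R) :
  (forall t q, - PI < q < PI -> is_derive (f t) q (f1 t q)) ->
  (forall t q, - PI < q < PI -> continuity_2d_pt f1 t q) ->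
  (forall b, 0 < b < PI -> exists K, forall t q, - b <= q <= b -> Rabs (f1 t q) <= K / cosh t) ->
  (forall q, - PI < q < PI -> Good (fun t => f t q)) ->
  forall q, - PI < q < PI -> is_derive (fun q => IR (fun t => cos (tau * t) * f t q)) q
    (IR (fun t => cos (tau * t) * f1 t q)).
Proof.
intros Hder Hc HK HG q Hq. destruct (angle_interval q Hq) as [b [Hb Hqb]].
destruct (HK b Hb) as [K HK'].
assert (HK0 : 0 <= K).
{ specialize (HK' 0 q ltac:(lra)). assert (H := Rabs_pos (f1 0 q)).
  rewrite cosh_0 in HK'. lra. }
apply (is_derive_IR (fun t q => cos (tau * t) * f t q) (fun t q => cos (tau * t) * f1 t q)
   (- b) b 1 (2 * K)); try lra.
- intros t p Hp. apply is_derive_scal. apply Hder. lra.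
- intros t p Hp. apply continuity_2d_pt_mult; [cont_2d | apply Hc; lra].
- intros t p Hp. rewrite Rabs_mult. apply Rle_trans with (1 * (K / cosh t)).
  + apply Rmult_le_compat; try apply Rabs_pos; [apply Rabs_cos_le_1 | now apply HK'].
  + rewrite Rmult_1_l. now apply cosh_bound_exp.
- intros p Hp. apply Good_mult_cos. apply HG. lra.
Qed.

(** The combinations [H' + tau H] and [H' - tau H] solve first-order equations, so each is an
    exponential times its value at 0. *)
Lemma ode_hyperbolic tau (H H1 : R -> R) a : 0 < tau -> 0 < a ->
  (forall q, - a < q < a -> is_derive H q (H1 q)) ->
  (forall q, - a < q < a -> is_derive H1 q (tau ^ 2 * H q)) -> H 0 = 0 ->
  forall q, 0 < q < a -> H q = H1 0 / tau * sinh (tau * q).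
Proof.
intros Ht Ha D D1 H0 q Hq.
assert (E1 : (fun q => exp (- (tau * q)) * (H1 q + tau * H q)) q = (fun q => exp (- (tau * q)) * (H1 q + tau * H q)) 0).
{ apply (const_of_derive_0 (fun q => exp (- (tau * q)) * (H1 q + tau * H q)) (- a) a); try lra.
  intros z Hz. auto_derive; [repeat split; eexists; [now apply D1 | now apply D] |].
  replace (Derive (fun x : R => H x) z) with (H1 z) by (symmetry; apply is_derive_unique, D, Hz).
  replace (Derive (fun x : R => H1 x) z) with (tau ^ 2 * H z) by (symmetry; apply is_derive_unique, D1, Hz). ring. }
assert (E2 : (fun q => exp (tau * q) * (H1 q - tau * H q)) q = (fun q => exp (tau * q) * (H1 q - tau * H q)) 0).
{ apply (const_of_derive_0 (fun q => exp (tau * q) * (H1 q - tau * H q)) (- a) a); try lra.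
  intros z Hz. auto_derive; [repeat split; eexists; [now apply D1 | now apply D] |].
  replace (Derive (fun x : R => H x) z) with (H1 z) by (symmetry; apply is_derive_unique, D, Hz).
  replace (Derive (fun x : R => H1 x) z) with (tau ^ 2 * H z) by (symmetry; apply is_derive_unique, D1, Hz). ring. }
simpl in E1, E2. rewrite Rmult_0_r, Ropp_0, exp_0, H0 in E1. rewrite Rmult_0_r, exp_0, H0 in E2.
unfold sinh. rewrite exp_Ropp in *. assert (He := exp_pos (tau * q)).
assert (F1 : H1 q + tau * H q = exp (tau * q) * H1 0).
{ replace (H1 0) with (1 * (H1 0 + tau * 0)) by ring. rewrite <- E1. field. lra. }
assert (F2 : H1 q - tau * H q = / exp (tau * q) * H1 0).
{ replace (H1 0) with (1 * (H1 0 - tau * 0)) by ring. rewrite <- E2. field. lra. }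
apply Rmult_eq_reg_l with (2 * tau); [| lra].
replace (2 * tau * H q) with ((H1 q + tau * H q) - (H1 q - tau * H q)) by ring.
rewrite F1, F2. field. lra.
Qed.

(** The substitution [w = tan (q/2) tanh (t/2)] gives the antiderivative [2 atan w], whose limits at
    the two ends are [+- q]. *)
Lemma IR_poisson q : 0 < q < PI -> IR (fun t => poisson t q) = 2 * q.
Proof.
intros Hq.
assert (Hc : 0 < cos (q / 2)) by (apply cos_gt_0; lra).
assert (Eq : sin q = 2 * sin (q / 2) * cos (q / 2)).
{ rewrite <- sin_2a. f_equal. field. }
assert (Ec : cos q = 2 * cos (q / 2) * cos (q / 2) - 1).
{ rewrite <- cos_2a_cos. f_equal. field. }
set (F := fun t => 2 * atan (tan (q / 2) * tanh_half t)).
assert (L : forall x (l : R), is_lim tanh_half x l -> is_lim F x (2 * atan (tan (q / 2) * l))).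
{ intros x l Hl. apply (is_lim_scal_l _ 2 x (atan (tan (q / 2) * l))).
  apply is_lim_comp_continuous.
  - apply (is_lim_scal_l _ (tan (q / 2)) x l Hl).
  - apply continuous_atan. }
rewrite (IR_FTC F _ (2 * atan (tan (q / 2) * -1)) (2 * atan (tan (q / 2) * 1))).
- replace (tan (q / 2) * -1) with (- tan (q / 2)) by ring. rewrite Rmult_1_r, atan_opp, atan_tan by lra. field.
- exact (proj1 (Good_poisson q ltac:(lra))).
- intros t. unfold F. auto_derive; [eexists; apply is_derive_tanh_half |].
  replace (Derive (fun x : R => tanh_half x) t) with (/ (1 + cosh t))
    by (symmetry; apply is_derive_unique, is_derive_tanh_half).
  unfold poisson. assert (Hd := poisson_den_pos t q ltac:(lra)).
  assert (HC := cosh_ge_1 t).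
  assert (ET : tanh_half t ^ 2 = (cosh t - 1) / (cosh t + 1)).
  { unfold tanh_half, cosh. rewrite exp_Ropp. assert (He := exp_pos t).
    field. split; nra. }
  replace (tan (q / 2) * tanh_half t * (tan (q / 2) * tanh_half t * 1))
    with (tan (q / 2) ^ 2 * tanh_half t ^ 2) by ring.
  rewrite ET. unfold tan. rewrite Eq, Ec in *.
  assert (E1 := sin2_cos2 (q / 2)). unfold Rsqr in E1.
  set (sn := sin (q / 2)) in *. set (cs := cos (q / 2)) in *. set (C := cosh t) in *.
  assert (E2 : cs * cs * (C + 1) + sn * sn * (C - 1) = 2 * cs * cs - 1 + C).
  { replace (sn * sn) with (1 - cs * cs) by lra. ring. }
  rewrite <- E2 in *. field. repeat split; lra.
- apply L, tanh_half_lim_m.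
- apply L, tanh_half_lim_p.
Qed.

Lemma Rabs_sin_le y : Rabs (sin y) <= Rabs y.
Proof.
destruct (MVT_gen sin 0 y cos) as [z [_ Hz]].
- intros x _. apply is_derive_Reals, derivable_pt_lim_sin.
- intros x _. apply continuity_sin.
- rewrite sin_0, !Rminus_0_r in Hz. rewrite Hz, Rabs_mult.
  rewrite <- (Rmult_1_l (Rabs y)) at 2. apply Rmult_le_compat_r; [apply Rabs_pos | apply Rabs_cos_le_1].
Qed.

Lemma Rabs_le_sinh y : Rabs y <= Rabs (sinh y).
Proof.
destruct (MVT_gen sinh 0 y cosh) as [z [_ Hz]].
- intros x _. apply is_derive_sinh.
- intros x _. apply continuity_pt_of_ex_derive. eexists. apply is_derive_sinh.
- rewrite sinh_0, !Rminus_0_r in Hz. rewrite Hz, Rabs_mult.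
  rewrite <- (Rmult_1_l (Rabs y)) at 1. apply Rmult_le_compat_r; [apply Rabs_pos |].
  assert (H := cosh_ge_1 z). rewrite Rabs_pos_eq; lra.
Qed.

(** The Fourier integral [H q] of the Poisson kernel satisfies [H'' = tau^2 H], [H 0 = 0] and
    [H' 0 = sech_int tau], so it is a multiple of [sinh (tau q)]. As [q] tends to pi the kernel
    concentrates at [t = 0] with mass [2 q], which forces the boundary value [2 pi] and determines
    the multiple. *)
Lemma sech_int_eq tau : 0 < tau -> sech_int tau = 2 * PI * tau / sinh (PI * tau).
Proof.
intros Ht. assert (HPI := PI_RGT_0).
set (H := fun q => IR (fun t => cos (tau * t) * poisson t q)).
set (H1 := fun q => IR (fun t => cos (tau * t) * poisson1 t q)).
assert (D : forall q, - PI < q < PI -> is_derive H q (H1 q)).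
{ apply is_derive_IR_cosh.
  - intros; now apply is_derive_poisson.
  - intros; now apply continuity_2d_poisson1.
  - intros b Hb. destruct (poisson_bounds b Hb) as [K HK]. exists K. intros t q Hq. now apply HK.
  - intros q Hq. exact (proj1 (Good_poisson q Hq)). }
assert (D1 : forall q, - PI < q < PI -> is_derive H1 q (IR (fun t => cos (tau * t) * poisson2 t q))).
{ apply is_derive_IR_cosh.
  - intros; now apply is_derive_poisson1.
  - intros; now apply continuity_2d_poisson2.
  - intros b Hb. destruct (poisson_bounds b Hb) as [K HK]. exists K. intros t q Hq. now apply HK.
  - intros q Hq. exact (proj1 (proj2 (Good_poisson q Hq))). }
assert (D2 : forall q, - PI < q < PI -> is_derive H1 q (tau ^ 2 * H q)).
{ intros q Hq. destruct (Good_poisson q Hq) as [G0 [G1 [G2 G3]]].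
  replace (tau ^ 2 * H q) with (IR (fun t => cos (tau * t) * poisson2 t q)); [now apply D1 |].
  set (F := fun t => poisson t q) in *. set (F2 := fun t => poisson2 t q) in *.
  set (Ft := fun t => - (sin q * sinh t / (cos q + cosh t) ^ 2)) in *.
  assert (E : IR (fun t => cos (tau * t) * F2 t - tau ^ 2 * (cos (tau * t) * F t)) = 0).
  { apply (IR_derive_0 (fun t => - (cos (tau * t) * Ft t + tau * (sin (tau * t) * F t)))).
    - apply Good_minus; [now apply Good_mult_cos | now apply Good_scal, Good_mult_cos].
    - apply Good_opp, Good_plus; [now apply Good_mult_cos | now apply Good_scal, Good_mult_sin].
    - intros t.
      assert (K1 : is_derive F t (Ft t)) by now apply is_derive_poisson_t.
      assert (K2 : is_derive Ft t (- F2 t)) by now apply is_derive_poisson_tt.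
      auto_derive; [repeat split; eexists; eassumption |].
      replace (Derive (fun x : R => F x) t) with (Ft t) by (symmetry; apply is_derive_unique, K1).
      replace (Derive (fun x : R => Ft x) t) with (- F2 t) by (symmetry; apply is_derive_unique, K2).
      ring. }
  rewrite IR_minus, IR_scal in E;
    [| now apply Good_mult_cos | now apply Good_mult_cos | now apply Good_scal, Good_mult_cos].
  change (IR (fun t => cos (tau * t) * F2 t) = tau ^ 2 * IR (fun t => cos (tau * t) * F t)). lra. }
assert (H0 : H 0 = 0).
{ unfold H. rewrite (IR_ext _ (fun t => 0 * (cos (tau * t) * / (1 + cosh t)))).
  - rewrite IR_scal; [ring | apply Good_mult_cos, Good_inv_1_cosh].
  - intros t. unfold poisson. rewrite sin_0. unfold Rdiv. ring. }
assert (H10 : H1 0 = sech_int tau).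
{ apply IR_ext. intros t. unfold poisson1. rewrite cos_0.
  assert (HC := cosh_ge_1 t). field. lra. }
assert (Hsol := ode_hyperbolic tau H H1 PI Ht HPI D D2 H0). rewrite H10 in Hsol.
set (K := 4 + 2 * tau ^ 2).
(* The numerator [1 - cos (tau t)] is at most 2 and at most [tau^2 (cosh t - 1)], which compensates
   the zero of [cos q + cosh t] at [t = 0], [q = pi]. The bound is thus uniform up to pi, and the
   factor [sin q] sends the difference to 0. *)
assert (Hclose : forall q, 0 < q < PI -> Rabs (H q - 2 * q) <= sin q * IR (fun t => 2 * K / cosh t)).
{ intros q Hq. destruct (Good_poisson q ltac:(lra)) as [G0 _].
  assert (GK : Good (fun t => 2 * K / cosh t)).
  { apply Good_of_cosh with (2 * K).
    - apply cont_of_ex_derive. intros t. auto_derive. assert (HC := cosh_ge_1 t). lra.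
    - intros t. rewrite Rabs_pos_eq; [apply Rle_refl |]. assert (HC := cosh_ge_1 t).
      apply Rdiv_le_0_compat; [unfold K; nra | lra]. }
  rewrite <- IR_poisson by exact Hq. unfold H.
  assert (G1 := Good_mult_cos _ tau G0).
  rewrite <- IR_minus by assumption.
  rewrite <- IR_scal by exact GK.
  apply IR_abs_le; [exact (proj1 (Good_minus _ _ G1 G0)) | now apply Good_scal |].
  intros t.
  assert (Hs : 0 < sin q) by (apply sin_gt_0; lra).
  assert (Hden := poisson_den_pos t q ltac:(lra)).
  assert (HC := cosh_ge_1 t).
  assert (Hc1 : -1 <= cos q) by apply COS_bound.
  assert (Hb := COS_bound (tau * t)).
  replace (cos (tau * t) * poisson t q - poisson t q)
    with (- (sin q * ((1 - cos (tau * t)) / (cos q + cosh t)))) by (unfold poisson; field; lra).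
  rewrite Rabs_Ropp, Rabs_pos_eq.
  2:{ apply Rmult_le_pos; [lra |]. apply Rdiv_le_0_compat; lra. }
  apply Rmult_le_compat_l; [lra |].
  assert (Hcos : 1 - cos (tau * t) <= tau ^ 2 * (cosh t - 1)).
  { assert (E1 : 1 - cos (tau * t) = 2 * (sin (tau * t / 2) * sin (tau * t / 2))).
    { replace (cos (tau * t)) with (cos (2 * (tau * t / 2))) by (f_equal; field).
      rewrite cos_2a_sin. ring. }
    assert (E2 : cosh t - 1 = 2 * (sinh (t / 2) * sinh (t / 2))).
    { unfold sinh, cosh. rewrite exp_Ropp.
      replace (exp t) with (exp (t / 2) * exp (t / 2)) by (rewrite <- exp_plus; f_equal; field).
      rewrite exp_Ropp. assert (He := exp_pos (t / 2)). field. lra. }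
    rewrite E1, E2.
    assert (A := Rsqr_le_abs_1 _ _ (Rabs_sin_le (tau * t / 2))).
    assert (B := Rsqr_le_abs_1 _ _ (Rabs_le_sinh (t / 2))). unfold Rsqr in A, B.
    replace (tau ^ 2 * (2 * (sinh (t / 2) * sinh (t / 2)))) with (2 * (tau ^ 2 * (sinh (t / 2) * sinh (t / 2)))) by ring.
    apply Rmult_le_compat_l; [lra |]. eapply Rle_trans; [exact A |].
    replace (tau * t / 2 * (tau * t / 2)) with (tau ^ 2 * (t / 2 * (t / 2))) by (field; lra).
    apply Rmult_le_compat_l; [nra | exact B]. }
  apply Rmult_le_reg_r with ((cos q + cosh t) * cosh t); [nra |].
  replace ((1 - cos (tau * t)) / (cos q + cosh t) * ((cos q + cosh t) * cosh t))
    with ((1 - cos (tau * t)) * cosh t) by (field; lra).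
  replace (2 * K / cosh t * ((cos q + cosh t) * cosh t)) with (2 * K * (cos q + cosh t)) by (field; lra).
  unfold K. nra. }
set (B := IR (fun t => 2 * K / cosh t)) in *.
assert (C : forall c1 c2 c3, continuity_pt (fun q => c1 * (sech_int tau / tau * sinh (tau * q)) + c2 * q + c3 * sin q) PI).
{ intros c1 c2 c3. cont_1d. exact I. }
(* Two one-sided inequalities at [q = pi], where the [sin] term vanishes, combine into an
   equality. *)
assert (U1 : 1 * (sech_int tau / tau * sinh (tau * PI)) + -2 * PI + - B * sin PI <= 0).
{ apply (nonpos_at_right_end (fun q => 1 * (sech_int tau / tau * sinh (tau * q)) + -2 * q + - B * sin q) 0 PI HPI);
    [apply C |].
  intros q Hq. specialize (Hclose q Hq). rewrite Hsol in Hclose by exact Hq.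
  apply Rabs_le_between in Hclose. lra. }
assert (U2 : -1 * (sech_int tau / tau * sinh (tau * PI)) + 2 * PI + - B * sin PI <= 0).
{ apply (nonpos_at_right_end (fun q => -1 * (sech_int tau / tau * sinh (tau * q)) + 2 * q + - B * sin q) 0 PI HPI);
    [apply C |].
  intros q Hq. specialize (Hclose q Hq). rewrite Hsol in Hclose by exact Hq.
  apply Rabs_le_between in Hclose. lra. }
rewrite sin_PI in U1, U2.
assert (E : sech_int tau / tau * sinh (tau * PI) = 2 * PI) by lra.
assert (Hsh : 0 < sinh (tau * PI)) by (rewrite <- sinh_0; apply sinh_lt; nra).
rewrite (Rmult_comm PI tau).
apply Rmult_eq_reg_r with (/ tau * sinh (tau * PI)); [| apply Rgt_not_eq, Rmult_lt_0_compat; [now apply Rinv_0_lt_compat | exact Hsh]].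
transitivity (2 * PI); [rewrite <- E; field; lra | field; lra].
Qed.

(** * The Gamma function on the line Re z = 1 *)

(* [gam_re + i gam_im] is [Gamma (a + i tau)], after the substitution [y = e^r] in Euler's integral. *)
Definition gam_w a r := exp (a * r - exp r).
Definition gam_re tau a := IR (fun r => gam_w a r * cos (tau * r)).
Definition gam_im tau a := IR (fun r => gam_w a r * sin (tau * r)).

Lemma Good_gam_w a : 0 < a -> Good (gam_w a).
Proof. exact (Good_exp_phi a). Qed.

Lemma Good_gam_cos a tau c : 0 < a -> Good (fun r => gam_w a r * cos (tau * r + c)).
Proof.
intros Ha. apply Good_mult_bounded with 1; [now apply Good_gam_w | | intros; apply Rabs_cos_le_1].
apply cont_of_ex_derive. intros t. auto_derive. exact I.
Qed.

Lemma Good_gam_sin a tau c : 0 < a -> Good (fun r => gam_w a r * sin (tau * r + c)).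
Proof.
intros Ha. apply Good_mult_bounded with 1; [now apply Good_gam_w | | intros; apply Rabs_sin_le_1].
apply cont_of_ex_derive. intros t. auto_derive. exact I.
Qed.

Lemma Good_gam_cos0 a tau : 0 < a -> Good (fun r => gam_w a r * cos (tau * r)).
Proof.
intros Ha. apply Good_ext with (fun r => gam_w a r * cos (tau * r + 0)).
- intros; now rewrite Rplus_0_r.
- now apply Good_gam_cos.
Qed.

Lemma Good_gam_sin0 a tau : 0 < a -> Good (fun r => gam_w a r * sin (tau * r)).
Proof.
intros Ha. apply Good_ext with (fun r => gam_w a r * sin (tau * r + 0)).
- intros; now rewrite Rplus_0_r.
- now apply Good_gam_sin.
Qed.

Lemma gam_w_succ a r : gam_w (a + 1) r = exp r * gam_w a r.
Proof. unfold gam_w. rewrite <- exp_plus. f_equal. ring. Qed.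

Lemma is_derive_gam_w a r : is_derive (gam_w a) r (a * gam_w a r - gam_w (a + 1) r).
Proof. rewrite gam_w_succ. unfold gam_w. auto_derive; [exact I |]. unfold Rminus. ring. Qed.

(** Real part of [Gamma (z + 1) = z Gamma z] at [z = a + i tau], by parts; [gam_im_succ] is the
    imaginary part. *)
Lemma gam_re_succ tau a : 0 < a -> gam_re tau (a + 1) = a * gam_re tau a - tau * gam_im tau a.
Proof.
intros Ha. unfold gam_re, gam_im.
assert (G1 := Good_gam_cos0 a tau Ha). assert (G2 := Good_gam_sin0 a tau Ha).
rewrite <- !IR_scal by assumption.
rewrite <- IR_minus by (apply Good_scal; assumption).
apply Rminus_diag_uniq. symmetry.
rewrite <- IR_minus.
2:{ apply Good_gam_cos0. lra. }
2:{ apply Good_minus; apply Good_scal; assumption. }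
symmetry. rewrite <- (IR_derive_0 (fun r => - (gam_w a r * cos (tau * r)))
  (fun r => gam_w (a + 1) r * cos (tau * r) - (a * (gam_w a r * cos (tau * r)) - tau * (gam_w a r * sin (tau * r))))).
- reflexivity.
- apply Good_minus; [apply Good_gam_cos0; lra |].
  apply Good_minus; apply Good_scal; assumption.
- apply Good_opp. now apply Good_gam_cos0.
- intros r. auto_derive; [repeat split; eexists; apply is_derive_gam_w |].
  replace (Derive (fun x : R => gam_w a x) r) with (a * gam_w a r - gam_w (a + 1) r)
    by (symmetry; apply is_derive_unique, is_derive_gam_w).
  ring.
Qed.

Lemma gam_im_succ tau a : 0 < a -> gam_im tau (a + 1) = a * gam_im tau a + tau * gam_re tau a.
Proof.
intros Ha. unfold gam_re, gam_im.
assert (G1 := Good_gam_cos0 a tau Ha). assert (G2 := Good_gam_sin0 a tau Ha).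
rewrite <- !IR_scal by assumption.
rewrite <- IR_plus by (apply Good_scal; assumption).
apply Rminus_diag_uniq.
rewrite <- IR_minus.
2:{ apply Good_gam_sin0. lra. }
2:{ apply Good_plus; apply Good_scal; assumption. }
rewrite <- (IR_derive_0 (fun r => - (gam_w a r * sin (tau * r)))
  (fun r => gam_w (a + 1) r * sin (tau * r) - (a * (gam_w a r * sin (tau * r)) + tau * (gam_w a r * cos (tau * r))))).
- reflexivity.
- apply Good_minus; [apply Good_gam_sin0; lra |].
  apply Good_plus; apply Good_scal; assumption.
- apply Good_opp. now apply Good_gam_sin0.
- intros r. auto_derive; [repeat split; eexists; apply is_derive_gam_w |].
  replace (Derive (fun x : R => gam_w a x) r) with (a * gam_w a r - gam_w (a + 1) r)
    by (symmetry; apply is_derive_unique, is_derive_gam_w).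
  ring.
Qed.

Lemma IR_gam_w_succ a : 0 < a -> IR (gam_w (a + 1)) = a * IR (gam_w a).
Proof.
intros Ha. assert (H := gam_re_succ 0 a Ha). unfold gam_re in H.
rewrite Rmult_0_l, Rminus_0_r in H.
rewrite (IR_ext _ (gam_w (a + 1))) in H.
2:{ intros. rewrite Rmult_0_l, cos_0. ring. }
rewrite H. f_equal. apply IR_ext. intros. rewrite Rmult_0_l, cos_0. ring.
Qed.

Lemma IR_gam_w_1 : IR (gam_w 1) = 1.
Proof.
rewrite (IR_FTC (fun r => - exp (- exp r)) (gam_w 1) (-1) 0).
- ring.
- apply Good_gam_w. lra.
- intros r. unfold gam_w, Rminus. rewrite exp_plus, Rmult_1_l. auto_derive; [exact I |]. ring.
- apply is_lim_m_of_bound with 1 1; try lra. intros x _.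
  assert (H := exp_pos x). rewrite !Rmult_1_l.
  assert (H1 : exp (- exp x) <= 1) by (rewrite <- exp_0; apply exp_le_mono; lra).
  assert (H2 := exp_ineq1_le (- exp x)). rewrite Rabs_pos_eq; lra.
- apply is_lim_p_of_bound with 1 1; try lra. intros x Hx.
  rewrite Rminus_0_r, Rabs_Ropp, Rabs_pos_eq by (left; apply exp_pos). rewrite !Rmult_1_l.
  apply exp_le_mono. assert (H2 := exp_ineq1_le x). lra.
Qed.

Lemma IR_gam_w_nat m : IR (gam_w (INR m + 1)) = INR (Factorial.fact m).
Proof.
induction m as [|m IH].
- rewrite Rplus_0_l. apply IR_gam_w_1.
- rewrite S_INR, IR_gam_w_succ, IH.
  + change (Factorial.fact (S m)) with (S m * Factorial.fact m)%nat. rewrite mult_INR, S_INR. ring.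
  + assert (H := pos_INR m). lra.
Qed.

Lemma phi_gam_w r : phi r = gam_w 1 r.
Proof. unfold phi, gam_w. now rewrite Rmult_1_l. Qed.

(** The product of the two weights is again a Gamma weight, of order 2 and rate [1 + e^t]; a shift
    by [ln (1 + e^t)] normalizes the rate and leaves [Gamma 2 = 1]. *)
Lemma IR_phi_corr t : IR (fun r => phi r * phi (t + r)) = exp t / (1 + exp t) ^ 2.
Proof.
assert (He := exp_pos t).
rewrite (IR_ext _ (fun r => exp t / (1 + exp t) ^ 2 * gam_w 2 (r + ln (1 + exp t)))).
- rewrite IR_scal by (apply Good_shift, Good_gam_w; lra).
  rewrite IR_shift by (apply Good_gam_w; lra).
  assert (H := IR_gam_w_nat 1). simpl in H. replace (1 + 1) with 2 in H by ring. rewrite H. ring.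
- intros r. unfold phi, gam_w.
  assert (E1 : exp (r + ln (1 + exp t)) = exp r * (1 + exp t)) by (rewrite exp_plus, exp_ln; lra).
  rewrite E1, (exp_plus t r), <- exp_plus.
  replace (2 * (r + ln (1 + exp t)) - exp r * (1 + exp t))
    with (r + r + (ln (1 + exp t) + ln (1 + exp t)) + - (exp r * (1 + exp t))) by ring.
  replace (r - exp r + (t + r - exp t * exp r)) with (r + r + t + - (exp r * (1 + exp t))) by ring.
  rewrite !(exp_plus _ (- _)), (exp_plus (r + r) t), (exp_plus (r + r)), (exp_plus (ln _)), exp_ln by lra.
  field. lra.
Qed.

(* [|Gamma(1 + i tau)|^2 = pi tau / sinh (pi tau)]: expand the square as a double integral
   and integrate along the direction that keeps the difference of the variables fixed. *)
Lemma gam_mod_sq tau : 0 < tau ->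
  gam_re tau 1 ^ 2 + gam_im tau 1 ^ 2 = PI * tau / sinh (PI * tau).
Proof.
intros Ht.
set (F := fun r t => phi r * phi (t + r) * cos (tau * t)).
destruct phi_two_sided as [K [HK HK']].
assert (Hphi : forall r, 0 < phi r) by (intros; apply exp_pos).
assert (HF2 : cont2 F).
{ unfold F, phi. cont_2d. }
(* The inequality [|t| <= |t + r| + |r|] shares the decay of the two weights between [r] and [t], at
   the price of the rate [1/2]. *)
assert (HFd : udom2 (/ 2) (K * K) F).
{ intros r t. unfold F. rewrite !Rabs_mult.
  rewrite (Rabs_pos_eq (phi r)), (Rabs_pos_eq (phi (t + r))) by (left; apply Hphi).
  apply Rle_trans with (phi r * phi (t + r) * 1).
  - apply Rmult_le_compat_l; [left; apply Rmult_lt_0_compat; apply Hphi | apply Rabs_cos_le_1].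
  - rewrite Rmult_1_r. apply Rle_trans with ((K * exp (- Rabs r)) * (K * exp (- Rabs (t + r)))).
    + apply Rmult_le_compat; [left; apply Hphi | left; apply Hphi | apply HK' | apply HK'].
    + replace (K * exp (- Rabs r) * (K * exp (- Rabs (t + r)))) with (K * K * (exp (- Rabs r) * exp (- Rabs (t + r)))) by ring.
      apply Rmult_le_compat_l; [nra |]. rewrite <- !exp_plus. apply exp_le_mono.
      assert (Rabs t <= Rabs (t + r) + Rabs r).
      { replace t with ((t + r) + (- r)) at 1 by ring. rewrite <- (Rabs_Ropp r). apply Rabs_triang. }
      assert (H1 := Rabs_pos (t + r)). lra. }
assert (HFub := Fubini_IR (/ 2) (K * K) F ltac:(lra) HF2 HFd).
assert (G1 := Good_gam_cos0 1 tau ltac:(lra)). assert (G2 := Good_gam_sin0 1 tau ltac:(lra)).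
assert (E1 : IR (fun r => IR (fun t => F r t)) = gam_re tau 1 ^ 2 + gam_im tau 1 ^ 2).
{ rewrite (IR_ext _ (fun r => gam_re tau 1 * (gam_w 1 r * cos (tau * r)) + gam_im tau 1 * (gam_w 1 r * sin (tau * r)))).
  - rewrite IR_plus, !IR_scal by good. unfold gam_re, gam_im. ring.
  - intros r. unfold gam_re, gam_im.
    transitivity (IR (fun s => phi r * (gam_w 1 s * cos (tau * s + - (tau * r))))).
    + rewrite <- (IR_shift (fun s => phi r * (gam_w 1 s * cos (tau * s + - (tau * r)))) r).
      * apply IR_ext. intros t. unfold F. rewrite <- phi_gam_w.
        replace (tau * (t + r) + - (tau * r)) with (tau * t) by ring. ring.
      * apply Good_scal, Good_gam_cos. lra.
    + rewrite <- !phi_gam_w.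
      rewrite (IR_ext _ (fun s => (phi r * cos (tau * r)) * (gam_w 1 s * cos (tau * s))
         + (phi r * sin (tau * r)) * (gam_w 1 s * sin (tau * s)))).
      * rewrite IR_plus, !IR_scal by good. ring.
      * intros s. rewrite cos_plus, cos_neg, sin_neg. ring. }
assert (E2 : IR (fun t => IR (fun r => F r t)) = / 2 * sech_int tau).
{ unfold sech_int. rewrite <- IR_scal by (apply Good_mult_cos, Good_inv_1_cosh).
  apply IR_ext. intros t. unfold F.
  rewrite (IR_ext _ (fun r => cos (tau * t) * (phi r * phi (t + r)))) by (intros; ring).
  rewrite IR_scal.
  - rewrite IR_phi_corr. unfold cosh. rewrite exp_Ropp. assert (He := exp_pos t). field. split; nra.
  - apply Good_mult_bounded with K; [apply Good_phi | |].
    + apply cont_of_ex_derive. intros x. unfold phi. auto_derive. exact I.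
    + intros x. rewrite Rabs_pos_eq by (left; apply Hphi). eapply Rle_trans; [apply HK' |].
      rewrite <- (Rmult_1_r K) at 2. apply Rmult_le_compat_l; [lra |].
      rewrite <- exp_0. apply exp_le_mono. assert (H := Rabs_pos (t + x)). lra. }
rewrite <- E1, HFub, E2, sech_int_eq by exact Ht. field.
apply Rgt_not_eq. rewrite <- sinh_0. apply sinh_lt. assert (H := PI_RGT_0). nra.
Qed.

(** The derivative of [x^(1 + i tau)] is [(1 + i tau) x^(i tau)], whose components are at most
    [1 + tau]. The phase [c] selects a component: [c = 0] the real part, [c = - pi/2] the imaginary
    part. *)
Lemma Rabs_mul_cos_ln x tau c : 0 < x -> 0 < tau ->
  Rabs (x * cos (tau * ln x + c) - cos c) <= (1 + tau) * Rabs (x - 1).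
Proof.
intros Hx Ht.
assert (HP : forall z, Rmin 1 x <= z <= Rmax 1 x -> 0 < z).
{ intros z Hz. assert (0 < Rmin 1 x) by (apply Rmin_glb_lt; lra). lra. }
destruct (MVT_gen (fun x => x * cos (tau * ln x + c)) 1 x
   (fun x => cos (tau * ln x + c) - tau * sin (tau * ln x + c))) as [z [Hz E]].
- intros z Hz. auto_derive; [apply HP; lra |]. field. apply Rgt_not_eq, HP. lra.
- intros z Hz. cont_1d. now apply HP.
- rewrite ln_1, Rmult_0_r, Rplus_0_l, Rmult_1_l in E. rewrite E, Rabs_mult.
  apply Rmult_le_compat_r; [apply Rabs_pos |].
  eapply Rle_trans; [apply Rabs_triang |]. rewrite Rabs_Ropp, Rabs_mult, (Rabs_pos_eq tau) by lra.
  assert (H1 := Rabs_cos_le_1 (tau * ln z + c)). assert (H2 := Rabs_sin_le_1 (tau * ln z + c)).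
  apply Rplus_le_compat; [exact H1 |]. nra.
Qed.

(* With T Gamma(m+1)-distributed, this says that E[(T/m)^(1+i tau)] is within O(m^(-1/2)) of 1;
   the bound comes from the variance of T. *)
Lemma gam_concentration tau c m dl : 0 < tau -> (1 <= m)%nat -> 0 < dl ->
  Rabs (/ (INR (Factorial.fact m) * INR m) * IR (fun r => gam_w (INR m + 2) r * cos (tau * (r - ln (INR m)) + c)) - cos c)
   <= (1 + tau) / 2 * (dl + (INR m + 2) / (INR m ^ 2 * dl)).
Proof.
intros Ht Hm Hdl.
assert (HM : 0 < INR m) by (apply lt_0_INR; lia).
assert (Hf : 0 < INR (Factorial.fact m)) by (apply lt_0_INR, Factorial.lt_O_fact).
set (M := INR m) in *. set (f := INR (Factorial.fact m)) in *.
assert (G0 : Good (gam_w (M + 1))) by (apply Good_gam_w; lra).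
assert (G1 : Good (gam_w (M + 1 + 1))) by (apply Good_gam_w; lra).
assert (G2 : Good (gam_w (M + 1 + 1 + 1))) by (apply Good_gam_w; lra).
assert (I0 : IR (gam_w (M + 1)) = f) by apply IR_gam_w_nat.
assert (I1 : IR (gam_w (M + 1 + 1)) = (M + 1) * f) by (rewrite IR_gam_w_succ, I0; lra).
assert (I2 : IR (gam_w (M + 1 + 1 + 1)) = (M + 2) * ((M + 1) * f)) by (rewrite IR_gam_w_succ, I1; lra).
assert (Gc : Good (fun r => gam_w (M + 2) r * cos (tau * (r - ln M) + c))).
{ apply Good_ext with (fun r => gam_w (M + 2) r * cos (tau * r + (- (tau * ln M) + c))).
  - intros r. f_equal. f_equal. ring.
  - apply Good_gam_cos. lra. }
replace (/ (f * M) * IR (fun r => gam_w (M + 2) r * cos (tau * (r - ln M) + c)) - cos c)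
  with (/ f * (/ M * IR (fun r => gam_w (M + 2) r * cos (tau * (r - ln M) + c)) - cos c * IR (gam_w (M + 1))))
  by (rewrite I0; field; lra).
rewrite <- !IR_scal by assumption.
rewrite <- IR_minus by (apply Good_scal; assumption).
(* With [x = e^r / M], [P] is the weight of order [M + 1] times [dl + (x - 1)^2 / dl], which is at
   least [2 |x - 1|] by the arithmetic-geometric mean inequality. The normalized second moment of
   [x - 1] is [(M + 2) / M^2]. *)
set (P := fun r => (dl + / dl) * gam_w (M + 1) r + (/ (M ^ 2 * dl) * gam_w (M + 1 + 1 + 1) r - 2 / (M * dl) * gam_w (M + 1 + 1) r)).
assert (GP : Good P) by (apply Good_plus; [now apply Good_scal | apply Good_minus; now apply Good_scal]).
assert (IP : IR P = f * (dl + (M + 2) / (M ^ 2 * dl))).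
{ unfold P. rewrite IR_plus, IR_minus, !IR_scal, I0, I1, I2 by good.
  field. lra. }
rewrite Rabs_mult, Rabs_pos_eq by (left; now apply Rinv_0_lt_compat).
apply Rle_trans with (/ f * ((1 + tau) / 2 * IR P)).
2:{ rewrite IP. right. field. lra. }
apply Rmult_le_compat_l; [left; now apply Rinv_0_lt_compat |].
rewrite <- IR_scal by exact GP.
apply IR_abs_le; [apply Good_minus; now apply Good_scal | now apply Good_scal |].
intros r. unfold P. replace (M + 2) with (M + 1 + 1) by ring.
rewrite (gam_w_succ (M + 1 + 1)), (gam_w_succ (M + 1)). assert (Hw : 0 < gam_w (M + 1) r) by apply exp_pos.
assert (He := exp_pos r).
set (x := exp r / M). assert (Hx : 0 < x) by (apply Rdiv_lt_0_compat; lra).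
assert (Elx : ln x = r - ln M).
{ unfold x, Rdiv. rewrite ln_mult, ln_Rinv, ln_exp; try lra. now apply Rinv_0_lt_compat. }
assert (Ex : exp r = M * x) by (unfold x; field; lra).
assert (B := Rabs_mul_cos_ln x tau c Hx Ht). rewrite Elx in B.
rewrite !Ex.
replace (/ M * (M * x * gam_w (M + 1) r * cos (tau * (r - ln M) + c)) - cos c * gam_w (M + 1) r)
  with (gam_w (M + 1) r * (x * cos (tau * (r - ln M) + c) - cos c)) by (field; lra).
replace ((1 + tau) / 2 * ((dl + / dl) * gam_w (M + 1) r +
    (/ (M ^ 2 * dl) * (M * x * (M * x * gam_w (M + 1) r)) - 2 / (M * dl) * (M * x * gam_w (M + 1) r))))
  with (gam_w (M + 1) r * ((1 + tau) * (/ 2 * (dl + (x - 1) ^ 2 / dl)))) by (field; lra).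
rewrite Rabs_mult, (Rabs_pos_eq (gam_w _ _)) by lra.
apply Rmult_le_compat_l; [lra |]. eapply Rle_trans; [exact B |].
apply Rmult_le_compat_l; [lra |].
assert (Ey : (x - 1) ^ 2 = Rabs (x - 1) ^ 2) by (now rewrite pow2_abs).
rewrite Ey. set (y := Rabs (x - 1)) in *.
assert (0 <= (dl - y) ^ 2 / dl) by (apply Rdiv_le_0_compat; [apply pow2_ge_0 | lra]).
replace (/ 2 * (dl + y ^ 2 / dl)) with (y + / 2 * ((dl - y) ^ 2 / dl)) by (field; lra). lra.
Qed.

Lemma gam_concentration_lim tau c : 0 < tau ->
  is_lim_seq (fun m => / (INR (Factorial.fact m) * INR m) *
     IR (fun r => gam_w (INR m + 2) r * cos (tau * (r - ln (INR m)) + c))) (cos c).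
Proof.
intros Ht. apply is_lim_seq_spec. intros eps. assert (He := cond_pos eps).
(* Once [m > 3 / dl^2], the variance term is below [dl] as well, so the total is below
   [(1 + tau) dl = eps]. *)
set (dl := eps / (1 + tau)). assert (Hdl : 0 < dl) by (apply Rdiv_lt_0_compat; lra).
assert (Hdd : 0 < dl * dl) by nra.
destruct (nfloor_ex (3 / (dl * dl))) as [N [_ HN]]; [apply Rdiv_le_0_compat; lra |].
exists (S N). intros m Hm.
assert (HM : 3 / (dl * dl) < INR m) by (apply le_INR in Hm; rewrite S_INR in Hm; lra).
assert (HM1 : 1 <= INR m) by (apply (le_INR 1); lia).
eapply Rle_lt_trans; [apply (gam_concentration tau c m dl); try assumption; lia |].
assert (H1 : (INR m + 2) / (INR m ^ 2 * dl) <= 3 / (INR m * dl)).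
{ apply Rmult_le_reg_r with (INR m ^ 2 * dl); [apply Rmult_lt_0_compat; [apply pow_lt; lra | lra] |].
  replace ((INR m + 2) / (INR m ^ 2 * dl) * (INR m ^ 2 * dl)) with (INR m + 2) by (field; lra).
  replace (3 / (INR m * dl) * (INR m ^ 2 * dl)) with (3 * INR m) by (field; lra). lra. }
assert (H2 : 3 / (INR m * dl) < dl).
{ apply Rmult_lt_reg_r with (INR m * dl); [nra |].
  replace (3 / (INR m * dl) * (INR m * dl)) with 3 by (field; lra).
  apply Rmult_lt_reg_r with (/ (dl * dl)); [apply Rinv_0_lt_compat; nra |].
  replace (dl * (INR m * dl) * / (dl * dl)) with (INR m) by (field; lra). exact HM. }
apply Rlt_le_trans with ((1 + tau) / 2 * (dl + dl)).
- apply Rmult_lt_compat_l; lra.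
- right. unfold dl. field. lra.
Qed.

(** [Clim] is total and returns a value even for divergent sequences; convergence is carried by this
    predicate, and [is_Clim_unique] reads off the value. *)
Definition is_Clim (u : nat -> C) (l : C) :=
  is_lim_seq (fun m => Re (u m)) (Re l) /\ is_lim_seq (fun m => Im (u m)) (Im l).

Lemma is_Clim_unique u l : is_Clim u l -> Clim u = l.
Proof.
intros [H1 H2]. unfold Clim. apply is_lim_seq_unique in H1. apply is_lim_seq_unique in H2.
rewrite H1, H2. now destruct l.
Qed.

Lemma is_Clim_ext_loc u v l : eventually (fun m => u m = v m) -> is_Clim u l -> is_Clim v l.
Proof.
intros H [H1 H2]. split; (eapply is_lim_seq_ext_loc; [| eassumption]);
  revert H; apply filter_imp; intros m Hm; now rewrite Hm.
Qed.

Lemma is_Clim_eq u l l' : l = l' -> is_Clim u l -> is_Clim u l'.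
Proof. now intros ->. Qed.

Lemma is_Clim_const l : is_Clim (fun _ => l) l.
Proof. split; apply is_lim_seq_const. Qed.

Lemma is_Clim_mult u v a b : is_Clim u a -> is_Clim v b ->
  is_Clim (fun m => Cmult (u m) (v m)) (Cmult a b).
Proof.
intros [H1 H2] [H3 H4]. split; simpl.
- apply (is_lim_seq_minus' _ _ (fst a * fst b) (snd a * snd b)).
  + apply (is_lim_seq_mult' _ _ _ _ H1 H3).
  + apply (is_lim_seq_mult' _ _ _ _ H2 H4).
- apply (is_lim_seq_plus' _ _ (fst a * snd b) (snd a * fst b)).
  + apply (is_lim_seq_mult' _ _ _ _ H1 H4).
  + apply (is_lim_seq_mult' _ _ _ _ H2 H3).
Qed.

Definition gauss z m :=
  Cdiv (Cpoch z m) (Cmult (RtoC (INR (Factorial.fact m))) (cpow_pos (INR m) z)).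

Definition gam1 tau : C := (gam_re tau 1, gam_im tau 1).

(** The functional equation iterated: [Cpoch] has [m + 1] factors, so the product that starts at
    [1 + i tau] lands on [Gamma (m + 2 + i tau)]. *)
Lemma Cpoch_gam1 tau m :
  Cmult (Cpoch (1, tau) m) (gam1 tau) = (gam_re tau (INR m + 2), gam_im tau (INR m + 2)).
Proof.
induction m as [|m IH].
- simpl Cpoch. simpl INR. rewrite Rplus_0_l. replace 2 with (1 + 1) by ring.
  rewrite gam_re_succ, gam_im_succ by lra. unfold gam1, Cmult; simpl. f_equal; ring.
- change (Cpoch (1, tau) (S m)) with (Cmult (Cpoch (1, tau) m) (Cplus (1, tau) (RtoC (INR (S m))))).
  replace (Cmult (Cmult (Cpoch (1, tau) m) (Cplus (1, tau) (RtoC (INR (S m))))) (gam1 tau))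
    with (Cmult (Cplus (1, tau) (RtoC (INR (S m)))) (Cmult (Cpoch (1, tau) m) (gam1 tau))) by ring.
  rewrite IH. rewrite S_INR. replace (INR m + 1 + 2) with (INR m + 2 + 1) by ring.
  assert (Hm := pos_INR m).
  rewrite (gam_re_succ tau (INR m + 2)), (gam_im_succ tau (INR m + 2)) by lra.
  unfold Cmult, Cplus, RtoC; simpl. f_equal; ring.
Qed.

Lemma IR_gam_rotate a tau th c : 0 < a ->
  IR (fun r => gam_w a r * cos (tau * (r - th) + c)) =
  cos (tau * th - c) * gam_re tau a + sin (tau * th - c) * gam_im tau a.
Proof.
intros Ha. unfold gam_re, gam_im.
assert (G1 := Good_gam_cos0 a tau Ha). assert (G2 := Good_gam_sin0 a tau Ha).
rewrite <- !IR_scal, <- IR_plus by good.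
apply IR_ext. intros r. replace (tau * (r - th) + c) with (tau * r - (tau * th - c)) by ring.
rewrite cos_minus. ring.
Qed.

(** Multiplied by [Gamma (1 + i tau)], Gauss' quotient becomes [Gamma (m + 2 + i tau) / (m! m^(1 + i
    tau))], the normalized complex moment that concentrates at 1. *)
Lemma gauss_gam1_lim tau : 0 < tau -> is_Clim (fun m => Cmult (gauss (1, tau) m) (gam1 tau)) (RtoC 1).
Proof.
intros Ht.
assert (L1 := gam_concentration_lim tau 0 Ht).
assert (L2 := gam_concentration_lim tau (- (PI / 2)) Ht).
assert (K : forall m, (1 <= m)%nat -> Cmult (gauss (1, tau) m) (gam1 tau) =
  (/ (INR (Factorial.fact m) * INR m) * IR (fun r => gam_w (INR m + 2) r * cos (tau * (r - ln (INR m)) + 0)),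
   / (INR (Factorial.fact m) * INR m) * IR (fun r => gam_w (INR m + 2) r * cos (tau * (r - ln (INR m)) + - (PI / 2))))).
{ intros m Hm. assert (HM : 0 < INR m) by (apply lt_0_INR; lia).
  assert (Hf : 0 < INR (Factorial.fact m)) by (apply lt_0_INR, Factorial.lt_O_fact).
  rewrite !IR_gam_rotate by lra.
  unfold gauss, Cdiv.
  replace (Cmult (Cmult (Cpoch (1, tau) m) (Cinv (Cmult (RtoC (INR (Factorial.fact m))) (cpow_pos (INR m) (1, tau))))) (gam1 tau))
    with (Cmult (Cmult (Cpoch (1, tau) m) (gam1 tau)) (Cinv (Cmult (RtoC (INR (Factorial.fact m))) (cpow_pos (INR m) (1, tau)))))
    by ring.
  rewrite Cpoch_gam1.
  assert (E : Cinv (Cmult (RtoC (INR (Factorial.fact m))) (cpow_pos (INR m) (1, tau))) =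
     (/ (INR (Factorial.fact m) * INR m) * cos (tau * ln (INR m)), - (/ (INR (Factorial.fact m) * INR m) * sin (tau * ln (INR m))))).
  { unfold cpow_pos, Cinv, Cmult, RtoC; simpl. rewrite Rmult_1_l, exp_ln by exact HM.
    set (c := cos (tau * ln (INR m))). set (s := sin (tau * ln (INR m))).
    assert (Hcs : c * c + s * s = 1) by (unfold c, s; assert (H := sin2_cos2 (tau * ln (INR m))); unfold Rsqr in H; lra).
    set (f := INR (Factorial.fact m)) in *. set (M := INR m) in *.
    assert (Hd : (f * (M * c) - 0 * (M * s)) * ((f * (M * c) - 0 * (M * s)) * 1) +
       (f * (M * s) + 0 * (M * c)) * ((f * (M * s) + 0 * (M * c)) * 1) = (f * M) * (f * M)).
    { transitivity ((f * M) * (f * M) * (c * c + s * s)); [ring | rewrite Hcs; ring]. }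
    rewrite Hd. f_equal; field; lra. }
  rewrite E. unfold Cmult; simpl.
  replace (tau * ln (INR m) - - (PI / 2)) with (PI / 2 + tau * ln (INR m)) by ring.
  rewrite Rminus_0_r, cos_plus, sin_plus, cos_PI2, sin_PI2. f_equal; ring. }
apply is_Clim_ext_loc with (fun m =>
  (/ (INR (Factorial.fact m) * INR m) * IR (fun r => gam_w (INR m + 2) r * cos (tau * (r - ln (INR m)) + 0)),
   / (INR (Factorial.fact m) * INR m) * IR (fun r => gam_w (INR m + 2) r * cos (tau * (r - ln (INR m)) + - (PI / 2))))).
- exists 1%nat. intros m Hm. symmetry. now apply K.
- rewrite cos_0 in L1. rewrite cos_neg, cos_PI2 in L2. split; assumption.
Qed.

Lemma sinh_pos x : 0 < x -> 0 < sinh x.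
Proof. intros H. rewrite <- sinh_0. now apply sinh_lt. Qed.

Lemma gam1_neq_0 tau : 0 < tau -> gam1 tau <> RtoC 0.
Proof.
intros Ht H. injection H as H1 H2.
assert (E := gam_mod_sq tau Ht). rewrite H1, H2 in E. assert (HP := PI_RGT_0).
assert (0 < PI * tau / sinh (PI * tau)).
{ apply Rdiv_lt_0_compat; [nra | apply sinh_pos; nra]. }
lra.
Qed.

Lemma gauss_lim_1 tau : 0 < tau -> is_Clim (gauss (1, tau)) (Cinv (gam1 tau)).
Proof.
intros Ht. assert (H0 := gam1_neq_0 tau Ht).
apply is_Clim_ext_loc with (fun m => Cmult (Cmult (gauss (1, tau) m) (gam1 tau)) (Cinv (gam1 tau))).
- apply filter_forall. intros m. field. exact H0.
- apply (is_Clim_eq _ (Cmult (RtoC 1) (Cinv (gam1 tau)))); [apply Cmult_1_l |].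
  apply is_Clim_mult; [now apply gauss_gam1_lim | apply is_Clim_const].
Qed.

Lemma Cpoch_shift z m :
  Cmult z (Cpoch (Cplus z (RtoC 1)) m) = Cmult (Cpoch z m) (Cplus z (RtoC (INR m + 1))).
Proof.
induction m as [|m IH].
- rewrite Rplus_0_l. reflexivity.
- change (Cpoch (Cplus z (RtoC 1)) (S m)) with
    (Cmult (Cpoch (Cplus z (RtoC 1)) m) (Cplus (Cplus z (RtoC 1)) (RtoC (INR (S m))))).
  change (Cpoch z (S m)) with (Cmult (Cpoch z m) (Cplus z (RtoC (INR (S m))))).
  rewrite Cmult_assoc, IH, S_INR, !RtoC_plus. ring.
Qed.

Lemma cpow_pos_succ y z : 0 < y -> cpow_pos y (Cplus z (RtoC 1)) = Cmult (RtoC y) (cpow_pos y z).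
Proof.
intros Hy. destruct z as [a b]. unfold cpow_pos, Cplus, Cmult, RtoC; simpl.
rewrite Rplus_0_r, Rmult_plus_distr_r, Rmult_1_l, exp_plus, exp_ln by exact Hy. f_equal; ring.
Qed.

Lemma cpow_pos_neq_0 y z : cpow_pos y z <> RtoC 0.
Proof.
intros H. injection H as H1 H2.
assert (He := exp_pos (Re z * ln y)). assert (E := sin2_cos2 (Im z * ln y)).
apply Rmult_integral in H1. apply Rmult_integral in H2.
destruct H1 as [H1|H1]; [lra |]. destruct H2 as [H2|H2]; [lra |].
rewrite H1, H2 in E. unfold Rsqr in E. lra.
Qed.

Lemma RtoC_neq_0 x : x <> 0 -> RtoC x <> RtoC 0.
Proof. intros H E. apply H. now apply RtoC_inj. Qed.

(** The quotients at [z + 1] and at [z] differ by the factor [(1 + (z + 1)/m) / z]. This carries the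
    limit from [1 + i tau] to all [k + 1 + i tau]. *)
Lemma gauss_shift z l : z <> RtoC 0 -> is_Clim (gauss z) l ->
  is_Clim (gauss (Cplus z (RtoC 1))) (Cdiv l z).
Proof.
intros Hz H.
apply is_Clim_ext_loc with
  (fun m => Cmult (gauss z m) (Cmult (Cplus (RtoC 1) (Cmult (Cplus z (RtoC 1)) (RtoC (/ INR m)))) (Cinv z))).
- exists 1%nat. intros m Hm.
  assert (HM : 0 < INR m) by (apply lt_0_INR; lia).
  assert (Hf : 0 < INR (Factorial.fact m)) by (apply lt_0_INR, Factorial.lt_O_fact).
  assert (E := Cpoch_shift z m).
  assert (E' : Cpoch (Cplus z (RtoC 1)) m = Cmult (Cmult (Cpoch z m) (Cplus z (RtoC (INR m + 1)))) (Cinv z)).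
  { rewrite <- E. field. exact Hz. }
  unfold gauss. rewrite E', cpow_pos_succ by exact HM. rewrite RtoC_inv, RtoC_plus by lra.
  field. repeat split; first [exact Hz | apply cpow_pos_neq_0 | apply RtoC_neq_0; lra].
- apply is_Clim_mult; [exact H |].
  apply (is_Clim_eq _ (Cmult (Cplus (RtoC 1) (Cmult (Cplus z (RtoC 1)) (RtoC 0))) (Cinv z))); [ring |].
  apply is_Clim_mult; [| apply is_Clim_const].
  assert (L : is_lim_seq (fun m => / INR m) 0).
  { apply (is_lim_seq_inv _ p_infty); [apply is_lim_seq_INR | discriminate]. }
  assert (LC : is_Clim (fun m => Cmult (Cplus z (RtoC 1)) (RtoC (/ INR m))) (Cmult (Cplus z (RtoC 1)) (RtoC 0))).
  { apply is_Clim_mult; [apply is_Clim_const |]. split; simpl; [exact L | apply is_lim_seq_const]. }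
  destruct LC as [L1 L2]. split; simpl in *.
  + apply (is_lim_seq_plus' _ _ 1 _ (is_lim_seq_const 1) L1).
  + apply (is_lim_seq_plus' _ _ 0 _ (is_lim_seq_const 0) L2).
Qed.

(** [1/Gamma (k + 1 + i tau)], built from [1/Gamma (1 + i tau)] by the functional equation. *)
Fixpoint rgam (tau : R) (k : nat) : C :=
  match k with
  | O => Cinv (gam1 tau)
  | S k' => Cdiv (rgam tau k') (INR k' + 1, tau)
  end.

Lemma rGamma_rgam tau k : 0 < tau ->
  rGamma (Cplus (0, tau) (RtoC (INR k + 1))) = rgam tau k.
Proof.
intros Ht.
assert (H : is_Clim (gauss (INR k + 1, tau)) (rgam tau k)).
{ induction k as [|k IH].
  - rewrite Rplus_0_l. now apply gauss_lim_1.
  - rewrite S_INR. replace (INR k + 1 + 1, tau) with (Cplus (INR k + 1, tau) (RtoC 1))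
      by (unfold Cplus, RtoC; simpl; f_equal; ring).
    simpl rgam. apply gauss_shift; [| exact IH].
    intros E. injection E as E1 E2. lra. }
replace (Cplus (0, tau) (RtoC (INR k + 1))) with ((INR k + 1, tau) : C)
  by (unfold Cplus, RtoC; simpl; f_equal; ring).
apply is_Clim_unique. exact H.
Qed.

(** * Bessel functions of imaginary order *)

Lemma sum_n_Re (u : nat -> C) N : Re (sum_n u N) = sum_n (fun k => Re (u k)) N.
Proof.
induction N as [|N IH]; [now rewrite !sum_O |]. rewrite !sum_Sn, <- IH. reflexivity.
Qed.

Lemma sum_n_Im (u : nat -> C) N : Im (sum_n u N) = sum_n (fun k => Im (u k)) N.
Proof.
induction N as [|N IH]; [now rewrite !sum_O |]. rewrite !sum_Sn, <- IH. reflexivity.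
Qed.

Lemma Cseries_unique (u : nat -> C) a b :
  is_series (fun k => Re (u k)) a -> is_series (fun k => Im (u k)) b -> Cseries u = (a, b).
Proof.
intros Ha Hb. apply is_Clim_unique. split.
- apply is_lim_seq_ext with (sum_n (fun k => Re (u k))); [intros; now rewrite sum_n_Re | exact Ha].
- apply is_lim_seq_ext with (sum_n (fun k => Im (u k))); [intros; now rewrite sum_n_Im | exact Hb].
Qed.

Lemma rgam_bound tau k : Cmod (rgam tau k) <= Cmod (rgam tau 0).
Proof.
induction k as [|k IH]; [apply Rle_refl |].
eapply Rle_trans; [| exact IH]. change (rgam tau (S k)) with (Cdiv (rgam tau k) (INR k + 1, tau)).
assert (Hk := pos_INR k).
assert (Hm : 1 <= Cmod (INR k + 1, tau)).
{ apply Rle_trans with (INR k + 1); [lra |]. eapply Rle_trans; [| apply (Rmax_Cmod (INR k + 1, tau))].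
  eapply Rle_trans; [| apply Rmax_l]. apply Rle_abs. }
rewrite Cmod_div.
- assert (H := Cmod_ge_0 (rgam tau k)). apply Rmult_le_reg_r with (Cmod (INR k + 1, tau)); [lra |].
  unfold Rdiv. rewrite Rmult_assoc, Rinv_l by lra. nra.
- intros E. rewrite E, Cmod_0 in Hm. lra.
Qed.

(** [pr + i pim] is the Bessel coefficient [(-1)^k / (k! Gamma (k + 1 + i tau))]; the components are
    kept apart so that real power series can be used. *)
Definition pr tau k := (-1) ^ k / INR (Factorial.fact k) * Re (rgam tau k).
Definition pim tau k := (-1) ^ k / INR (Factorial.fact k) * Im (rgam tau k).

Lemma pow_m1_abs k : Rabs ((-1) ^ k) = 1.
Proof. apply pow_1_abs. Qed.

(** Comparison with the exponential series at every radius. *)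
Lemma entire_of_bound (a : nat -> R) B : 0 <= B ->
  (forall k, Rabs (a k) <= B / INR (Factorial.fact k)) -> CV_radius a = p_infty.
Proof.
intros HB H.
assert (K : forall r : R, Rbar_le r (CV_radius a)).
{ intros r. apply Lub_Rbar_correct.
  apply @ex_series_le with (fun k => B * (Rabs r ^ k / INR (Factorial.fact k))).
  - intros n. rewrite Rabs_Rabsolu, Rabs_mult, <- RPow_abs.
    replace (B * (Rabs r ^ n / INR (Factorial.fact n))) with (B / INR (Factorial.fact n) * Rabs r ^ n)
      by (unfold Rdiv; ring).
    apply Rmult_le_compat_r; [apply pow_le, Rabs_pos | apply H].
  - apply @ex_series_scal_l. exists (exp (Rabs r)).
    apply is_series_ext with (2 := is_exp_Reals (Rabs r)).
    intros n. rewrite pow_n_pow. reflexivity. }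
destruct (CV_radius a) as [r| |] eqn:E; [| reflexivity |].
- specialize (K (r + 1)). simpl in K. lra.
- specialize (K 0). contradiction.
Qed.

Lemma im_le_Cmod z : Rabs (Im z) <= Cmod z.
Proof. eapply Rle_trans; [apply Rmax_r | apply Rmax_Cmod]. Qed.

Lemma CV_pr tau : CV_radius (pr tau) = p_infty.
Proof.
apply entire_of_bound with (Cmod (rgam tau 0)); [apply Cmod_ge_0 |]. intros k. unfold pr, Rdiv.
assert (Hf : 0 < INR (Factorial.fact k)) by (apply lt_0_INR, Factorial.lt_O_fact).
rewrite !Rabs_mult, pow_m1_abs, Rmult_1_l, Rabs_pos_eq by (left; now apply Rinv_0_lt_compat).
rewrite Rmult_comm. apply Rmult_le_compat_r; [left; now apply Rinv_0_lt_compat |].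
eapply Rle_trans; [apply re_le_Cmod | apply rgam_bound].
Qed.

Lemma CV_pim tau : CV_radius (pim tau) = p_infty.
Proof.
apply entire_of_bound with (Cmod (rgam tau 0)); [apply Cmod_ge_0 |]. intros k. unfold pim, Rdiv.
assert (Hf : 0 < INR (Factorial.fact k)) by (apply lt_0_INR, Factorial.lt_O_fact).
rewrite !Rabs_mult, pow_m1_abs, Rmult_1_l, Rabs_pos_eq by (left; now apply Rinv_0_lt_compat).
rewrite Rmult_comm. apply Rmult_le_compat_r; [left; now apply Rinv_0_lt_compat |].
eapply Rle_trans; [apply im_le_Cmod | apply rgam_bound].
Qed.

Lemma rgam_succ tau k :
  (INR k + 1) * Re (rgam tau (S k)) - tau * Im (rgam tau (S k)) = Re (rgam tau k) /\
  (INR k + 1) * Im (rgam tau (S k)) + tau * Re (rgam tau (S k)) = Im (rgam tau k).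
Proof.
assert (Hk := pos_INR k).
assert (E : Cmult (INR k + 1, tau) (rgam tau (S k)) = rgam tau k).
{ simpl rgam. field. intros E. injection E as E1 E2. lra. }
rewrite <- E. unfold Cmult; simpl. split; ring.
Qed.

(** Real part of [(k + 1) (k + 1 + i tau) p_(k+1) = - p_k]; [pim_succ] is the imaginary part. *)
Lemma pr_succ tau k : (INR k + 1) * ((INR k + 1) * pr tau (S k)) = - pr tau k + tau * ((INR k + 1) * pim tau (S k)).
Proof.
destruct (rgam_succ tau k) as [E1 E2]. unfold pr, pim. rewrite <- E1.
change (Factorial.fact (S k)) with (S k * Factorial.fact k)%nat. rewrite mult_INR, S_INR.
assert (Hk := pos_INR k).
assert (Hf : 0 < INR (Factorial.fact k)) by (apply lt_0_INR, Factorial.lt_O_fact).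
simpl pow. field. lra.
Qed.

Lemma pim_succ tau k : (INR k + 1) * ((INR k + 1) * pim tau (S k)) = - pim tau k - tau * ((INR k + 1) * pr tau (S k)).
Proof.
destruct (rgam_succ tau k) as [E1 E2]. unfold pr, pim. rewrite <- E2.
change (Factorial.fact (S k)) with (S k * Factorial.fact k)%nat. rewrite mult_INR, S_INR.
assert (Hk := pos_INR k).
assert (Hf : 0 < INR (Factorial.fact k)) by (apply lt_0_INR, Factorial.lt_O_fact).
simpl pow. field. lra.
Qed.

(* [J_{i tau}(2 sqrt z) = z^{i tau/2} (P1 + i P2)]; [Q1], [Q2] are [z P1'], [z P2']. *)
Definition P1 tau z := PSeries (pr tau) z.
Definition P2 tau z := PSeries (pim tau) z.
Definition Q1 tau z := z * PSeries (PS_derive (pr tau)) z.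
Definition Q2 tau z := z * PSeries (PS_derive (pim tau)) z.

Lemma ex_pseries_entire a z : CV_radius a = p_infty -> ex_pseries a z.
Proof. intros H. apply CV_radius_inside. rewrite H. exact I. Qed.

Lemma is_derive_entire a z : CV_radius a = p_infty -> is_derive (PSeries a) z (PSeries (PS_derive a) z).
Proof. intros H. apply is_derive_PSeries. rewrite H. exact I. Qed.

Lemma CV_derive_entire a : CV_radius a = p_infty -> CV_radius (PS_derive a) = p_infty.
Proof. intros H. now rewrite CV_radius_derive. Qed.

(** Coefficientwise form of the equation [(z P')' + i tau P' + P = 0] of the Bessel series. Its real
    and imaginary parts differ only in the sign of the coupling, hence the parameter [c]. *)
Lemma is_derive_zD (a b : nat -> R) c z : CV_radius a = p_infty -> CV_radius b = p_infty ->
  (forall k, (INR k + 1) * ((INR k + 1) * a (S k)) = - a k + c * ((INR k + 1) * b (S k))) ->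
  is_derive (fun z => z * PSeries (PS_derive a) z) z (- PSeries a z + c * PSeries (PS_derive b) z).
Proof.
intros Ha Hb H.
assert (Ha' := CV_derive_entire _ Ha). assert (Hb' := CV_derive_entire _ Hb).
set (d := PS_incr_1 (PS_derive a)).
assert (Hd : CV_radius d = p_infty) by (unfold d; now rewrite CV_radius_incr_1).
apply is_derive_ext with (PSeries d).
{ intros t. unfold d. now rewrite PSeries_incr_1. }
replace (- PSeries a z + c * PSeries (PS_derive b) z) with (PSeries (PS_derive d) z).
- now apply is_derive_entire.
- rewrite <- PSeries_scal, <- PSeries_opp, <- PSeries_plus.
  + apply PSeries_ext. intros n. unfold PS_plus, PS_opp, PS_scal, PS_derive, d, PS_incr_1.

    change (match n with O => 1 | S _ => INR n + 1 end) with (INR (S n)). unfold PS_derive. rewrite !S_INR. apply H.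
  + apply @ex_pseries_opp. now apply ex_pseries_entire.
  + apply ex_pseries_scal; [apply Rmult_comm |]. now apply ex_pseries_entire.
Qed.

Lemma is_derive_Q1 tau z : is_derive (Q1 tau) z (- P1 tau z + tau * PSeries (PS_derive (pim tau)) z).
Proof. apply is_derive_zD; [apply CV_pr | apply CV_pim | apply pr_succ]. Qed.

Lemma is_derive_Q2 tau z : is_derive (Q2 tau) z (- P2 tau z + - tau * PSeries (PS_derive (pr tau)) z).
Proof.
apply is_derive_zD; [apply CV_pim | apply CV_pr |].
intros k. rewrite pim_succ. ring.
Qed.

(* [bu + i bv] is [J_{i tau} (2 e^{s/2})]; [bu1], [bv1] are the s-derivatives. *)
Definition bu tau s := cos (tau / 2 * s) * P1 tau (exp s) - sin (tau / 2 * s) * P2 tau (exp s).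
Definition bv tau s := sin (tau / 2 * s) * P1 tau (exp s) + cos (tau / 2 * s) * P2 tau (exp s).
Definition bu1 tau s := - (tau / 2) * bv tau s
  + (cos (tau / 2 * s) * Q1 tau (exp s) - sin (tau / 2 * s) * Q2 tau (exp s)).
Definition bv1 tau s := tau / 2 * bu tau s
  + (sin (tau / 2 * s) * Q1 tau (exp s) + cos (tau / 2 * s) * Q2 tau (exp s)).
Definition omega tau s := exp s + (tau / 2) ^ 2.

Lemma is_derive_P1_exp tau s : is_derive (fun s => P1 tau (exp s)) s (Q1 tau (exp s)).
Proof.
apply (is_derive_comp (P1 tau) exp); [apply is_derive_entire, CV_pr | apply is_derive_exp].
Qed.

Lemma is_derive_P2_exp tau s : is_derive (fun s => P2 tau (exp s)) s (Q2 tau (exp s)).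
Proof.
apply (is_derive_comp (P2 tau) exp); [apply is_derive_entire, CV_pim | apply is_derive_exp].
Qed.

Lemma is_derive_Q1_exp tau s :
  is_derive (fun s => Q1 tau (exp s)) s (- exp s * P1 tau (exp s) + tau * Q2 tau (exp s)).
Proof.
replace (- exp s * P1 tau (exp s) + tau * Q2 tau (exp s))
  with (exp s * (- P1 tau (exp s) + tau * PSeries (PS_derive (pim tau)) (exp s))) by (unfold Q2; ring).
apply (is_derive_comp (Q1 tau) exp); [apply is_derive_Q1 | apply is_derive_exp].
Qed.

Lemma is_derive_Q2_exp tau s :
  is_derive (fun s => Q2 tau (exp s)) s (- exp s * P2 tau (exp s) - tau * Q1 tau (exp s)).
Proof.
replace (- exp s * P2 tau (exp s) - tau * Q1 tau (exp s))
  with (exp s * (- P2 tau (exp s) + - tau * PSeries (PS_derive (pr tau)) (exp s))) by (unfold Q1; ring).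
apply (is_derive_comp (Q2 tau) exp); [apply is_derive_Q2 | apply is_derive_exp].
Qed.

Lemma is_derive_bu tau s : is_derive (bu tau) s (bu1 tau s).
Proof.
evar_last.
- apply @is_derive_minus; apply @is_derive_mult.
  + auto_derive; [exact I | reflexivity].
  + apply is_derive_P1_exp.
  + intros; apply Rmult_comm.
  + auto_derive; [exact I | reflexivity].
  + apply is_derive_P2_exp.
  + intros; apply Rmult_comm.
- unfold minus, plus, opp, mult; simpl. unfold bu1, bv. ring.
Qed.

Lemma is_derive_bv tau s : is_derive (bv tau) s (bv1 tau s).
Proof.
evar_last.
- apply @is_derive_plus; apply @is_derive_mult.
  + auto_derive; [exact I | reflexivity].
  + apply is_derive_P1_exp.
  + intros; apply Rmult_comm.
  + auto_derive; [exact I | reflexivity].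
  + apply is_derive_P2_exp.
  + intros; apply Rmult_comm.
- unfold plus, mult; simpl. unfold bv1, bu. ring.
Qed.

(** Since [x d/dx] is [2 d/ds], Bessel's equation reads [J'' = - omega J] in [s], without a
    first-order term. The energy estimate and the identities for [Y] and [MM] rest on this form. *)
Lemma is_derive_bu1 tau s : is_derive (bu1 tau) s (- omega tau s * bu tau s).
Proof.
evar_last.
- apply @is_derive_plus; [apply is_derive_scal, is_derive_bv |].
  apply @is_derive_minus; apply @is_derive_mult.
  + auto_derive; [exact I | reflexivity].
  + apply is_derive_Q1_exp.
  + intros; apply Rmult_comm.
  + auto_derive; [exact I | reflexivity].
  + apply is_derive_Q2_exp.
  + intros; apply Rmult_comm.
- unfold minus, plus, opp, mult; simpl. unfold bv1, bu, omega. field.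
Qed.

Lemma is_derive_bv1 tau s : is_derive (bv1 tau) s (- omega tau s * bv tau s).
Proof.
evar_last.
- apply @is_derive_plus; [apply is_derive_scal, is_derive_bu |].
  apply @is_derive_plus; apply @is_derive_mult.
  + auto_derive; [exact I | reflexivity].
  + apply is_derive_Q1_exp.
  + intros; apply Rmult_comm.
  + auto_derive; [exact I | reflexivity].
  + apply is_derive_Q2_exp.
  + intros; apply Rmult_comm.
- unfold plus, mult; simpl. unfold bu1, bv, omega. field.
Qed.

Lemma BesselJ_bu_bv tau s : 0 < tau ->
  BesselJ (0, tau) (2 * exp (s / 2)) = (bu tau s, bv tau s).
Proof.
intros Ht.
replace (2 * exp (s / 2)) with (2 * exp (s / 2)) by reflexivity.
assert (Ex : 2 * exp (s / 2) / 2 = exp (s / 2)) by field.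
assert (Ez : forall k, exp (s / 2) ^ (2 * k) = exp s ^ k).
{ intros k. rewrite pow_mult. f_equal. simpl. rewrite Rmult_1_r, <- exp_plus. f_equal. field. }
assert (S1 := PSeries_correct _ _ (ex_pseries_entire _ (exp s) (CV_pr tau))).
assert (S2 := PSeries_correct _ _ (ex_pseries_entire _ (exp s) (CV_pim tau))).
assert (El : Im (0, tau) * ln (exp (s / 2)) = tau / 2 * s) by (rewrite ln_exp; simpl; field).
apply Cseries_unique.
- apply is_series_ext with (fun k => minus
    (scal (cos (tau / 2 * s)) (scal (pow_n (exp s) k) (pr tau k)))
    (scal (sin (tau / 2 * s)) (scal (pow_n (exp s) k) (pim tau k)))).
  + intros k. rewrite rGamma_rgam by exact Ht. rewrite Ex, Ez. unfold cpow_pos. rewrite El.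
    simpl (Re (0, tau)). rewrite Rmult_0_l, exp_0.
    rewrite !pow_n_pow. unfold minus, plus, opp, scal; simpl; unfold mult; simpl.
    unfold pr, pim, Re, Im. field. apply INR_fact_neq_0.
  + apply @is_series_minus; apply @is_series_scal_l; assumption.
- apply is_series_ext with (fun k => plus
    (scal (sin (tau / 2 * s)) (scal (pow_n (exp s) k) (pr tau k)))
    (scal (cos (tau / 2 * s)) (scal (pow_n (exp s) k) (pim tau k)))).
  + intros k. rewrite rGamma_rgam by exact Ht. rewrite Ex, Ez. unfold cpow_pos. rewrite El.
    simpl (Re (0, tau)). rewrite Rmult_0_l, exp_0.
    rewrite !pow_n_pow. unfold plus, scal; simpl; unfold mult; simpl.
    unfold pr, pim, Re, Im. field. apply INR_fact_neq_0.
  + apply @is_series_plus; apply @is_series_scal_l; assumption.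
Qed.

(** * Size of the Bessel function: leading term at -oo and energy bound *)

Definition asq tau := sinh (PI * tau) / (PI * tau).
(* [1/Gamma (1 + i tau) = A1 + i A2], because [|Gamma (1 + i tau)|^2 = 1/asq]. *)
Definition A1 tau := asq tau * gam_re tau 1.
Definition A2 tau := - (asq tau * gam_im tau 1).

Lemma asq_pos tau : 0 < tau -> 0 < asq tau.
Proof.
intros Ht. assert (HP := PI_RGT_0). apply Rdiv_lt_0_compat; [apply sinh_pos |]; nra.
Qed.

Lemma rgam_0 tau : 0 < tau -> rgam tau 0 = (A1 tau, A2 tau).
Proof.
intros Ht. assert (HP := PI_RGT_0). assert (Hs : 0 < sinh (PI * tau)) by (apply sinh_pos; nra).
assert (E := gam_mod_sq tau Ht).
unfold rgam, Cinv, gam1. simpl fst. simpl snd. rewrite E. unfold A1, A2, asq.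
f_equal; field; lra.
Qed.

Lemma A_sq tau : 0 < tau -> A1 tau ^ 2 + A2 tau ^ 2 = asq tau.
Proof.
intros Ht. assert (HP := PI_RGT_0). assert (Hs : 0 < sinh (PI * tau)) by (apply sinh_pos; nra).
unfold A1, A2.
transitivity (asq tau ^ 2 * (gam_re tau 1 ^ 2 + gam_im tau 1 ^ 2)); [ring |].
rewrite gam_mod_sq by exact Ht. unfold asq. field. lra.
Qed.

Lemma P1_0 tau : 0 < tau -> P1 tau 0 = A1 tau.
Proof. intros Ht. unfold P1. rewrite PSeries_0. unfold pr. rewrite rgam_0 by exact Ht. simpl. field. Qed.

Lemma P2_0 tau : 0 < tau -> P2 tau 0 = A2 tau.
Proof. intros Ht. unfold P2. rewrite PSeries_0. unfold pim. rewrite rgam_0 by exact Ht. simpl. field. Qed.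

Lemma entire_bounded a : CV_radius a = p_infty ->
  exists K, 0 <= K /\ forall z, 0 <= z <= 1 -> Rabs (PSeries a z) <= K.
Proof.
intros H.
destruct (continuity_ab_maj (fun z => Rabs (PSeries a z)) 0 1) as [z0 [Hz _]]; [lra | |].
- intros c _. apply continuity_pt_filterlim.
  apply (continuous_comp (PSeries a) Rabs); [| apply continuous_Rabs].
  apply @ex_derive_continuous. eexists. now apply is_derive_entire.
- exists (Rabs (PSeries a z0)). split; [apply Rabs_pos | exact Hz].
Qed.

Lemma entire_lip_0 a : CV_radius a = p_infty ->
  exists K, 0 <= K /\ forall z, 0 <= z <= 1 ->
   Rabs (PSeries a z - PSeries a 0) <= K * z /\ Rabs (z * PSeries (PS_derive a) z) <= K * z.
Proof.
intros H. destruct (entire_bounded (PS_derive a) (CV_derive_entire _ H)) as [K [HK0 HK]].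
exists K. split; [exact HK0 |]. intros z Hz. split.
- destruct (MVT_gen (PSeries a) 0 z (PSeries (PS_derive a))) as [c [Hc E]].
  + intros x _. now apply is_derive_entire.
  + intros x _. apply continuity_pt_of_ex_derive. eexists. now apply is_derive_entire.
  + rewrite E, Rabs_mult, Rminus_0_r, (Rabs_pos_eq z) by lra.
    apply Rmult_le_compat_r; [lra |]. apply HK.
    rewrite Rmin_left, Rmax_right in Hc by lra. lra.
- rewrite Rabs_mult, Rabs_pos_eq, Rmult_comm by lra. apply Rmult_le_compat_r; [lra | now apply HK].
Qed.

Lemma rotate_bound th a b K : Rabs a <= K -> Rabs b <= K ->
  Rabs (cos th * a - sin th * b) <= 2 * K /\ Rabs (sin th * a + cos th * b) <= 2 * K.
Proof.
intros Ha Hb. assert (Hc := Rabs_cos_le_1 th). assert (Hs := Rabs_sin_le_1 th).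
assert (M : forall x y, Rabs x <= 1 -> Rabs y <= K -> Rabs (x * y) <= K).
{ intros x y Hx Hy. rewrite Rabs_mult. assert (H2 := Rabs_pos y). nra. }
split.
- eapply Rle_trans; [apply Rabs_triang |]. rewrite Rabs_Ropp.
  assert (H1 := M _ _ Hc Ha). assert (H2 := M _ _ Hs Hb). lra.
- eapply Rle_trans; [apply Rabs_triang |].
  assert (H1 := M _ _ Hs Ha). assert (H2 := M _ _ Hc Hb). lra.
Qed.

(* [u0 + i v0] is the leading term [e^{i tau s/2} / Gamma (1 + i tau)] of [J_{i tau}(2 e^{s/2})] at -oo. *)
Definition u0 tau s := cos (tau / 2 * s) * A1 tau - sin (tau / 2 * s) * A2 tau.
Definition v0 tau s := sin (tau / 2 * s) * A1 tau + cos (tau / 2 * s) * A2 tau.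

(** The power series are Lipschitz at [z = e^s = 0], and rotations by [tau s / 2] preserve the size
    of the error. The derivatives are included because [MM] involves them. *)
Lemma bessel_small tau : 0 < tau -> exists K, 0 <= K /\ forall s, s <= 0 ->
  Rabs (bu tau s - u0 tau s) <= K * exp s /\ Rabs (bv tau s - v0 tau s) <= K * exp s /\
  Rabs (bu1 tau s + tau / 2 * v0 tau s) <= K * exp s /\ Rabs (bv1 tau s - tau / 2 * u0 tau s) <= K * exp s.
Proof.
intros Ht.
destruct (entire_lip_0 (pr tau) (CV_pr tau)) as [Ka [Ha0 Ha]].
destruct (entire_lip_0 (pim tau) (CV_pim tau)) as [Kb [Hb0 Hb]].
set (K := 2 * (Ka + Kb)).
exists (tau / 2 * K + K). split; [unfold K; nra |]. intros s Hs.
assert (Hz : 0 <= exp s <= 1).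
{ split; [left; apply exp_pos |]. rewrite <- exp_0. now apply exp_le_mono. }
destruct (Ha _ Hz) as [Ha1 Ha2]. destruct (Hb _ Hz) as [Hb1 Hb2].
fold (P1 tau (exp s)) in Ha1. fold (P1 tau 0) in Ha1. fold (P2 tau (exp s)) in Hb1. fold (P2 tau 0) in Hb1.
rewrite P1_0 in Ha1 by exact Ht. rewrite P2_0 in Hb1 by exact Ht.
assert (L : Ka * exp s <= (Ka + Kb) * exp s /\ Kb * exp s <= (Ka + Kb) * exp s) by (split; nra).
destruct (rotate_bound (tau / 2 * s) _ _ ((Ka + Kb) * exp s) (Rle_trans _ _ _ Ha1 (proj1 L)) (Rle_trans _ _ _ Hb1 (proj2 L))) as [R1 R2].
destruct (rotate_bound (tau / 2 * s) _ _ ((Ka + Kb) * exp s) (Rle_trans _ _ _ Ha2 (proj1 L)) (Rle_trans _ _ _ Hb2 (proj2 L))) as [R3 R4].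
assert (EU : Rabs (bu tau s - u0 tau s) <= K * exp s).
{ unfold bu, u0. eapply Rle_trans; [right | eapply Rle_trans; [exact R1 | right; unfold K; ring]]. f_equal. ring. }
assert (EV : Rabs (bv tau s - v0 tau s) <= K * exp s).
{ unfold bv, v0. eapply Rle_trans; [right | eapply Rle_trans; [exact R2 | right; unfold K; ring]]. f_equal. ring. }
assert (HK : 0 <= tau / 2 * (K * exp s)).
{ apply Rmult_le_pos; [lra |]. eapply Rle_trans; [apply Rabs_pos | exact EU]. }
rewrite Rmult_plus_distr_r, Rmult_assoc.
repeat split; try lra.
- replace (bu1 tau s + tau / 2 * v0 tau s) with (- (tau / 2 * (bv tau s - v0 tau s))
    + (cos (tau / 2 * s) * Q1 tau (exp s) - sin (tau / 2 * s) * Q2 tau (exp s))) by (unfold bu1; ring).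
  eapply Rle_trans; [apply Rabs_triang |]. rewrite Rabs_Ropp, Rabs_mult, (Rabs_pos_eq (tau / 2)) by lra.
  apply Rplus_le_compat; [apply Rmult_le_compat_l; [lra | exact EV] |].
  eapply Rle_trans; [exact R3 |]. right; unfold K; ring.
- replace (bv1 tau s - tau / 2 * u0 tau s) with (tau / 2 * (bu tau s - u0 tau s)
    + (sin (tau / 2 * s) * Q1 tau (exp s) + cos (tau / 2 * s) * Q2 tau (exp s))) by (unfold bv1; ring).
  eapply Rle_trans; [apply Rabs_triang |]. rewrite Rabs_mult, (Rabs_pos_eq (tau / 2)) by lra.
  apply Rplus_le_compat; [apply Rmult_le_compat_l; [lra | exact EU] |].
  eapply Rle_trans; [exact R4 |]. right; unfold K; ring.
Qed.

Lemma omega_pos tau s : 0 < omega tau s.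
Proof. unfold omega. assert (H := exp_pos s). assert (H1 := pow2_ge_0 (tau / 2)). lra. Qed.

(** Sonin's function of [J'' = - omega J]: in its derivative the terms in [J J'] cancel, and because
    [omega] increases only a nonpositive term remains. *)
Definition energy tau s := (bu1 tau s ^ 2 + bv1 tau s ^ 2) / omega tau s + (bu tau s ^ 2 + bv tau s ^ 2).

Lemma is_derive_energy tau s :
  is_derive (energy tau) s (- (exp s * (bu1 tau s ^ 2 + bv1 tau s ^ 2) / omega tau s ^ 2)).
Proof.
assert (Ho := omega_pos tau s). unfold energy.
assert (D1 := is_derive_bu tau s). assert (D2 := is_derive_bv tau s).
assert (D3 := is_derive_bu1 tau s). assert (D4 := is_derive_bv1 tau s).
assert (D5 : is_derive (omega tau) s (exp s)) by (unfold omega; auto_derive; [exact I | ring]).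
auto_derive.
- repeat split; try (eexists; eassumption). lra.
- replace (Derive (fun x : R => bu tau x) s) with (bu1 tau s) by (symmetry; apply is_derive_unique, D1).
  replace (Derive (fun x : R => bv tau x) s) with (bv1 tau s) by (symmetry; apply is_derive_unique, D2).
  replace (Derive (fun x : R => bu1 tau x) s) with (- omega tau s * bu tau s) by (symmetry; apply is_derive_unique, D3).
  replace (Derive (fun x : R => bv1 tau x) s) with (- omega tau s * bv tau s) by (symmetry; apply is_derive_unique, D4).
  replace (Derive (fun x : R => omega tau x) s) with (exp s) by (symmetry; apply is_derive_unique, D5).
  field. lra.
Qed.

Lemma energy_decr tau s t : t <= s -> energy tau s <= energy tau t.
Proof.
intros Hts.
destruct (MVT_gen (energy tau) t s (fun s => - (exp s * (bu1 tau s ^ 2 + bv1 tau s ^ 2) / omega tau s ^ 2))) as [c [_ E]].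
- intros x _. apply is_derive_energy.
- intros x _. apply continuity_pt_of_ex_derive. eexists. apply is_derive_energy.
- assert (0 <= exp c * (bu1 tau c ^ 2 + bv1 tau c ^ 2) / omega tau c ^ 2).
  { apply Rdiv_le_0_compat; [| apply pow_lt, omega_pos].
    apply Rmult_le_pos; [left; apply exp_pos |].
    assert (H1 := pow2_ge_0 (bu1 tau c)). assert (H2 := pow2_ge_0 (bv1 tau c)). lra. }
  nra.
Qed.

(** Monotonicity reduces the bound to the limit at -oo. The oscillating factors cancel in the
    squared moduli, so [energy] is a function [F] of [z = e^s] that is continuous at 0; there the
    derivative term and the value term both equal [asq], whence the 2. *)
Lemma energy_le tau s : 0 < tau -> energy tau s <= 2 * asq tau.
Proof.
intros Ht.
set (F := fun z => ((tau / 2) ^ 2 * (P1 tau z ^ 2 + P2 tau z ^ 2) + tau * (P1 tau z * Q2 tau z - P2 tau z * Q1 tau z)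
   + (Q1 tau z ^ 2 + Q2 tau z ^ 2)) / (z + (tau / 2) ^ 2) + (P1 tau z ^ 2 + P2 tau z ^ 2)).
assert (EF : forall t, energy tau t = F (exp t)).
{ intros t.
  assert (Hcs := sin2_cos2 (tau / 2 * t)). unfold Rsqr in Hcs.
  unfold energy, F, omega, bu1, bv1, bu, bv.
  set (c := cos (tau / 2 * t)) in *. set (w := sin (tau / 2 * t)) in *.

  f_equal; [f_equal |].
  - transitivity ((w * w + c * c) * ((tau / 2) ^ 2 * ((w * w + c * c) * (P1 tau (exp t) ^ 2 + P2 tau (exp t) ^ 2))
      + tau * (P1 tau (exp t) * Q2 tau (exp t) - P2 tau (exp t) * Q1 tau (exp t)) + (Q1 tau (exp t) ^ 2 + Q2 tau (exp t) ^ 2))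
      + ((tau / 2) ^ 2 * (P1 tau (exp t) ^ 2 + P2 tau (exp t) ^ 2)) * (w * w + c * c) * (1 - (w * w + c * c))); [| rewrite Hcs; ring].
    field.
  - transitivity ((w * w + c * c) * (P1 tau (exp t) ^ 2 + P2 tau (exp t) ^ 2)); [ring | rewrite Hcs; ring]. }
assert (Hmu : 0 < (tau / 2) ^ 2) by (apply pow_lt; lra).
assert (F0 : F 0 = 2 * asq tau).
{ unfold F, Q1, Q2. rewrite P1_0, P2_0, <- A_sq by exact Ht. field. lra. }
assert (CF : continuity_pt F 0).
{ assert (C1 : forall a, CV_radius a = p_infty -> ex_derive (PSeries a) 0).
  { intros a Ha. eexists. now apply is_derive_entire. }
  unfold F. cont_1d.
  assert (E1 := C1 _ (CV_pr tau)). assert (E2 := C1 _ (CV_pim tau)).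
  assert (E3 : ex_derive (Q1 tau) 0) by (eexists; apply is_derive_Q1).
  assert (E4 : ex_derive (Q2 tau) 0) by (eexists; apply is_derive_Q2).
  repeat split; try assumption. lra. }
apply le_epsilon. intros eps He.
destruct (CF eps He) as [dl [Hdl Hc]].
(* Far enough to the left for [e^t] to lie within the continuity radius of [F] at 0, and to the left
   of [s] for monotonicity. *)
set (t := Rmin s (ln (dl / 2))).
eapply Rle_trans; [apply (energy_decr tau s t), Rmin_l |]. rewrite EF.
assert (Hz : 0 < exp t < dl).
{ split; [apply exp_pos |]. apply Rle_lt_trans with (dl / 2); [| lra].
  rewrite <- (exp_ln (dl / 2)) by lra. apply exp_le_mono, Rmin_r. }
assert (H : Rabs (F (exp t) - F 0) < eps).
{ apply Hc. split; [split; [exact I | lra] |]. simpl. unfold Rdist. rewrite Rminus_0_r, Rabs_pos_eq; lra. }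
apply Rabs_lt_between in H. lra.
Qed.

Lemma bessel_bound tau s : 0 < tau -> bu tau s ^ 2 + bv tau s ^ 2 <= 2 * asq tau.
Proof.
intros Ht. eapply Rle_trans; [| apply (energy_le tau s Ht)]. unfold energy.
assert (0 <= (bu1 tau s ^ 2 + bv1 tau s ^ 2) / omega tau s).
{ apply Rdiv_le_0_compat; [| apply omega_pos].
  assert (H1 := pow2_ge_0 (bu1 tau s)). assert (H2 := pow2_ge_0 (bv1 tau s)). lra. }
lra.
Qed.

Lemma bessel1_bound tau s : 0 < tau -> bu1 tau s ^ 2 + bv1 tau s ^ 2 <= 2 * asq tau * omega tau s.
Proof.
intros Ht. assert (Ho := omega_pos tau s). assert (E := energy_le tau s Ht). unfold energy in E.
assert (H1 := pow2_ge_0 (bu tau s)). assert (H2 := pow2_ge_0 (bv tau s)).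
apply Rmult_le_reg_r with (/ omega tau s); [now apply Rinv_0_lt_compat |].
rewrite Rmult_assoc, Rinv_r by lra. lra.
Qed.

(** * The Gaussian transform of Im J^2 *)

(* [2 Y] is the imaginary part of [J_{i tau}(2 e^{s/2})^2]. *)
Definition Y tau s := bu tau s * bv tau s.
Definition Y1 tau s := bu1 tau s * bv tau s + bu tau s * bv1 tau s.
(* Chosen so that [Y'' = 2 MM - 4 omega Y] while [MM'] involves [Y] only. *)
Definition MM tau s := bu1 tau s * bv1 tau s + omega tau s * Y tau s.

Lemma is_derive_Y tau s : is_derive (Y tau) s (Y1 tau s).
Proof.
apply @is_derive_mult; [apply is_derive_bu | apply is_derive_bv | intros; apply Rmult_comm].
Qed.

Lemma is_derive_Y1 tau s : is_derive (Y1 tau) s (2 * MM tau s - 4 * omega tau s * Y tau s).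
Proof.
evar_last.
- apply @is_derive_plus; apply @is_derive_mult;
    [apply is_derive_bu1 | apply is_derive_bv | intros; apply Rmult_comm
    | apply is_derive_bu | apply is_derive_bv1 | intros; apply Rmult_comm].
- unfold plus, mult; simpl. unfold MM, Y. ring.
Qed.

Lemma is_derive_omega tau s : is_derive (omega tau) s (exp s).
Proof. unfold omega. auto_derive; [exact I | ring]. Qed.

Lemma is_derive_MM tau s : is_derive (MM tau) s (exp s * Y tau s).
Proof.
evar_last.
- apply @is_derive_plus; apply @is_derive_mult;
    [apply is_derive_bu1 | apply is_derive_bv1 | intros; apply Rmult_comm
    | apply is_derive_omega | apply is_derive_Y | intros; apply Rmult_comm].
- unfold plus, mult; simpl. unfold Y1, Y. ring.
Qed.

Lemma cont_of_is_derive f g : (forall x, is_derive f x (g x)) -> cont f.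
Proof. intros H. apply cont_of_ex_derive. intros x. eexists. apply H. Qed.

Lemma Y_bound tau s : 0 < tau -> Rabs (Y tau s) <= asq tau.
Proof.
intros Ht. assert (H := bessel_bound tau s Ht). unfold Y. apply Rabs_le.
assert (H1 := pow2_ge_0 (bu tau s - bv tau s)). assert (H2 := pow2_ge_0 (bu tau s + bv tau s)).
split; nra.
Qed.

Lemma MM_bound_omega tau s : 0 < tau -> Rabs (MM tau s) <= 2 * asq tau * omega tau s.
Proof.
intros Ht. assert (H := bessel1_bound tau s Ht). assert (HY := Y_bound tau s Ht).
assert (Ho := omega_pos tau s).
eapply Rle_trans; [apply Rabs_triang |]. rewrite (Rabs_mult (omega tau s)), (Rabs_pos_eq (omega tau s)) by lra.
assert (Rabs (bu1 tau s * bv1 tau s) <= asq tau * omega tau s).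
{ apply Rabs_le.
  assert (H1 := pow2_ge_0 (bu1 tau s - bv1 tau s)). assert (H2 := pow2_ge_0 (bu1 tau s + bv1 tau s)).
  split; nra. }
nra.
Qed.

Lemma Y1_bound tau s : 0 < tau -> Rabs (Y1 tau s) <= asq tau * (omega tau s + 1).
Proof.
intros Ht. assert (H := bessel1_bound tau s Ht). assert (H' := bessel_bound tau s Ht).
unfold Y1. apply Rabs_le.
assert (H1 := pow2_ge_0 (bu1 tau s - bv tau s)). assert (H2 := pow2_ge_0 (bu1 tau s + bv tau s)).
assert (H3 := pow2_ge_0 (bv1 tau s - bu tau s)). assert (H4 := pow2_ge_0 (bv1 tau s + bu tau s)).
split; nra.
Qed.

Lemma Rabs_le_1_sq x c : x ^ 2 <= c -> Rabs x <= 1 + c.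
Proof.
intros H. rewrite <- pow2_abs in H.
nra.
Qed.

Lemma u0_v0_sq tau s : 0 < tau -> u0 tau s ^ 2 + v0 tau s ^ 2 = asq tau.
Proof.
intros Ht. rewrite <- A_sq by exact Ht. unfold u0, v0.
assert (Hcs := sin2_cos2 (tau / 2 * s)). unfold Rsqr in Hcs.
set (c := cos (tau / 2 * s)) in *. set (w := sin (tau / 2 * s)) in *.
transitivity ((w * w + c * c) * (A1 tau ^ 2 + A2 tau ^ 2)); [ring | rewrite Hcs; ring].
Qed.

Lemma bessel_bounds_neg tau : 0 < tau -> exists B, 0 < B /\ forall s, s <= 0 ->
  Rabs (bu tau s) <= B /\ Rabs (bv tau s) <= B /\ Rabs (bv1 tau s) <= B /\
  Rabs (u0 tau s) <= B /\ Rabs (v0 tau s) <= B.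
Proof.
intros Ht. assert (Hq := asq_pos tau Ht).
set (c := 2 * asq tau * (2 + (tau / 2) ^ 2)).
assert (Hc : 2 * asq tau <= c) by (unfold c; nra).
exists (1 + c). split; [lra |]. intros s Hs.
assert (H1 := bessel_bound tau s Ht). assert (H2 := bessel1_bound tau s Ht). assert (H3 := u0_v0_sq tau s Ht).
assert (Ho : omega tau s <= 2 + (tau / 2) ^ 2).
{ unfold omega. assert (exp s <= 1) by (rewrite <- exp_0; now apply exp_le_mono). lra. }
assert (Hc2 : 2 * asq tau * omega tau s <= c) by (unfold c; apply Rmult_le_compat_l; lra).
assert (N1 := pow2_ge_0 (bu tau s)). assert (N2 := pow2_ge_0 (bv tau s)).
assert (N3 := pow2_ge_0 (bu1 tau s)).
assert (N5 := pow2_ge_0 (u0 tau s)). assert (N6 := pow2_ge_0 (v0 tau s)).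
repeat split; apply Rabs_le_1_sq; lra.
Qed.

Lemma Rabs_mult_le a b A B : Rabs a <= A -> Rabs b <= B -> Rabs (a * b) <= A * B.
Proof. intros Ha Hb. rewrite Rabs_mult. apply Rmult_le_compat; auto using Rabs_pos. Qed.

Lemma Y_asymp tau : 0 < tau -> exists K, 0 <= K /\ forall s,
  Rabs (Y tau s - u0 tau s * v0 tau s) <= K * exp s.
Proof.
intros Ht. destruct (bessel_small tau Ht) as [K [HK H]]. destruct (bessel_bounds_neg tau Ht) as [B [HB HB']].
assert (Hq := asq_pos tau Ht).
exists (2 * B * K + 2 * asq tau). split; [nra |]. intros s.
assert (He := exp_pos s).
destruct (Rle_dec s 0) as [Hs|Hs].
- destruct (H s Hs) as [H1 [H2 _]]. destruct (HB' s Hs) as [B1 [B2 [_ [B4 B5]]]].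
  unfold Y. replace (bu tau s * bv tau s - u0 tau s * v0 tau s)
    with (bu tau s * (bv tau s - v0 tau s) + v0 tau s * (bu tau s - u0 tau s)) by ring.
  eapply Rle_trans; [apply Rabs_triang |].
  assert (M1 := Rabs_mult_le _ _ _ _ B1 H2). assert (M2 := Rabs_mult_le _ _ _ _ B5 H1). nra.
(* For [s > 0] the allowed error is at least its value at 0, so boundedness of [Y] and of its
   leading term suffices; this accounts for [2 * asq tau] in the constant. *)
- assert (1 <= exp s) by (rewrite <- exp_0; apply exp_le_mono; lra).
  assert (HY := Y_bound tau s Ht). assert (H3 := u0_v0_sq tau s Ht).
  assert (Rabs (u0 tau s * v0 tau s) <= asq tau).
  { apply Rabs_le.
    split; nra. }
  eapply Rle_trans; [apply Rabs_triang |]. rewrite Rabs_Ropp.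
  assert (0 <= 2 * B * K) by nra. nra.
Qed.

(** The leading terms cancel: at -oo [bu1 * bv1] behaves like [- (tau/2)^2 u0 v0] and [omega Y] like
    [(tau/2)^2 u0 v0]. The decay thus obtained disposes of the boundary term in [IR_phi_MM]. *)
Lemma MM_asymp tau : 0 < tau -> exists K, 0 <= K /\ forall s, Rabs (MM tau s) <= K * exp s.
Proof.
intros Ht. destruct (bessel_small tau Ht) as [K [HK H]]. destruct (bessel_bounds_neg tau Ht) as [B [HB HB']].
assert (Hq := asq_pos tau Ht). assert (Hmu := pow2_ge_0 (tau / 2)).
set (K1 := B * K + tau / 2 * B * K + (tau / 2) ^ 2 * (2 * B * K) + asq tau).
set (K2 := 2 * asq tau * (1 + (tau / 2) ^ 2)).
assert (HBK : 0 <= B * K) by nra.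
assert (HK1 : 0 <= K1) by (unfold K1; nra). assert (HK2 : 0 <= K2) by (unfold K2; nra).
exists (K1 + K2). split; [lra |]. intros s. assert (He := exp_pos s).
destruct (Rle_dec s 0) as [Hs|Hs].
- destruct (H s Hs) as [H1 [H2 [H3 H4]]]. destruct (HB' s Hs) as [B1 [B2 [B3 [B4 B5]]]].
  apply Rle_trans with (K1 * exp s); [| nra].
  replace (MM tau s) with ((bu1 tau s + tau / 2 * v0 tau s) * bv1 tau s
    + (- (tau / 2) * (v0 tau s * (bv1 tau s - tau / 2 * u0 tau s))
    + ((tau / 2) ^ 2 * (bu tau s * (bv tau s - v0 tau s) + v0 tau s * (bu tau s - u0 tau s))
    + exp s * Y tau s))) by (unfold MM, omega, Y; ring).
  assert (M1 := Rabs_mult_le _ _ _ _ H3 B3). assert (M2 := Rabs_mult_le _ _ _ _ B5 H4).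
  assert (M3 := Rabs_mult_le _ _ _ _ B1 H2). assert (M4 := Rabs_mult_le _ _ _ _ B5 H1).
  assert (M5 := Y_bound tau s Ht).
  eapply Rle_trans; [apply Rabs_triang |].
  eapply Rle_trans; [apply Rplus_le_compat_l, Rabs_triang |].
  eapply Rle_trans; [apply Rplus_le_compat_l, Rplus_le_compat_l, Rabs_triang |].
  rewrite (Rabs_mult (- _)), Rabs_Ropp, (Rabs_pos_eq (tau / 2)) by lra.
  rewrite (Rabs_mult ((tau / 2) ^ 2)), (Rabs_pos_eq ((tau / 2) ^ 2)) by lra.
  rewrite (Rabs_mult (exp s)), (Rabs_pos_eq (exp s)) by lra.
  assert (M34 := Rabs_triang (bu tau s * (bv tau s - v0 tau s)) (v0 tau s * (bu tau s - u0 tau s))).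
  assert (T2 : tau / 2 * Rabs (v0 tau s * (bv1 tau s - tau / 2 * u0 tau s)) <= tau / 2 * (B * (K * exp s)))
    by (apply Rmult_le_compat_l; lra).
  assert (T3 : (tau / 2) ^ 2 * Rabs (bu tau s * (bv tau s - v0 tau s) + v0 tau s * (bu tau s - u0 tau s))
    <= (tau / 2) ^ 2 * (B * (K * exp s) + B * (K * exp s))) by (apply Rmult_le_compat_l; lra).
  assert (T4 : exp s * Rabs (Y tau s) <= exp s * asq tau) by (apply Rmult_le_compat_l; lra).
  unfold K1. lra.
- assert (1 <= exp s) by (rewrite <- exp_0; apply exp_le_mono; lra).
  apply Rle_trans with (K2 * exp s); [| nra].
  eapply Rle_trans; [apply (MM_bound_omega tau s Ht) |].
  replace (K2 * exp s) with (2 * asq tau * ((1 + (tau / 2) ^ 2) * exp s)) by (unfold K2; ring).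
  apply Rmult_le_compat_l; [lra |]. unfold omega. nra.
Qed.

Lemma gam_w_dom a : 1 <= a -> exists K, 0 < K /\ forall r, gam_w a r <= K * exp (- (1 * Rabs r)).
Proof.
intros Ha. destruct (exp_minus_exp_bound (a + 1) ltac:(lra)) as [K [HK H]].
exists (Rmax 1 K). split; [eapply Rlt_le_trans; [apply Rlt_0_1 | apply Rmax_l] |].
intros r. rewrite Rmult_1_l. unfold gam_w, Rabs. destruct (Rcase_abs r) as [Hr|Hr].
- apply Rle_trans with (1 * exp (- - r)).
  + rewrite Rmult_1_l. apply exp_le_mono. assert (H1 := exp_pos r). nra.
  + apply Rmult_le_compat_r; [left; apply exp_pos | apply Rmax_l].
- replace (a * r - exp r) with (((a + 1) * r - exp r) + - r) by ring. rewrite exp_plus.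
  apply Rmult_le_compat_r; [left; apply exp_pos |]. eapply Rle_trans; [apply H | apply Rmax_r].
Qed.

(** Growth class for the functions integrated against Gamma weights; it contains [e^s] because
    [omega] grows that fast. *)
Definition subexp C (G : R -> R) := forall s, Rabs (G s) <= C * (1 + exp s).

(** The factor [e^r] allowed by [subexp] raises the order of the Gamma weight by one, and the shift
    costs at most [e^(l0)]. One bound thus serves all [l <= l0], as differentiation in [l]
    requires. *)
Lemma gam_w_conv_dom a C G l0 : 1 <= a -> subexp C G ->
  exists K, forall r l, l <= l0 -> Rabs (gam_w a r * G (r + l)) <= K * exp (- (1 * Rabs r)).
Proof.
intros Ha HG. destruct (gam_w_dom a Ha) as [K1 [HK1 H1]].
destruct (gam_w_dom (a + 1) ltac:(lra)) as [K2 [HK2 H2]].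
exists (C * (K1 + exp l0 * K2)). intros r l Hl.
assert (HC : 0 <= C).
{ specialize (HG 0). rewrite exp_0 in HG. assert (H := Rabs_pos (G 0)). lra. }
rewrite Rabs_mult, (Rabs_pos_eq (gam_w a r)) by (left; apply exp_pos).
assert (Hw : 0 < gam_w a r) by apply exp_pos.
apply Rle_trans with (gam_w a r * (C * (1 + exp l0 * exp r))).
- apply Rmult_le_compat_l; [lra |]. eapply Rle_trans; [apply HG |].
  apply Rmult_le_compat_l; [exact HC |]. rewrite exp_plus.
  assert (exp l <= exp l0) by now apply exp_le_mono. assert (Hr := exp_pos r). nra.
- replace (gam_w a r * (C * (1 + exp l0 * exp r))) with (C * (gam_w a r + exp l0 * gam_w (a + 1) r))
    by (rewrite gam_w_succ; ring).
  rewrite Rmult_assoc. apply Rmult_le_compat_l; [exact HC |].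
  specialize (H1 r). specialize (H2 r). assert (H := exp_pos l0). nra.
Qed.

Lemma cont_shift_mult f G l : cont f -> cont G -> cont (fun r => f r * G (r + l)).
Proof.
intros Hf HG. apply cont_mult; [exact Hf |]. apply (cont_comp G (fun r => r + l)); [exact HG |].
apply cont_of_ex_derive. intros t. auto_derive. exact I.
Qed.

Lemma cont_gam_w a : cont (gam_w a).
Proof. apply cont_of_ex_derive. intros x. unfold gam_w. auto_derive. exact I. Qed.

Lemma Good_gam_w_conv a C G l : 1 <= a -> cont G -> subexp C G -> Good (fun r => gam_w a r * G (r + l)).
Proof.
intros Ha HG HC. destruct (gam_w_conv_dom a C G l Ha HC) as [K HK].
split; [apply cont_shift_mult; [apply cont_gam_w | exact HG] |].
exists 1, K. split; [lra |]. intros r. apply HK. lra.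
Qed.

Lemma is_derive_conv C (G G1 : R -> R) l : (forall s, is_derive G s (G1 s)) -> cont G1 ->
  subexp C G -> subexp C G1 ->
  is_derive (fun l => IR (fun r => gam_w 1 r * G (r + l))) l (IR (fun r => gam_w 1 r * G1 (r + l))).
Proof.
intros HD HG1 HC HC1. destruct (gam_w_conv_dom 1 C G1 (l + 1) ltac:(lra) HC1) as [K HK].
apply (is_derive_IR (fun r l => gam_w 1 r * G (r + l)) (fun r l => gam_w 1 r * G1 (r + l)) (l - 1) (l + 1) 1 K); try lra.
- intros r q _. apply is_derive_scal. rewrite <- (Rmult_1_l (G1 (r + q))).
  apply (is_derive_comp G (fun q => r + q)); [apply HD | auto_derive; [exact I | ring]].
- intros r q _. apply continuity_2d_pt_mult.
  + apply continuity_2d_pt_fst. apply continuity_pt_filterlim. apply cont_gam_w.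
  + apply (continuity_1d_2d_pt_comp G1 (fun r q => r + q)).
    * apply continuity_pt_filterlim. apply HG1.
    * cont_2d.
- intros r q Hq. apply HK. lra.
- intros q _. apply Good_gam_w_conv with C; [lra | now apply cont_of_is_derive with G1 | exact HC].
Qed.

Lemma subexp_Y tau : 0 < tau -> subexp (asq tau) (Y tau).
Proof.
intros Ht s. eapply Rle_trans; [apply (Y_bound tau s Ht) |].
assert (Hq := asq_pos tau Ht). assert (He := exp_pos s). nra.
Qed.

Lemma omega_le tau s : omega tau s <= (1 + (tau / 2) ^ 2) * (1 + exp s).
Proof. unfold omega. assert (He := exp_pos s). nra. Qed.

Definition wbound tau := 6 * asq tau * (2 + (tau / 2) ^ 2).

Lemma subexp_Y1 tau : 0 < tau -> subexp (wbound tau) (Y1 tau).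
Proof.
intros Ht s. eapply Rle_trans; [apply (Y1_bound tau s Ht) |].
assert (Hq := asq_pos tau Ht). assert (He := exp_pos s). assert (Ho := omega_le tau s).
unfold wbound.
rewrite (Rmult_comm 6), !Rmult_assoc. apply Rmult_le_compat_l; nra.
Qed.

Lemma subexp_MM tau : 0 < tau -> subexp (wbound tau) (MM tau).
Proof.
intros Ht s. eapply Rle_trans; [apply (MM_bound_omega tau s Ht) |].
assert (Hq := asq_pos tau Ht). assert (He := exp_pos s). assert (Ho := omega_le tau s).
unfold wbound.
rewrite (Rmult_comm 6), (Rmult_comm 2), !Rmult_assoc. apply Rmult_le_compat_l; nra.
Qed.

Lemma subexp_Y2 tau : 0 < tau -> subexp (wbound tau) (fun s => 2 * MM tau s - 4 * omega tau s * Y tau s).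
Proof.
intros Ht s.
assert (Hq := asq_pos tau Ht). assert (Ho := omega_le tau s).
assert (HM := Y_bound tau s Ht). assert (Hop := omega_pos tau s).
assert (E : Rabs (bu1 tau s * bv1 tau s) <= asq tau * omega tau s).
{ assert (HB := bessel1_bound tau s Ht). apply Rabs_le.
  assert (H1 := pow2_ge_0 (bu1 tau s - bv1 tau s)). assert (H2 := pow2_ge_0 (bu1 tau s + bv1 tau s)).
  split; nra. }
replace (2 * MM tau s - 4 * omega tau s * Y tau s) with (2 * (bu1 tau s * bv1 tau s) - 2 * omega tau s * Y tau s)
  by (unfold MM; ring).
eapply Rle_trans; [apply Rabs_triang |]. rewrite Rabs_Ropp, !Rabs_mult in *.
rewrite (Rabs_pos_eq 2), (Rabs_pos_eq (omega tau s)) by lra.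
apply Rle_trans with (4 * asq tau * omega tau s); [nra |].
unfold wbound. rewrite (Rmult_comm 6), (Rmult_comm 4), !Rmult_assoc. apply Rmult_le_compat_l; nra.
Qed.

(* [W] is [int_0^oo e^{-y} Y (ln (y e^l)) dy], a Gaussian transform in [x = 2 sqrt (y e^l)]. *)
Definition W tau l := IR (fun r => gam_w 1 r * Y tau (r + l)).
Definition W1 tau l := IR (fun r => gam_w 1 r * Y1 tau (r + l)).

Lemma cont_Y tau : cont (Y tau).
Proof. apply cont_of_is_derive with (Y1 tau). apply is_derive_Y. Qed.

Lemma cont_MM tau : cont (MM tau).
Proof. apply cont_of_is_derive with (fun s => exp s * Y tau s). apply is_derive_MM. Qed.

Lemma cont_Y1 tau : cont (Y1 tau).
Proof. eapply cont_of_is_derive. apply is_derive_Y1. Qed.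

Lemma cont_omega tau : cont (omega tau).
Proof. eapply cont_of_is_derive. apply is_derive_omega. Qed.

Lemma cont_const (c : R) : cont (fun _ => c).
Proof. intros x. apply continuous_const. Qed.

Lemma cont_Y2 tau : cont (fun s => 2 * MM tau s - 4 * omega tau s * Y tau s).
Proof.
apply cont_minus; [apply cont_mult; [apply cont_const | apply cont_MM] |].
apply cont_mult; [apply cont_mult; [apply cont_const | apply cont_omega] | apply cont_Y].
Qed.

Lemma is_derive_W tau l : 0 < tau -> is_derive (W tau) l (W1 tau l).
Proof.
intros Ht. apply (is_derive_conv (asq tau + wbound tau)).
- apply is_derive_Y.
- apply cont_Y1.
- intros s. eapply Rle_trans; [apply subexp_Y; exact Ht |].
  apply Rmult_le_compat_r; [assert (H := exp_pos s); lra |].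
  assert (Hq := asq_pos tau Ht). unfold wbound. nra.
- intros s. eapply Rle_trans; [apply subexp_Y1; exact Ht |].
  apply Rmult_le_compat_r; [assert (H := exp_pos s); lra |].
  assert (Hq := asq_pos tau Ht). lra.
Qed.

(** Multiplication by [y] inside the transform becomes [1 + d/dl]: integrate the total derivative of
    [- (gam_w 1 r * Y tau (r + l))]. *)
Lemma IR_gam_w_2_Y tau l : 0 < tau -> IR (fun r => gam_w 2 r * Y tau (r + l)) = W tau l + W1 tau l.
Proof.
intros Ht.
assert (G0 := Good_gam_w_conv 1 _ _ l ltac:(lra) (cont_Y tau) (subexp_Y tau Ht)).
assert (G1 := Good_gam_w_conv 1 _ _ l ltac:(lra) (cont_Y1 tau) (subexp_Y1 tau Ht)).
assert (G2 := Good_gam_w_conv 2 _ _ l ltac:(lra) (cont_Y tau) (subexp_Y tau Ht)).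
unfold W, W1. rewrite <- IR_plus by assumption.
apply Rminus_diag_uniq. symmetry.
rewrite <- IR_minus; [| exact G2 | now apply Good_plus]. symmetry.
apply (IR_derive_0 (fun r => - (gam_w 1 r * Y tau (r + l)))).
- apply Good_minus; [exact G2 | now apply Good_plus].
- now apply Good_opp.
- intros r. evar_last.
  + apply @is_derive_opp. apply @is_derive_mult.
    * apply is_derive_gam_w.
    * apply (is_derive_comp (Y tau) (fun r => r + l)); [apply is_derive_Y | auto_derive; [exact I | reflexivity]].
    * intros; apply Rmult_comm.
  + unfold opp, plus, mult, scal; simpl; unfold mult; simpl. replace (1 + 1) with 2 by ring. ring.
Qed.

(** Here the order of the equation drops: [- e^(-y)] is a primitive of the weight and [MM' = e^s Y],
    so integration by parts expresses the transform of [MM] by that of [Y]. *)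
Lemma IR_phi_MM tau l : 0 < tau -> IR (fun r => gam_w 1 r * MM tau (r + l)) = exp l * W tau l.
Proof.
intros Ht. destruct (MM_asymp tau Ht) as [K [HK HKM]].
assert (G0 := Good_gam_w_conv 1 _ _ l ltac:(lra) (cont_Y tau) (subexp_Y tau Ht)).
assert (G1 := Good_gam_w_conv 1 _ _ l ltac:(lra) (cont_MM tau) (subexp_MM tau Ht)).
unfold W. rewrite <- IR_scal by assumption.
apply Rminus_diag_uniq. rewrite <- IR_minus; [| exact G1 | now apply Good_scal].
apply (IR_derive_0 (fun r => - (exp (- exp r) * MM tau (r + l)))).
- apply Good_minus; [exact G1 | now apply Good_scal].
- apply Good_opp. apply Good_le with (fun r => (K * exp l) * gam_w 1 r).
  + apply cont_shift_mult; [| apply cont_MM]. apply cont_of_ex_derive. intros x. auto_derive. exact I.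
  + apply Good_scal, Good_gam_w. lra.
  + intros r. rewrite Rabs_mult, Rabs_pos_eq by (left; apply exp_pos).
    unfold gam_w, Rminus. rewrite exp_plus, Rmult_1_l.
    apply Rle_trans with (exp (- exp r) * (K * exp (r + l))).
    * apply Rmult_le_compat_l; [left; apply exp_pos | apply HKM].
    * right. rewrite exp_plus. ring.
- intros r. evar_last.
  + apply @is_derive_opp. apply @is_derive_mult.
    * auto_derive; [exact I | reflexivity].
    * apply (is_derive_comp (MM tau) (fun r => r + l)); [apply is_derive_MM | auto_derive; [exact I | reflexivity]].
    * intros; apply Rmult_comm.
  + unfold opp, plus, mult, scal; simpl; unfold mult; simpl.
    assert (E : gam_w 1 r = exp r * exp (- exp r)) by (unfold gam_w; rewrite <- exp_plus; f_equal; ring).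
    rewrite E, exp_plus. ring.
Qed.

(** Insert [Y'' = 2 MM - 4 omega Y]: the [MM] part gives [2 e^l W], the exponential in [omega] gives
    [- 4 e^l (W + W1)], and its constant gives [- tau^2 W]. *)
Lemma is_derive_W1 tau l : 0 < tau ->
  is_derive (W1 tau) l (- (4 * exp l * W1 tau l + (2 * exp l + tau ^ 2) * W tau l)).
Proof.
intros Ht.
assert (G0 := Good_gam_w_conv 1 _ _ l ltac:(lra) (cont_Y tau) (subexp_Y tau Ht)).
assert (G1 := Good_gam_w_conv 1 _ _ l ltac:(lra) (cont_MM tau) (subexp_MM tau Ht)).
assert (G2 := Good_gam_w_conv 2 _ _ l ltac:(lra) (cont_Y tau) (subexp_Y tau Ht)).
replace (- (4 * exp l * W1 tau l + (2 * exp l + tau ^ 2) * W tau l))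
  with (IR (fun r => gam_w 1 r * (2 * MM tau (r + l) - 4 * omega tau (r + l) * Y tau (r + l)))).
- apply (is_derive_conv (wbound tau) (Y1 tau) (fun s => 2 * MM tau s - 4 * omega tau s * Y tau s)).
  + apply is_derive_Y1.
  + apply cont_Y2.
  + now apply subexp_Y1.
  + now apply subexp_Y2.
- rewrite (IR_ext _ (fun r => (2 * (gam_w 1 r * MM tau (r + l)) + (- 4 * exp l) * (gam_w 2 r * Y tau (r + l)))
      + (- tau ^ 2) * (gam_w 1 r * Y tau (r + l)))).
  + rewrite !IR_plus, !IR_scal, IR_phi_MM, IR_gam_w_2_Y
      by (good || assumption).
    fold (W tau l). ring.
  + intros r. assert (E : gam_w 2 r = exp r * gam_w 1 r).
    { rewrite <- gam_w_succ. now replace (1 + 1) with 2 by ring. }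
    rewrite E. unfold omega. rewrite exp_plus. field.
Qed.

(** * The Macdonald function and its equation *)

Lemma pow_exp_neg_bound n : exists K, 0 < K /\ forall x, 0 < x -> x ^ n * exp (- x) <= K.
Proof.
destruct (exp_minus_exp_bound (INR n) (pos_INR n)) as [K [HK H]].
exists K. split; [exact HK |]. intros x Hx. specialize (H (ln x)).
rewrite exp_ln in H by exact Hx. unfold Rminus in H. rewrite exp_plus in H.
replace (exp (INR n * ln x)) with (x ^ n) in H; [exact H |].
change (x ^ n = Rpower x (INR n)). now rewrite Rpower_pow.
Qed.

(** With [z = 2 e^l], [VE] is [e^(-z) e^(-z cosh t)]. [VX] is minus the exponent and also the factor
    that an [l]-derivative brings down, up to sign. *)
Definition VX t l := 2 * exp l * (1 + cosh t).
Definition VE t l := exp (- VX t l).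

Lemma VX_pos t l : 0 < VX t l.
Proof. unfold VX. assert (H := cosh_ge_1 t). assert (H1 := exp_pos l). nra. Qed.

Lemma VX_lower t l q : l <= q -> 2 * exp l * cosh t <= VX t q.
Proof.
intros H. unfold VX. assert (H1 := cosh_ge_1 t). assert (H2 := exp_le_mono _ _ H).
assert (H3 := exp_pos l). nra.
Qed.

(** A spare power does it: [X^(n+1) e^(-X)] is bounded, so [X^n e^(-X)] is at most a multiple of
    [1/X], and [X] dominates [cosh t]. *)
Lemma VE_dom n : exists K, 0 < K /\ forall l q t, l <= q -> VX t q ^ n * VE t q <= (K / (2 * exp l)) / cosh t.
Proof.
destruct (pow_exp_neg_bound (S n)) as [K [HK H]]. exists K. split; [exact HK |].
intros l q t Hl. specialize (H (VX t q) (VX_pos t q)). fold (VE t q) in H. simpl in H.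
assert (HX := VX_lower t l q Hl). assert (H1 := cosh_ge_1 t). assert (H2 := exp_pos l).
assert (Hc : 0 < 2 * exp l * cosh t) by nra.
assert (HP : 0 <= VX t q ^ n * VE t q).
{ apply Rmult_le_pos; [apply pow_le; lra | left; apply exp_pos]. }
apply Rmult_le_reg_r with (2 * exp l * cosh t); [exact Hc |].
replace (K / (2 * exp l) / cosh t * (2 * exp l * cosh t)) with K by (field; lra).
eapply Rle_trans; [| exact H].
replace (VX t q * VX t q ^ n * VE t q) with (VX t q ^ n * VE t q * VX t q) by ring.
now apply Rmult_le_compat_l.
Qed.

Lemma is_derive_VX t l : is_derive (VX t) l (VX t l).
Proof. unfold VX. auto_derive; [exact I | ring]. Qed.

Lemma is_derive_VE t l : is_derive (VE t) l (- (VX t l * VE t l)).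
Proof.
unfold VE. evar_last.
- apply (is_derive_comp exp (fun l => - VX t l)); [apply is_derive_exp |].
  apply @is_derive_opp, is_derive_VX.
- unfold scal, opp; simpl; unfold mult; simpl. ring.
Qed.

Lemma is_derive_VXE t l : is_derive (fun l => - (VX t l * VE t l)) l ((VX t l ^ 2 - VX t l) * VE t l).
Proof.
evar_last.
- apply @is_derive_opp, @is_derive_mult; [apply is_derive_VX | apply is_derive_VE | intros; apply Rmult_comm].
- unfold plus, opp, mult; simpl. ring.
Qed.

Lemma cont2_VX : cont2 VX.
Proof. unfold VX. cont_2d. Qed.

Lemma cont2_VE : cont2 VE.
Proof.
intros t l. apply (continuity_1d_2d_pt_comp exp); [cont_1d; exact I |].
apply continuity_2d_pt_opp, cont2_VX.
Qed.

Lemma Good_VE_gen f l n K : cont f -> (forall t, Rabs (f t) <= K * (VX t l ^ n * VE t l)) -> Good f.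
Proof.
intros Hf H. destruct (VE_dom n) as [K' [HK' HE]].
apply Good_of_cosh with (K * (K' / (2 * exp l))); [exact Hf |].
assert (HK : 0 <= K).
{ specialize (H 0). assert (H1 := Rabs_pos (f 0)).
  assert (H2 : 0 < VX 0 l ^ n * VE 0 l) by (apply Rmult_lt_0_compat; [apply pow_lt, VX_pos | apply exp_pos]).
  nra. }
intros t. eapply Rle_trans; [apply H |]. unfold Rdiv. rewrite Rmult_assoc.
apply Rmult_le_compat_l; [exact HK |]. apply HE. lra.
Qed.

Lemma is_derive_Vker tau (n : nat) (f g : R -> R -> R) l :
  (forall t q, is_derive (f t) q (g t q)) -> cont2 g -> (forall q, Good (fun t => f t q)) ->
  (exists n m, forall t q, Rabs (g t q) <= VX t q ^ n * VE t q + VX t q ^ m * VE t q) ->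
  is_derive (fun q => IR (fun t => cos (tau * t) * f t q)) l (IR (fun t => cos (tau * t) * g t l)).
Proof.
intros HD Hg Hf [n1 [n2 HB]].
destruct (VE_dom n1) as [K1 [HK1 H1]]. destruct (VE_dom n2) as [K2 [HK2 H2]].
assert (He := exp_pos (l - 1)).
assert (HK : 0 <= (K1 + K2) / (2 * exp (l - 1))) by (apply Rdiv_le_0_compat; lra).
apply (is_derive_IR (fun t q => cos (tau * t) * f t q) (fun t q => cos (tau * t) * g t q) (l - 1) (l + 1) 1
   (2 * ((K1 + K2) / (2 * exp (l - 1))))); try lra.
- intros t q _. apply is_derive_scal, HD.
- intros t q _. apply continuity_2d_pt_mult; [cont_2d | apply Hg].
- intros t q Hq. rewrite Rabs_mult.
  apply Rle_trans with (1 * ((K1 + K2) / (2 * exp (l - 1)) / cosh t)).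
  + apply Rmult_le_compat; try apply Rabs_pos; [apply Rabs_cos_le_1 |].
    eapply Rle_trans; [apply HB |].
    assert (B1 := H1 (l - 1) q t ltac:(lra)). assert (B2 := H2 (l - 1) q t ltac:(lra)).
    replace ((K1 + K2) / (2 * exp (l - 1)) / cosh t) with
     (K1 / (2 * exp (l - 1)) / cosh t + K2 / (2 * exp (l - 1)) / cosh t).
    * lra.
    * assert (HC := cosh_ge_1 t). field. lra.
  + rewrite Rmult_1_l. now apply cosh_bound_exp.
- intros q _. apply Good_mult_cos, Hf.
Qed.

Lemma Good_VE l : Good (fun t => VE t l).
Proof.
apply Good_VE_gen with l 0%nat 1; [apply (cont2_slice_l VE), cont2_VE |].
intros t. rewrite Rabs_pos_eq by (left; apply exp_pos). rewrite pow_O. lra.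
Qed.

Lemma Good_VXE l : Good (fun t => - (VX t l * VE t l)).
Proof.
apply Good_VE_gen with l 1%nat 1.
- apply cont_opp, cont_mult; [apply (cont2_slice_l VX), cont2_VX | apply (cont2_slice_l VE), cont2_VE].
- intros t. assert (HX := VX_pos t l). assert (HE : 0 < VE t l) by apply exp_pos.
  rewrite Rabs_Ropp, Rabs_pos_eq by (apply Rmult_le_pos; lra). rewrite pow_1. lra.
Qed.

(* [Vk tau l = 2 e^{-2 e^l} K_{i tau}(2 e^l)]. *)
Definition Vk tau l := IR (fun t => cos (tau * t) * VE t l).
Definition Vk1 tau l := IR (fun t => cos (tau * t) * - (VX t l * VE t l)).

Lemma is_derive_Vk tau l : is_derive (Vk tau) l (Vk1 tau l).
Proof.
apply (is_derive_Vker tau 0 VE (fun t l => - (VX t l * VE t l))).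
- apply is_derive_VE.
- intros t q. apply continuity_2d_pt_opp, continuity_2d_pt_mult; [apply cont2_VX | apply cont2_VE].
- apply Good_VE.
- exists 1%nat, 1%nat. intros t q. assert (HX := VX_pos t q). assert (HE : 0 < VE t q) by apply exp_pos.
  rewrite Rabs_Ropp, Rabs_pos_eq, pow_1 by (apply Rmult_le_pos; lra). nra.
Qed.

Lemma VE_t_derive t l : is_derive (fun t => VE t l) t (- (2 * exp l * sinh t) * VE t l).
Proof. unfold VE, VX. auto_derive; [exact I |]. ring. Qed.

Lemma sinh_VE_bound l t : Rabs (- (2 * exp l * sinh t) * VE t l) <= 1 * (VX t l ^ 1 * VE t l).
Proof.
assert (HE : 0 < VE t l) by apply exp_pos. assert (Hl := exp_pos l).
rewrite Rabs_mult, (Rabs_pos_eq (VE t l)), Rmult_1_l, pow_1 by lra.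
apply Rmult_le_compat_r; [lra |].
rewrite Rabs_Ropp, Rabs_mult, (Rabs_pos_eq (2 * exp l)) by lra.
assert (Hs := Rabs_sinh_le_cosh t). apply Rmult_le_compat_l; lra.
Qed.

Lemma cont_sinh_VE l : cont (fun t => - (2 * exp l * sinh t) * VE t l).
Proof.
apply cont_mult; [| apply (cont2_slice_l VE), cont2_VE].
apply cont_of_ex_derive. intros x. auto_derive. exact I.
Qed.

(** Integration by parts in [t] brings out [tau^2]: the combined integrand is the [t]-derivative of
    [cos (tau t)] times the [t]-derivative of [VE], plus [tau sin (tau t) VE], thanks to
    [sinh^2 = cosh^2 - 1]. *)
Lemma is_derive_Vk1 tau l :
  is_derive (Vk1 tau) l (- (4 * exp l * Vk1 tau l + (2 * exp l + tau ^ 2) * Vk tau l)).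
Proof.
set (g := fun t l => (VX t l ^ 2 - VX t l) * VE t l).
assert (Hg : cont2 g).
{ intros t q. apply continuity_2d_pt_mult; [| apply cont2_VE].
  apply continuity_2d_pt_minus; [| apply cont2_VX].
  apply continuity_2d_pt_ext with (fun t l => VX t l * VX t l); [intros; ring |].
  apply continuity_2d_pt_mult; apply cont2_VX. }
assert (Hgb : forall t q, Rabs (g t q) <= VX t q ^ 2 * VE t q + VX t q ^ 1 * VE t q).
{ intros t q. assert (HX := VX_pos t q). assert (HE : 0 < VE t q) by apply exp_pos.
  unfold g. rewrite Rabs_mult, (Rabs_pos_eq (VE t q)) by lra.
  rewrite <- Rmult_plus_distr_r. apply Rmult_le_compat_r; [lra |]. apply Rabs_le. nra. }
assert (Gg : Good (fun t => g t l)).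
{ apply Good_le with (fun t => VX t l ^ 2 * VE t l + VX t l ^ 1 * VE t l).
  - now apply (cont2_slice_l g).
  - assert (GP : forall n, Good (fun t => VX t l ^ n * VE t l)).
    { intros n. apply Good_VE_gen with l n 1.
      - apply cont_mult; [| apply (cont2_slice_l VE), cont2_VE].
        apply cont_of_ex_derive. intros x. unfold VX. auto_derive. exact I.
      - intros t. rewrite Rabs_pos_eq; [lra |].
        apply Rmult_le_pos; [apply pow_le; left; apply VX_pos | left; apply exp_pos]. }
    apply Good_plus; apply GP.
  - intros t. apply Hgb. }
replace (- (4 * exp l * Vk1 tau l + (2 * exp l + tau ^ 2) * Vk tau l)) with (IR (fun t => cos (tau * t) * g t l)).
- apply (is_derive_Vker tau 0 (fun t l => - (VX t l * VE t l)) g).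
  + apply is_derive_VXE.
  + exact Hg.
  + apply Good_VXE.
  + now exists 2%nat, 1%nat.
- assert (G1 := Good_mult_cos _ tau Gg). assert (G2 := Good_mult_cos _ tau (Good_VXE l)).
  assert (G3 := Good_mult_cos _ tau (Good_VE l)).
  assert (GF : Good (fun t => (cos (tau * t) * g t l + 4 * exp l * (cos (tau * t) * - (VX t l * VE t l)))
     + (2 * exp l + tau ^ 2) * (cos (tau * t) * VE t l)))
    by good.
  assert (E : IR (fun t => (cos (tau * t) * g t l + 4 * exp l * (cos (tau * t) * - (VX t l * VE t l)))
     + (2 * exp l + tau ^ 2) * (cos (tau * t) * VE t l)) = 0).
  { apply (IR_derive_0 (fun t => cos (tau * t) * (- (2 * exp l * sinh t) * VE t l) + tau * (sin (tau * t) * VE t l))).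
    - exact GF.
    - apply Good_plus; [apply Good_mult_cos | apply Good_scal, Good_mult_sin, Good_VE].
      apply Good_VE_gen with l 1%nat 1; [apply cont_sinh_VE | apply sinh_VE_bound].
    - intros t. assert (D := VE_t_derive t l).
      auto_derive; [repeat split; eexists; apply VE_t_derive |].
      replace (Derive (fun x : R => VE x l) t) with (- (2 * exp l * sinh t) * VE t l)
        by (symmetry; apply is_derive_unique, D).
      unfold g, VX. transitivity (cos (tau * t) * VE t l * (4 * exp l * exp l * (sinh t * sinh t) - 2 * exp l * cosh t + tau ^ 2)).
      + ring.
      + rewrite sinh_sq. ring. }
  rewrite !IR_plus, !IR_scal in E by good.
  fold (Vk tau l) in E. fold (Vk1 tau l) in E. lra.
Qed.

(** Linear rather than quadratic in [y] on purpose: in [Vk_asymp] one has [y = e^(l - r/2)], and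
    [y^2] would turn the weight [phi] into [e^(-e^r)], which is not integrable at -oo. *)
Lemma one_minus_exp_neg_sq y : 0 < y -> 0 <= 1 - exp (- y ^ 2) <= y.
Proof.
intros Hy. assert (H := exp_ineq1_le (- y ^ 2)). assert (H1 := exp_pos (- y ^ 2)).
split.
- assert (exp (- y ^ 2) <= exp 0) by (apply exp_le_mono; assert (H2 := pow2_ge_0 y); lra).
  rewrite exp_0 in *. lra.
- destruct (Rle_dec y 1); [simpl in *; nra | lra].
Qed.

(* Integration by parts and the substitution r = t + l expose the Gamma integrand. *)
Lemma Vk_gamma_form tau l : 0 < tau ->
  Vk tau l = 2 / tau * IR (fun r => sin (tau * (r - l)) * (phi r * exp (- (2 * exp l + exp (2 * l - r))))).
Proof.
intros Ht. assert (Hl := exp_pos l).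
assert (GE := Good_VE l).
assert (GSh : Good (fun t => - (2 * exp l * sinh t) * VE t l)).
{ apply Good_VE_gen with l 1%nat 1; [apply cont_sinh_VE | apply sinh_VE_bound]. }
assert (E1 : Vk tau l + / tau * IR (fun t => sin (tau * t) * (- (2 * exp l * sinh t) * VE t l)) = 0).
{ unfold Vk. assert (Gc := Good_mult_cos _ tau GE). assert (Gs := Good_mult_sin _ tau GSh).
  rewrite <- IR_scal by exact Gs. rewrite <- IR_plus by (exact Gc || exact (Good_scal _ _ Gs)).
  apply (IR_derive_0 (fun t => / tau * (sin (tau * t) * VE t l))).
  - apply Good_plus; [now apply Good_mult_cos | now apply Good_scal, Good_mult_sin].
  - now apply Good_scal, Good_mult_sin.
  - intros t. auto_derive; [repeat split; eexists; apply VE_t_derive |].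
    replace (Derive (fun x : R => VE x l) t) with (- (2 * exp l * sinh t) * VE t l)
      by (symmetry; apply is_derive_unique, VE_t_derive).
    field. lra. }
set (F := fun t => sin (tau * t) * (exp (l + t) * VE t l)).
assert (GF0 : Good (fun t => exp (l + t) * VE t l)).
{ apply Good_VE_gen with l 1%nat 1.
  - apply cont_mult; [| apply (cont2_slice_l VE), cont2_VE].
    apply cont_of_ex_derive. intros x. auto_derive. exact I.
  - intros t. assert (HE : 0 < VE t l) by apply exp_pos.
    rewrite Rabs_pos_eq by (apply Rmult_le_pos; left; [apply exp_pos | exact HE]).
    rewrite Rmult_1_l, pow_1. apply Rmult_le_compat_r; [lra |].
    rewrite exp_plus. unfold VX, cosh. assert (H := exp_pos (- t)). nra. }
assert (GF : Good F) by now apply Good_mult_sin.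
assert (E2 : IR (fun t => sin (tau * t) * (- (2 * exp l * sinh t) * VE t l)) = - 2 * IR F).
{ rewrite (IR_ext _ (fun t => -1 * F t + -1 * (fun s => F (- s)) t)).
  - rewrite IR_plus, !IR_scal; try apply Good_scal; try exact GF; try (now apply (Good_reflect F)).
    rewrite (IR_reflect F) by apply GF. ring.
  - intros t. unfold F. replace (tau * - t) with (- (tau * t)) by ring. rewrite sin_neg.
    replace (VE (- t) l) with (VE t l).
    + rewrite !exp_plus. unfold sinh. field.
    + unfold VE, VX, cosh. rewrite Ropp_involutive. do 2 f_equal. f_equal. f_equal. f_equal. ring. }
set (H := fun r => sin (tau * (r - l)) * (phi r * exp (- (2 * exp l + exp (2 * l - r))))).
assert (E3 : IR F = IR H).
{ rewrite (IR_ext F (fun t => H (t + l))).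
  - apply IR_shift. apply Good_ext with (fun r => F (r + - l)); [| now apply Good_shift].
    intros r. unfold F, H. f_equal.
    unfold phi, VE, VX, cosh. rewrite <- !exp_plus. f_equal.
    replace (l + (r + - l)) with r by ring.
    replace (2 * exp l * (1 + (exp (r + - l) + exp (- (r + - l))) / 2))
      with (2 * exp l + exp l * exp (r + - l) + exp l * exp (- (r + - l))) by field.
    rewrite <- !exp_plus. replace (l + (r + - l)) with r by ring.
    replace (l + - (r + - l)) with (2 * l - r) by ring. ring.
  - intros t. unfold F, H. f_equal; [f_equal; ring |].
    unfold phi, VE, VX, cosh. rewrite <- !exp_plus. f_equal.
    replace (2 * exp l * (1 + (exp t + exp (- t)) / 2))
      with (2 * exp l + exp l * exp t + exp l * exp (- t)) by field.
    rewrite <- !exp_plus. replace (2 * l - (t + l)) with (l + - t) by ring.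
    rewrite (Rplus_comm t l). ring. }
rewrite E2, E3 in E1.
assert (E4 : Vk tau l = - (/ tau * (-2 * IR H))) by lra. rewrite E4. field. lra.
Qed.

(** As [l] tends to -oo the damping factor in [Vk_gamma_form] tends to 1, and what is left is
    [2/tau] times the imaginary part of [e^(-i tau l) Gamma (1 + i tau)]. *)
Lemma Vk_asymp tau : 0 < tau -> exists K, 0 <= K /\ forall l,
  Rabs (Vk tau l - 2 / tau * (gam_im tau 1 * cos (tau * l) - gam_re tau 1 * sin (tau * l))) <= K * exp l.
Proof.
intros Ht.
(* The defect is [1 - exp (- (2 e^l + y^2)) <= 2 e^l + y] with [y = e^l e^(-r/2)]; the factor
   [e^(-r/2)] lowers the order of the weight from 1 to [1/2]. *)
set (B := fun r => 2 * gam_w 1 r + gam_w (/ 2) r).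
assert (GB : Good B) by (apply Good_plus; [apply Good_scal |]; apply Good_gam_w; lra).
assert (HB0 : 0 <= IR B).
{ eapply Rle_trans; [apply Rabs_pos |]. apply (IR_abs_le (fun _ => 0)); [apply cont_const | exact GB |].
  intros r. rewrite Rabs_R0. unfold B.
  assert (H1 : 0 < gam_w 1 r) by apply exp_pos. assert (H2 : 0 < gam_w (/ 2) r) by apply exp_pos. lra. }
exists (2 / tau * IR B). split; [apply Rmult_le_pos; [apply Rdiv_le_0_compat; lra | exact HB0] |].
intros l. rewrite Vk_gamma_form by exact Ht.
assert (G1 := Good_gam_cos0 1 tau ltac:(lra)). assert (G2 := Good_gam_sin0 1 tau ltac:(lra)).
set (S := fun r => sin (tau * (r - l)) * phi r).
assert (GS : Good S).
{ apply Good_ext with (fun r => phi r * sin (tau * (r - l))); [intros; unfold S; ring |].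
  apply Good_mult_bounded with 1; [apply Good_phi | | intros; apply Rabs_sin_le_1].
  apply cont_of_ex_derive. intros x. auto_derive. exact I. }
assert (E : gam_im tau 1 * cos (tau * l) - gam_re tau 1 * sin (tau * l) = IR S).
{ unfold S, gam_im, gam_re. rewrite !(Rmult_comm (IR _)), <- !IR_scal, <- IR_minus
    by good.
  apply IR_ext. intros r. rewrite phi_gam_w. replace (tau * (r - l)) with (tau * r - tau * l) by ring.
  rewrite sin_minus. ring. }
rewrite E, <- Rmult_minus_distr_l, Rabs_mult, (Rabs_pos_eq (2 / tau)) by (apply Rdiv_le_0_compat; lra).
rewrite Rmult_assoc. apply Rmult_le_compat_l; [apply Rdiv_le_0_compat; lra |].
set (H := fun r => sin (tau * (r - l)) * (phi r * exp (- (2 * exp l + exp (2 * l - r))))).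
assert (GH : Good H).
{ apply Good_ext with (fun r => S r * exp (- (2 * exp l + exp (2 * l - r)))); [intros; unfold S, H; ring |].
  apply Good_mult_bounded with 1; [exact GS | |].
  - apply cont_of_ex_derive. intros x. auto_derive. exact I.
  - intros r. rewrite Rabs_pos_eq by (left; apply exp_pos). rewrite <- exp_0. apply exp_le_mono.
    assert (H1 := exp_pos l). assert (H2 := exp_pos (2 * l - r)). lra. }
rewrite <- IR_minus by assumption. rewrite Rmult_comm, <- IR_scal by exact GB.
apply IR_abs_le; [now apply Good_minus | now apply Good_scal |].
intros r. unfold H, S.
assert (Hl := exp_pos l). assert (Hp : 0 < gam_w 1 r) by apply exp_pos.
replace (sin (tau * (r - l)) * (phi r * exp (- (2 * exp l + exp (2 * l - r)))) - sin (tau * (r - l)) * phi r)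
  with (- (sin (tau * (r - l)) * (phi r * (1 - exp (- (2 * exp l + exp (2 * l - r))))))) by ring.
rewrite Rabs_Ropp, Rabs_mult, phi_gam_w.
set (y := exp (l - r / 2)). assert (Hy : 0 < y) by apply exp_pos.
assert (Ey : exp (2 * l - r) = y ^ 2).
{ unfold y. simpl. rewrite Rmult_1_r, <- exp_plus. f_equal. field. }
rewrite Ey. destruct (one_minus_exp_neg_sq y Hy) as [Y0 YU].
assert (Ha := exp_ineq1_le (- (2 * exp l))).
assert (Hb : exp (- (2 * exp l)) <= 1) by (rewrite <- exp_0; apply exp_le_mono; lra).
assert (Hc0 := exp_pos (- y ^ 2)).
assert (Hs : 0 <= 1 - exp (- (2 * exp l + y ^ 2)) <= 2 * exp l + y).
{ replace (- (2 * exp l + y ^ 2)) with (- (2 * exp l) + - y ^ 2) by ring. rewrite exp_plus. split; nra. }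
apply Rle_trans with (1 * (gam_w 1 r * (2 * exp l + y))).
- apply Rmult_le_compat; [apply Rabs_pos | apply Rabs_pos | apply Rabs_sin_le_1 |].
  rewrite Rabs_pos_eq by (apply Rmult_le_pos; lra). apply Rmult_le_compat_l; lra.
- right. unfold B. replace (gam_w (/ 2) r) with (gam_w 1 r * exp (- (r / 2))).
  + unfold y, Rminus. rewrite exp_plus. ring.
  + unfold gam_w. rewrite <- exp_plus. f_equal. field.
Qed.

(** * Uniqueness of decaying solutions and comparison of the two transforms *)

Lemma small_derivative tau D D1 K : 0 <= K ->
  (forall l, is_derive D l (D1 l)) ->
  (forall l, is_derive D1 l (- (4 * exp l * D1 l + (2 * exp l + tau ^ 2) * D l))) ->
  (forall l, Rabs (D l) <= K * exp l) ->
  forall l, l <= 0 -> Rabs (D1 l) <= (12 + tau ^ 2) * K * exp l.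
Proof.
intros HK HD HD1 HB l Hl.
assert (Htau := pow2_ge_0 tau).
assert (Hmono : forall x, x <= l -> 0 < exp x <= exp l) by (intros x Hx; split; [apply exp_pos | now apply exp_le_mono]).
assert (Hl1 : exp l <= 1) by (rewrite <- exp_0; now apply exp_le_mono).
assert (HBx : forall x, x <= l -> Rabs (D x) <= K * exp l).
{ intros x Hx. eapply Rle_trans; [apply HB |]. apply Rmult_le_compat_l; [exact HK | apply Hmono, Hx]. }
(* The derivative of [Z] contains no [D1]. The mean value theorem on [[l - 1, l]] gives one point
   where [D1] is small, and [Z] carries the bound from there to [l]. *)
set (Z := fun l => D1 l + 4 * exp l * D l).
assert (HZ : forall x, is_derive Z x ((2 * exp x - tau ^ 2) * D x)).
{ intros x. evar_last.
  - apply @is_derive_plus; [apply HD1 |]. apply @is_derive_mult;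
      [auto_derive; [exact I | reflexivity] | apply HD | intros; apply Rmult_comm].
  - unfold plus, mult; simpl. ring. }
destruct (MVT_gen D (l - 1) l D1) as [x [Hx Ex]].
{ intros z _. apply HD. }
{ intros z _. apply continuity_pt_of_ex_derive. eexists. apply HD. }
rewrite Rmin_left, Rmax_right in Hx by lra.
assert (Hx1 : Rabs (D1 x) <= 2 * (K * exp l)).
{ replace (D1 x) with (D l - D (l - 1)) by (rewrite Ex; ring).
  eapply Rle_trans; [apply Rabs_triang |]. rewrite Rabs_Ropp.
  assert (A := HBx l ltac:(lra)). assert (B := HBx (l - 1) ltac:(lra)). lra. }
destruct (MVT_gen Z x l (fun x => (2 * exp x - tau ^ 2) * D x)) as [y [Hy Ey]].
{ intros z _. apply HZ. }
{ intros z _. apply continuity_pt_of_ex_derive. eexists. apply HZ. }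
rewrite Rmin_left, Rmax_right in Hy by lra.
assert (Hy1 : Rabs ((2 * exp y - tau ^ 2) * D y) <= (2 + tau ^ 2) * (K * exp l)).
{ rewrite Rabs_mult. apply Rmult_le_compat; try apply Rabs_pos; [| apply HBx; lra].
  apply Rabs_le. destruct (Hmono y ltac:(lra)). lra. }
assert (Hxl : Rabs (l - x) <= 1) by (apply Rabs_le; lra).
assert (HDe : forall z, z <= l -> Rabs (4 * exp z * D z) <= 4 * (K * exp l)).
{ intros z Hz. destruct (Hmono z Hz) as [M1 M2]. rewrite Rabs_mult, Rabs_pos_eq by lra.
  assert (A := HBx z Hz). assert (A' := Rabs_pos (D z)). nra. }
replace (D1 l) with (((2 * exp y - tau ^ 2) * D y) * (l - x) + (D1 x + 4 * exp x * D x) - 4 * exp l * D l)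
  by (rewrite <- Ey; unfold Z; ring).
assert (T1 : Rabs ((2 * exp y - tau ^ 2) * D y * (l - x)) <= (2 + tau ^ 2) * (K * exp l) * 1)
  by (apply Rabs_mult_le; assumption).
assert (T2 := HDe x ltac:(lra)). assert (T3 := HDe l ltac:(lra)).
eapply Rle_trans; [apply Rabs_triang |]. rewrite Rabs_Ropp.
eapply Rle_trans; [apply Rplus_le_compat_r, Rabs_triang |].
eapply Rle_trans; [apply Rplus_le_compat_r, Rplus_le_compat_l, Rabs_triang |].
lra.
Qed.

(** The quadratic form [E = D1^2 + tau^2 D^2] would be conserved without the [e^l] terms of the
    equation. The factor [exp (- c e^l)] absorbs those and makes [G] nonincreasing, while the decay
    of [D] and [D1] sends [G] to 0 at -oo; hence [E] vanishes everywhere. *)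
Lemma ode_unique tau D D1 K : 0 < tau -> 0 <= K ->
  (forall l, is_derive D l (D1 l)) ->
  (forall l, is_derive D1 l (- (4 * exp l * D1 l + (2 * exp l + tau ^ 2) * D l))) ->
  (forall l, Rabs (D l) <= K * exp l) -> forall l, D l = 0.
Proof.
intros Ht HK HD HD1 HB l.
assert (HS := small_derivative tau D D1 K HK HD HD1 HB).
(* Large enough for [8 D1^2 + 4 D D1 + c E] to be a sum of nonnegative squares. *)
set (c := 2 * (1 + / tau ^ 2)).
assert (Ht2 : 0 < tau ^ 2) by (apply pow_lt; lra).
assert (Hc : 0 < c) by (unfold c; assert (H := Rinv_0_lt_compat _ Ht2); lra).
set (E := fun l => D1 l ^ 2 + tau ^ 2 * D l ^ 2).
set (G := fun l => E l * exp (- (c * exp l))).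
assert (HE : forall x, is_derive E x (- (exp x * (8 * D1 x ^ 2 + 4 * D x * D1 x)))).
{ intros x. unfold E. assert (A := HD x). assert (B := HD1 x).
  auto_derive; [repeat split; eexists; eassumption |].
  replace (Derive (fun x : R => D x) x) with (D1 x) by (symmetry; apply is_derive_unique, A).
  replace (Derive (fun x : R => D1 x) x) with (- (4 * exp x * D1 x + (2 * exp x + tau ^ 2) * D x))
    by (symmetry; apply is_derive_unique, B). ring. }
assert (HG : forall x, is_derive G x (- (exp x * (8 * D1 x ^ 2 + 4 * D x * D1 x + c * E x)) * exp (- (c * exp x)))).
{ intros x. unfold G. assert (A := HE x).
  auto_derive; [repeat split; eexists; eassumption |].
  replace (Derive (fun x : R => E x) x) with (- (exp x * (8 * D1 x ^ 2 + 4 * D x * D1 x)))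
    by (symmetry; apply is_derive_unique, A). ring. }
assert (Hdecr : forall t, t <= l -> G l <= G t).
{ intros t Htl.
  destruct (MVT_gen G t l (fun x => - (exp x * (8 * D1 x ^ 2 + 4 * D x * D1 x + c * E x)) * exp (- (c * exp x)))) as [x [_ Ex]].
  - intros z _. apply HG.
  - intros z _. apply continuity_pt_of_ex_derive. eexists. apply HG.
  - assert (P : 0 <= 8 * D1 x ^ 2 + 4 * D x * D1 x + c * E x).
    { unfold c, E.
      replace (8 * D1 x ^ 2 + 4 * D x * D1 x + 2 * (1 + / tau ^ 2) * (D1 x ^ 2 + tau ^ 2 * D x ^ 2))
        with (8 * D1 x ^ 2 + 2 * (D x + D1 x) ^ 2 + 2 * / tau ^ 2 * D1 x ^ 2 + 2 * tau ^ 2 * D x ^ 2) by (field; lra).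
      assert (Q1 := pow2_ge_0 (D1 x)). assert (Q2 := pow2_ge_0 (D x + D1 x)). assert (Q3 := pow2_ge_0 (D x)).
      assert (Q4 := Rinv_0_lt_compat _ Ht2).
      assert (0 <= / tau ^ 2 * D1 x ^ 2) by (apply Rmult_le_pos; lra).
      assert (0 <= tau ^ 2 * D x ^ 2) by (apply Rmult_le_pos; lra). lra. }
    assert (0 <= exp x * (8 * D1 x ^ 2 + 4 * D x * D1 x + c * E x) * exp (- (c * exp x))).
    { apply Rmult_le_pos; [apply Rmult_le_pos; [left; apply exp_pos | exact P] | left; apply exp_pos]. }
    nra. }
set (KK := (12 + tau ^ 2) * K).
set (Q := KK ^ 2 + tau ^ 2 * K ^ 2).
assert (HQ : 0 <= Q).
{ unfold Q. assert (H1 := pow2_ge_0 KK). assert (H2 := pow2_ge_0 K).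
  assert (0 <= tau ^ 2 * K ^ 2) by (apply Rmult_le_pos; lra). lra. }
assert (HGt : forall t, t <= 0 -> G t <= Q * exp t).
{ intros t Ht0. unfold G.
  assert (He : 0 < exp t <= 1) by (split; [apply exp_pos | rewrite <- exp_0; now apply exp_le_mono]).
  assert (B1 := HS t Ht0). assert (B2 := HB t).
  assert (S1 : D1 t ^ 2 <= (KK * exp t) ^ 2).
  { rewrite <- (pow2_abs (D1 t)). apply pow_incr. split; [apply Rabs_pos | exact B1]. }
  assert (S2 : D t ^ 2 <= (K * exp t) ^ 2).
  { rewrite <- (pow2_abs (D t)). apply pow_incr. split; [apply Rabs_pos | exact B2]. }
  assert (HE0 : 0 <= E t <= Q * exp t).
  { unfold E. split.
    - assert (H1 := pow2_ge_0 (D1 t)). assert (H2 := pow2_ge_0 (D t)).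
      assert (0 <= tau ^ 2 * D t ^ 2) by (apply Rmult_le_pos; lra). lra.
    - apply Rle_trans with (Q * (exp t * exp t)).
      + unfold Q. replace ((KK ^ 2 + tau ^ 2 * K ^ 2) * (exp t * exp t)) with ((KK * exp t) ^ 2 + tau ^ 2 * (K * exp t) ^ 2) by ring.
        apply Rplus_le_compat; [exact S1 | apply Rmult_le_compat_l; lra].
      + apply Rmult_le_compat_l; nra. }
  assert (Hx : exp (- (c * exp t)) <= 1).
  { rewrite <- exp_0. apply exp_le_mono. assert (0 < c * exp t) by (apply Rmult_lt_0_compat; lra). lra. }
  nra. }
assert (HGl : G l <= 0).
{ apply le_epsilon. intros eps He. rewrite Rplus_0_l.
  destruct (exp_neg_small 1 Q eps Rlt_0_1 HQ He) as [M [HM HM']].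
  set (t := Rmin l (- M)). assert (Ht1 := Rmin_l l (- M)). assert (Ht2' := Rmin_r l (- M)). fold t in Ht1, Ht2'.
  eapply Rle_trans; [apply (Hdecr t Ht1) |]. eapply Rle_trans; [apply HGt; lra |].
  left. replace t with (- (1 * (- t))) by ring. apply HM'. lra. }
assert (HEl : E l <= 0).
{ unfold G in HGl. assert (H := exp_pos (- (c * exp l))). nra. }
unfold E in HEl. assert (H1 := pow2_ge_0 (D1 l)). assert (H2 := pow2_ge_0 (D l)).
assert (H3 : 0 <= tau ^ 2 * D l ^ 2) by (apply Rmult_le_pos; lra).
assert (H4 : tau ^ 2 * D l ^ 2 = 0) by lra.
apply Rmult_integral in H4. destruct H4 as [H4|H4]; [lra |].
simpl in H4. rewrite Rmult_1_r in H4. now apply Rsqr_0_uniq.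
Qed.

(** [u0 v0] is half the imaginary part of [e^(i tau s) / Gamma (1 + i tau)^2]; integration against
    the weight multiplies by [Gamma (1 + i tau)] and leaves half the imaginary part of
    [e^(i tau l) / Gamma (1 + i tau)]. The error [K e^s] integrates to [K e^l] because
    [Gamma 2 = 1]. *)
Lemma W_asymp tau : 0 < tau -> exists K, 0 <= K /\ forall l,
  Rabs (W tau l - asq tau / 2 * (gam_re tau 1 * sin (tau * l) - gam_im tau 1 * cos (tau * l))) <= K * exp l.
Proof.
intros Ht. destruct (Y_asymp tau Ht) as [K [HK HKY]].
assert (GB := Good_gam_w 2 ltac:(lra)).
assert (I2 : IR (gam_w 2) = 1).
{ assert (H := IR_gam_w_nat 1). replace (1 + 1) with 2 in H by ring. exact H. }
exists K. split; [exact HK |]. intros l.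
assert (G1 := Good_gam_cos0 1 tau ltac:(lra)). assert (G2 := Good_gam_sin0 1 tau ltac:(lra)).
set (g := gam_re tau 1). set (h := gam_im tau 1). set (q := asq tau).
assert (Hq : q * (g ^ 2 + h ^ 2) = 1).
{ unfold q, g, h. rewrite gam_mod_sq by exact Ht. unfold asq. assert (HP := PI_RGT_0).
  assert (0 < sinh (PI * tau)) by (apply sinh_pos; nra). field. lra. }
set (S := fun r => gam_w 1 r * (u0 tau (r + l) * v0 tau (r + l))).
set (a := / 2 * (A1 tau ^ 2 - A2 tau ^ 2)). set (b := A1 tau * A2 tau).
assert (ES : forall r, S r = (a * sin (tau * l) + b * cos (tau * l)) * (gam_w 1 r * cos (tau * r))
   + (a * cos (tau * l) - b * sin (tau * l)) * (gam_w 1 r * sin (tau * r))).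
{ intros r. unfold S, u0, v0, a, b.
  set (th := tau / 2 * (r + l)).
  assert (E2 : sin (tau * r) * cos (tau * l) + cos (tau * r) * sin (tau * l) = 2 * sin th * cos th).
  { rewrite <- sin_plus, <- sin_2a. f_equal. unfold th. field. }
  assert (E3 : cos (tau * r) * cos (tau * l) - sin (tau * r) * sin (tau * l) = cos th * cos th - sin th * sin th).
  { rewrite <- cos_plus, <- cos_2a. f_equal. unfold th. field. }
  transitivity (gam_w 1 r * (/ 2 * (A1 tau ^ 2 - A2 tau ^ 2) * (2 * sin th * cos th) + A1 tau * A2 tau * (cos th * cos th - sin th * sin th))).
  - field.
  - rewrite <- E2, <- E3. ring. }
assert (GS : Good S).
{ eapply Good_ext; [intros r; symmetry; apply ES |]. apply Good_plus; now apply Good_scal. }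
assert (IS : IR S = q / 2 * (g * sin (tau * l) - h * cos (tau * l))).
{ rewrite (IR_ext _ _ ES), IR_plus, !IR_scal by good.
  fold (gam_re tau 1). fold (gam_im tau 1). unfold a, b, A1, A2. fold q. fold g. fold h.
  transitivity (q / 2 * (g * sin (tau * l) - h * cos (tau * l)) * (q * (g ^ 2 + h ^ 2))); [field | rewrite Hq; ring]. }
rewrite <- IS. unfold W.
assert (GY := Good_gam_w_conv 1 _ _ l ltac:(lra) (cont_Y tau) (subexp_Y tau Ht)).
rewrite <- IR_minus by assumption.
replace (K * exp l) with (IR (fun r => K * exp l * gam_w 2 r)) by (rewrite IR_scal, I2; [ring | exact GB]).
apply IR_abs_le; [now apply Good_minus | now apply Good_scal |].
intros r. unfold S. rewrite <- Rmult_minus_distr_l, Rabs_mult, (Rabs_pos_eq (gam_w 1 r)) by (left; apply exp_pos).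
replace (K * exp l * gam_w 2 r) with (gam_w 1 r * (K * exp (r + l))).
- apply Rmult_le_compat_l; [left; apply exp_pos | apply HKY].
- assert (E : gam_w 2 r = exp r * gam_w 1 r) by (rewrite <- gam_w_succ; now replace (1 + 1) with 2 by ring).
  rewrite E, exp_plus. ring.
Qed.

(* The Gaussian transform of Im J^2 is a Macdonald function: both sides solve the same
   second-order equation and have the same leading behaviour at -oo. *)
Lemma W_eq_Vk tau l : 0 < tau -> W tau l = - (asq tau * tau / 4) * Vk tau l.
Proof.
intros Ht. destruct (W_asymp tau Ht) as [K1 [HK1 H1]]. destruct (Vk_asymp tau Ht) as [K2 [HK2 H2]].
assert (Hq := asq_pos tau Ht).
(* Quotient of the leading coefficients [asq / 2] and [2 / tau]; the leading terms have opposite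
   signs and cancel in [W + c Vk]. *)
set (c := asq tau * tau / 4). assert (Hc : 0 < c) by (unfold c; nra).
assert (Z : (fun l => W tau l + c * Vk tau l) l = 0).
{ apply (ode_unique tau (fun l => W tau l + c * Vk tau l) (fun l => W1 tau l + c * Vk1 tau l) (K1 + c * K2) Ht).
  - nra.
  - intros x. apply @is_derive_plus; [now apply is_derive_W | apply is_derive_scal, is_derive_Vk].
  - intros x. evar_last.
    + apply @is_derive_plus; [now apply is_derive_W1 | apply is_derive_scal, is_derive_Vk1].
    + unfold plus; simpl. ring.
  - intros x. specialize (H1 x). specialize (H2 x).
    set (w := gam_re tau 1 * sin (tau * x) - gam_im tau 1 * cos (tau * x)) in *.
    replace (gam_im tau 1 * cos (tau * x) - gam_re tau 1 * sin (tau * x)) with (- w) in H2 by (unfold w; ring).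
    replace (W tau x + c * Vk tau x) with ((W tau x - asq tau / 2 * w) + c * (Vk tau x - 2 / tau * - w))
      by (unfold c; field; lra).
    eapply Rle_trans; [apply Rabs_triang |]. rewrite (Rabs_mult c), (Rabs_pos_eq c) by lra.
    assert (c * Rabs (Vk tau x - 2 / tau * - w) <= c * (K2 * exp x)) by (apply Rmult_le_compat_l; lra). lra. }
lra.
Qed.

(** * The Laplace transform of Im J^2 *)

(** Gamma weight of rate [c]: changing the rate is a shift of the logarithmic variable. *)
Definition gam_wc a c l := exp (a * l - c * exp l).

Lemma gam_wc_shift a c l : 0 < c -> gam_wc a c l = exp (- (a * ln c)) * gam_w a (l + ln c).
Proof.
intros Hc. unfold gam_wc, gam_w. rewrite <- exp_plus, (exp_plus l), exp_ln by exact Hc. f_equal. ring.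
Qed.

Lemma IR_gam_wc a c : 0 < a -> 0 < c -> IR (gam_wc a c) = exp (- (a * ln c)) * IR (gam_w a).
Proof.
intros Ha Hc. rewrite (IR_ext _ _ (fun l => gam_wc_shift a c l Hc)).
rewrite IR_scal, IR_shift; [reflexivity | |]; try apply Good_shift; now apply Good_gam_w.
Qed.

Lemma exp_abs_shift x c : exp (- (1 * Rabs (x + c))) <= exp (Rabs c) * exp (- (1 * Rabs x)).
Proof.
rewrite <- exp_plus. apply exp_le_mono.
assert (Rabs x <= Rabs (x + c) + Rabs c).
{ replace x with ((x + c) + (- c)) at 1 by ring. rewrite <- (Rabs_Ropp c). apply Rabs_triang. }
lra.
Qed.

Lemma gam_wc_dom a c : 1 <= a -> 0 < c -> exists K, 0 < K /\ forall l, gam_wc a c l <= K * exp (- (1 * Rabs l)).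
Proof.
intros Ha Hc. destruct (gam_w_dom a Ha) as [K [HK H]].
exists (exp (- (a * ln c)) * K * exp (Rabs (ln c))). split.
- apply Rmult_lt_0_compat; [apply Rmult_lt_0_compat; [apply exp_pos | exact HK] | apply exp_pos].
- intros l. rewrite gam_wc_shift by exact Hc. rewrite !Rmult_assoc.
  apply Rmult_le_compat_l; [left; apply exp_pos |]. eapply Rle_trans; [apply H |].
  apply Rmult_le_compat_l; [lra | apply exp_abs_shift].
Qed.

(* [int_0^oo x^{-1/2} e^{-x - y^2/x} dx] with [x = e^l] *)
Definition lev y := IR (fun l => exp (/ 2 * l - exp l - y ^ 2 * exp (- l))).

Lemma lev_dom : exists d C, 0 < d /\ forall l y, Rabs (exp (/ 2 * l - exp l - y ^ 2 * exp (- l))) <= C * exp (- (d * Rabs l)).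
Proof.
destruct (Good_gam_w (/ 2) ltac:(lra)) as [_ [d [C [Hd HC]]]]. exists d, C. split; [exact Hd |].
intros l y. eapply Rle_trans; [| apply HC]. rewrite !Rabs_pos_eq by (left; apply exp_pos).
apply exp_le_mono. assert (H := pow2_ge_0 y). assert (H1 := exp_pos (- l)).
assert (0 <= y ^ 2 * exp (- l)) by (apply Rmult_le_pos; lra). lra.
Qed.

Lemma cont2_lev : cont2 (fun l y => exp (/ 2 * l - exp l - y ^ 2 * exp (- l))).
Proof.
intros l y. apply continuity_2d_pt_ext with (fun l y => exp (/ 2 * l - exp l - y * y * exp (- l))).
- intros; f_equal; ring.
- cont_2d.
Qed.

Lemma cont_lev : cont lev.
Proof.
destruct lev_dom as [d [C [Hd H]]]. apply (IR_param_cont d C); [exact Hd | apply cont2_lev | exact H].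
Qed.

(** The substitution [x -> y^2 / x] swaps the two exponentials and turns [x^(-1/2) dx] into
    [y x^(-3/2) dx]. *)
Lemma lev_reflect y : 0 < y ->
  IR (fun l => exp (- (/ 2 * l) - exp l - y ^ 2 * exp (- l))) = / y * lev y.
Proof.
intros Hy. unfold lev.
assert (HG : Good (fun l => exp (/ 2 * l - exp l - y ^ 2 * exp (- l)))).
{ destruct lev_dom as [d [C [Hd H]]]. split; [apply (cont2_slice_l _ y cont2_lev) |].
  exists d, C. split; [exact Hd |]. intros l. apply H. }
set (f := fun l => exp (/ 2 * l - exp l - y ^ 2 * exp (- l))) in *.
rewrite <- (IR_reflect f) by apply HG.
rewrite <- (IR_shift (fun x => f (- x)) (- (2 * ln y))) by now apply Good_reflect.
rewrite <- IR_scal by (apply (Good_shift (fun x => f (- x))); now apply Good_reflect).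
apply IR_ext. intros l. unfold f.
assert (Ey : exp (2 * ln y) = y ^ 2).
{ replace (2 * ln y) with (ln y + ln y) by ring. rewrite exp_plus, exp_ln by exact Hy. ring. }
replace (/ 2 * - (l + - (2 * ln y))) with (- (/ 2 * l) + ln y) by field.
replace (- (l + - (2 * ln y))) with (2 * ln y + - l) by ring.
replace (- (2 * ln y + - l)) with (- (2 * ln y) + l) by ring.
rewrite (exp_plus (2 * ln y)), (exp_plus (- (2 * ln y))), (exp_Ropp (2 * ln y)), Ey.
replace (- (/ 2 * l) + ln y - y ^ 2 * exp (- l) - y ^ 2 * (/ y ^ 2 * exp l))
  with (ln y + (- (/ 2 * l) - exp l - y ^ 2 * exp (- l))) by (field; lra).
rewrite exp_plus, exp_ln by exact Hy. field. lra.
Qed.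

(** Differentiation produces the integral with [x^(-3/2)], which [lev_reflect] returns to [lev];
    this closes into a first-order equation. *)
Lemma is_derive_lev y : 0 < y -> is_derive lev y (- 2 * lev y).
Proof.
intros Hy.
destruct (pow_exp_neg_bound 1) as [K [HK HK']].
set (a := y / 2). assert (Ha : 0 < a) by (unfold a; lra). assert (Ha2 : 0 < a ^ 2) by (apply pow_lt; lra).
replace (- 2 * lev y) with (IR (fun l => - (2 * y) * exp (- (/ 2 * l) - exp l - y ^ 2 * exp (- l)))).
(* The two entries of the maximum serve the two signs of [l]: for [l < 0] the growing factor
   [e^(-l/2)] is beaten by [exp (- a^2 e^(-l)) <= K e^l / a^2], where [a = y/2] bounds the parameter
   from below. *)
- set (C := 4 * y * Rmax 1 (K / a ^ 2)).
  assert (HB : forall l q, a <= q <= 2 * y ->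
    Rabs (- (2 * q) * exp (- (/ 2 * l) - exp l - q ^ 2 * exp (- l))) <= C * exp (- (/ 2 * Rabs l))).
  { intros l q Hq.
    replace (- (2 * q) * exp (- (/ 2 * l) - exp l - q ^ 2 * exp (- l)))
      with (- ((2 * q) * exp (- (/ 2 * l) - exp l - q ^ 2 * exp (- l)))) by ring.
    rewrite Rabs_Ropp, Rabs_pos_eq by (apply Rmult_le_pos; [unfold a in *; lra | left; apply exp_pos]).
    unfold C. rewrite (Rmult_assoc (4 * y)).
    apply Rmult_le_compat; [lra | left; apply exp_pos | lra |].
    assert (Hq2 : a ^ 2 <= q ^ 2) by (apply pow_incr; lra).
    assert (H1 := exp_pos l). assert (H2 := exp_pos (- l)).
    unfold Rabs. destruct (Rcase_abs l) as [Hl|Hl].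
    - apply Rle_trans with (K / a ^ 2 * exp (- (/ 2 * - l))).
      + specialize (HK' (a ^ 2 * exp (- l)) ltac:(nra)). rewrite pow_1 in HK'.
        apply Rmult_le_reg_l with (a ^ 2); [exact Ha2 |].
        replace (a ^ 2 * (K / a ^ 2 * exp (- (/ 2 * - l)))) with (K * exp (/ 2 * l)).
        2:{ replace (- (/ 2 * - l)) with (/ 2 * l) by ring. field. lra. }
        apply Rle_trans with (a ^ 2 * exp (- l) * exp (- (a ^ 2 * exp (- l))) * exp (/ 2 * l)).
        * rewrite Rmult_assoc, Rmult_assoc, <- !exp_plus. apply Rmult_le_compat_l; [lra |]. apply exp_le_mono.
          assert (a ^ 2 * exp (- l) <= q ^ 2 * exp (- l)) by (apply Rmult_le_compat_r; lra). lra.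
        * apply Rmult_le_compat_r; [left; apply exp_pos | exact HK'].
      + apply Rmult_le_compat_r; [left; apply exp_pos | apply Rmax_r].
    - apply Rle_trans with (1 * exp (- (/ 2 * l))).
      + rewrite Rmult_1_l. apply exp_le_mono.
        assert (0 <= q ^ 2 * exp (- l)) by (apply Rmult_le_pos; lra). lra.
      + apply Rmult_le_compat_r; [left; apply exp_pos | apply Rmax_l]. }
  destruct lev_dom as [d [C' [Hd HC']]].
  apply (is_derive_IR (fun l y => exp (/ 2 * l - exp l - y ^ 2 * exp (- l)))
     (fun l y => - (2 * y) * exp (- (/ 2 * l) - exp l - y ^ 2 * exp (- l))) a (2 * y) (/ 2) C);
    try (unfold a; lra).
  + intros l q _. auto_derive; [exact I |].
    replace (exp (/ 2 * l - exp l + - (q * (q * 1) * exp (- l))))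
      with (exp (- (/ 2 * l) - exp l - q ^ 2 * exp (- l)) * exp l) by (rewrite <- exp_plus; f_equal; field).
    rewrite (exp_Ropp l). assert (H := exp_pos l). field. lra.
  + intros l q _. apply continuity_2d_pt_ext with (fun l y => - (2 * y) * exp (- (/ 2 * l) - exp l - y * y * exp (- l))).
    * intros u v. f_equal. f_equal. ring.
    * cont_2d.
  + exact HB.
  + intros q _. split; [apply (cont2_slice_l _ q cont2_lev) |].
    exists d, C'. split; [exact Hd |]. intros l. apply HC'.
- rewrite IR_scal.
  + rewrite lev_reflect by exact Hy. field. lra.
  + set (f := fun l => exp (/ 2 * l - exp l - y ^ 2 * exp (- l))).
    assert (HG : Good f).
    { destruct lev_dom as [d [C [Hd H]]]. split; [apply (cont2_slice_l _ y cont2_lev) |].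
      exists d, C. split; [exact Hd |]. intros l. apply H. }
    apply Good_ext with (fun l => / y * (fun x => f (- x)) (l + - (2 * ln y))).
    2:{ apply Good_scal. apply (Good_shift (fun x => f (- x))). now apply Good_reflect. }
    intros l. unfold f.
    assert (Ey : exp (2 * ln y) = y ^ 2).
    { replace (2 * ln y) with (ln y + ln y) by ring. rewrite exp_plus, exp_ln by exact Hy. ring. }
    replace (/ 2 * - (l + - (2 * ln y))) with (- (/ 2 * l) + ln y) by field.
    replace (- (l + - (2 * ln y))) with (2 * ln y + - l) by ring.
    replace (- (2 * ln y + - l)) with (- (2 * ln y) + l) by ring.
    rewrite (exp_plus (2 * ln y)), (exp_plus (- (2 * ln y))), (exp_Ropp (2 * ln y)), Ey.
    replace (- (/ 2 * l) + ln y - y ^ 2 * exp (- l) - y ^ 2 * (/ y ^ 2 * exp l))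
      with (ln y + (- (/ 2 * l) - exp l - y ^ 2 * exp (- l))) by (field; lra).
    rewrite exp_plus, exp_ln by exact Hy. field. lra.
Qed.

(** The equation [lev' = - 2 lev] is available for [y > 0]; continuity at 0 supplies the initial
    value [Gamma (1/2)]. *)
Lemma lev_eq y : 0 <= y -> lev y = IR (gam_w (/ 2)) * exp (- (2 * y)).
Proof.
intros Hy.
assert (E0 : lev 0 = IR (gam_w (/ 2))).
{ apply IR_ext. intros l. unfold gam_w. f_equal. ring. }
destruct (Req_dec y 0) as [->|Hn].
- rewrite E0, Rmult_0_r, Ropp_0, exp_0. ring.
- destruct (MVT_gen (fun y => exp (2 * y) * lev y) 0 y (fun _ => 0)) as [c [_ E]].
  + intros x Hx. rewrite Rmin_left in Hx by lra. assert (D := is_derive_lev x ltac:(lra)).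
    auto_derive; [eexists; exact D |].
    replace (Derive (fun x : R => lev x) x) with (- 2 * lev x) by (symmetry; apply is_derive_unique, D).
    ring.
  + intros x _. apply continuity_pt_filterlim. apply (cont_mult (fun y => exp (2 * y)) lev).
    * apply cont_of_ex_derive. intros z. auto_derive. exact I.
    * apply cont_lev.
  + rewrite E0, Rmult_0_r, exp_0 in E.
    rewrite exp_Ropp. assert (H := exp_pos (2 * y)). apply Rmult_eq_reg_l with (exp (2 * y)); [| lra].
    replace (exp (2 * y) * (IR (gam_w (/ 2)) * / exp (2 * y))) with (IR (gam_w (/ 2))) by (field; lra). lra.
Qed.

(* The exponential as a mixture of Gaussians (subordination), with x^2/4 = e^s. *)
Lemma levy p s : 0 < p ->
  IR (fun l => exp (/ 2 * l - p ^ 2 * exp l - exp (s - l))) = IR (gam_w (/ 2)) / p * exp (- (2 * p * exp (s / 2))).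
Proof.
intros Hp.
assert (Hy : 0 <= p * exp (s / 2)) by (apply Rmult_le_pos; [lra | left; apply exp_pos]).
assert (E := lev_eq _ Hy).
replace (- (2 * p * exp (s / 2))) with (- (2 * (p * exp (s / 2)))) by ring.
transitivity (/ p * lev (p * exp (s / 2))); [| rewrite E; field; lra].
unfold lev.
set (f := fun l => exp (/ 2 * l - exp l - (p * exp (s / 2)) ^ 2 * exp (- l))).
assert (HG : Good f).
{ destruct lev_dom as [d [C [Hd H]]]. split; [apply (cont2_slice_l _ _ cont2_lev) |].
  exists d, C. split; [exact Hd |]. intros l. apply H. }
rewrite <- (IR_shift f (2 * ln p)), <- IR_scal by (try apply Good_shift; exact HG).
apply IR_ext. intros l. unfold f.
assert (Ep : exp (2 * ln p) = p ^ 2).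
{ replace (2 * ln p) with (ln p + ln p) by ring. rewrite exp_plus, exp_ln by exact Hp. ring. }
assert (Es : exp (s / 2) * exp (s / 2) = exp s) by (rewrite <- exp_plus; f_equal; field).
replace (- (l + 2 * ln p)) with (- l + - (2 * ln p)) by ring.
rewrite (exp_plus l), (exp_plus (- l)), (exp_Ropp (2 * ln p)), Ep.
replace (/ 2 * (l + 2 * ln p) - exp l * p ^ 2 - (p * exp (s / 2)) ^ 2 * (exp (- l) * / p ^ 2))
  with (ln p + (/ 2 * l - p ^ 2 * exp l - exp (s - l))).
- rewrite exp_plus, exp_ln by exact Hp. field. lra.
- assert (Esl : exp (s - l) = exp s * exp (- l)) by (unfold Rminus; apply exp_plus).
  rewrite Esl, <- Es. field. lra.
Qed.

(** From [e^(r/2) <= (1 + e^r) / 2] follows [1 = Gamma 1 <= (3/4) Gamma (1/2)]. Positivity allows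
    [Gamma (1/2)] to be divided out of the subordination identities. *)
Lemma IR_gam_w_half_pos : 0 < IR (gam_w (/ 2)).
Proof.
assert (G1 : Good (gam_w 1)) by (apply Good_gam_w; lra).
assert (Gh : Good (gam_w (/ 2))) by (apply Good_gam_w; lra).
assert (Gt : Good (gam_w (/ 2 + 1))) by (apply Good_gam_w; lra).
assert (H : IR (gam_w 1) <= IR (fun r => / 2 * gam_w (/ 2) r + / 2 * gam_w (/ 2 + 1) r)).
{ apply IR_le; [exact G1 | apply Good_plus; now apply Good_scal |].
  intros r. rewrite gam_w_succ.
  assert (E : gam_w 1 r = exp (r / 2) * gam_w (/ 2) r) by (unfold gam_w; rewrite <- exp_plus; f_equal; field).
  assert (Er : exp r = exp (r / 2) * exp (r / 2)) by (rewrite <- exp_plus; f_equal; field).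
  rewrite E, Er. assert (Hg : 0 < gam_w (/ 2) r) by apply exp_pos.
  assert (Q := pow2_ge_0 (exp (r / 2) - 1)). nra. }
rewrite IR_plus, !IR_scal, IR_gam_w_succ, IR_gam_w_1 in H by (good || lra). lra.
Qed.

(* Laplace transform of [x Y] at [p], up to a constant factor, with [x = 2 e^{s/2}]. *)
Definition Lam tau p := IR (fun s => exp (s - 2 * p * exp (s / 2)) * Y tau s).

Lemma exp_dom_mix l s : exp (- (1 * Rabs l)) * exp (- (1 * Rabs (s - l))) <= exp (- (/ 2 * Rabs s)) * exp (- (/ 2 * Rabs l)).
Proof.
rewrite <- !exp_plus. apply exp_le_mono.
assert (Rabs s <= Rabs (s - l) + Rabs l).
{ replace s with ((s - l) + l) at 1 by ring. apply Rabs_triang. }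
assert (H1 := Rabs_pos (s - l)). lra.
Qed.

(** [levy] replaces the exponential in [Lam] by a mixture of the Gaussian factors
    [exp (- e^(s - l))]; after the exchange the [s]-integral is [W tau l]. *)
Lemma Lam_W tau p : 0 < tau -> 0 < p ->
  IR (gam_w (/ 2)) / p * Lam tau p = IR (fun l => gam_wc (/ 2 + 1) (p ^ 2) l * W tau l).
Proof.
intros Ht Hp. assert (Hp2 : 0 < p ^ 2) by (apply pow_lt; lra).
(* The extra 1 in the order [1/2 + 1] absorbs the factor [e^(-l)] contained in [gam_w 1 (s - l)];
   what remains is [e^s Y] times the integrand of [levy]. *)
set (F := fun s l => gam_wc (/ 2 + 1) (p ^ 2) l * (gam_w 1 (s - l) * Y tau s)).
destruct (gam_wc_dom (/ 2 + 1) (p ^ 2) ltac:(lra) Hp2) as [K1 [HK1 H1]].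
destruct (gam_w_dom 1 ltac:(lra)) as [K2 [HK2 H2]].
assert (Hq := asq_pos tau Ht).
assert (HF : cont2 F).
{ intros s l. apply continuity_2d_pt_mult; [| apply continuity_2d_pt_mult].
  - unfold gam_wc. cont_2d.
  - unfold gam_w. cont_2d.
  - apply continuity_2d_pt_fst. apply continuity_pt_filterlim. apply cont_Y. }
assert (HFd : udom2 (/ 2) (K1 * K2 * asq tau) F).
{ intros s l. unfold F. rewrite !Rabs_mult, !Rabs_pos_eq by (left; apply exp_pos).
  assert (P1' : 0 < gam_wc (/ 2 + 1) (p ^ 2) l) by apply exp_pos.
  assert (P2' : 0 < gam_w 1 (s - l)) by apply exp_pos.
  apply Rle_trans with ((K1 * exp (- (1 * Rabs l))) * ((K2 * exp (- (1 * Rabs (s - l)))) * asq tau)).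
  - apply Rmult_le_compat; [lra | apply Rmult_le_pos; [lra | apply Rabs_pos] | apply H1 |].
    apply Rmult_le_compat; [lra | apply Rabs_pos | apply H2 | now apply Y_bound].
  - replace (K1 * exp (- (1 * Rabs l)) * (K2 * exp (- (1 * Rabs (s - l))) * asq tau))
      with (K1 * K2 * asq tau * (exp (- (1 * Rabs l)) * exp (- (1 * Rabs (s - l))))) by ring.
    apply Rmult_le_compat_l; [| apply exp_dom_mix].
    apply Rmult_le_pos; [apply Rmult_le_pos |]; lra. }
assert (HFub := Fubini_IR (/ 2) _ F ltac:(lra) HF HFd).
assert (E1 : forall s, IR (fun l => F s l) = IR (gam_w (/ 2)) / p * (exp (s - 2 * p * exp (s / 2)) * Y tau s)).
{ intros s. rewrite (IR_ext _ (fun l => exp s * Y tau s * exp (/ 2 * l - p ^ 2 * exp l - exp (s - l)))).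
  - rewrite IR_scal.
    + rewrite levy by exact Hp. unfold Rminus. rewrite (exp_plus s). field. lra.
    + assert (Gl : Good (fun l => exp (- s) * (gam_wc (/ 2 + 1) (p ^ 2) l * gam_w 1 (s - l)))).
      { apply Good_scal. apply Good_mult_bounded with K2.
        - split; [apply cont_of_ex_derive; intros x; unfold gam_wc; auto_derive; exact I |].
          exists 1, K1. split; [lra |]. intros l. rewrite Rabs_pos_eq by (left; apply exp_pos). apply H1.
        - apply cont_of_ex_derive. intros x. unfold gam_w. auto_derive. exact I.
        - intros l. rewrite Rabs_pos_eq by (left; apply exp_pos). eapply Rle_trans; [apply H2 |].
          assert (exp (- (1 * Rabs (s - l))) <= 1).
          { apply Rle_trans with (exp 0); [| rewrite exp_0; lra].
            apply exp_le_mono. assert (H := Rabs_pos (s - l)). lra. }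
          nra. }
      eapply Good_ext; [| exact Gl]. intros l. cbv beta. unfold gam_wc, gam_w.
      rewrite <- !exp_plus. f_equal. field.
  - intros l. unfold F, gam_wc, gam_w.
    transitivity (exp ((/ 2 + 1) * l - p ^ 2 * exp l) * exp (1 * (s - l) - exp (s - l)) * Y tau s); [ring |].
    rewrite <- exp_plus.
    transitivity (exp s * exp (/ 2 * l - p ^ 2 * exp l - exp (s - l)) * Y tau s); [| ring].
    rewrite <- exp_plus. f_equal. f_equal. field. }
rewrite (IR_ext (fun s => IR (fun l => F s l)) _ E1) in HFub.
unfold Lam. rewrite <- IR_scal.
- rewrite HFub. apply IR_ext. intros l. unfold F.
  assert (GY := Good_gam_w_conv 1 _ _ l ltac:(lra) (cont_Y tau) (subexp_Y tau Ht)).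
  assert (GY' : Good (fun s => gam_w 1 (s - l) * Y tau s)).
  { eapply Good_ext; [| apply (Good_shift _ (- l) GY)]. intros s. cbv beta.
    replace (s + - l + l) with s by ring. reflexivity. }
  rewrite IR_scal by exact GY'. f_equal.
  rewrite <- (IR_shift (fun s => gam_w 1 (s - l) * Y tau s) l) by exact GY'.
  apply IR_ext. intros r. f_equal. f_equal. ring.
- assert (GI := IR_inner_Good (/ 2) _ F ltac:(lra) HF HFd).
  assert (GI' := Good_scal (p / IR (gam_w (/ 2))) _ (Good_ext _ _ E1 GI)).
  eapply Good_ext; [| exact GI']. intros s. cbv beta. assert (HG := IR_gam_w_half_pos). field. lra.
Qed.

(* [x^(-3/2)] *)
Definition pw32 x := exp (- ((/ 2 + 1) * ln x)).

(** With [W] in Macdonald form, integrate over [l] first: this gives [Gamma (3/2)] times the power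
    [-3/2] of the total rate [p^2 + 2 (1 + cosh t)], and [Gamma (3/2) = Gamma (1/2) / 2] cancels the
    constant from subordination. *)
Lemma Lam_eq tau p : 0 < tau -> 0 < p ->
  Lam tau p = - (asq tau * tau / 8) * p * IR (fun t => cos (tau * t) * pw32 (p ^ 2 + 2 * (1 + cosh t))).
Proof.
intros Ht Hp. assert (Hp2 : 0 < p ^ 2) by (apply pow_lt; lra).
assert (HG := IR_gam_w_half_pos).
assert (E := Lam_W tau p Ht Hp).
set (F := fun l t => cos (tau * t) * gam_wc (/ 2 + 1) (p ^ 2 + 2 * (1 + cosh t)) l).
destruct (gam_w_dom 1 ltac:(lra)) as [K1 [HK1 H1]].
destruct (exp_minus_exp_bound (/ 2) ltac:(lra)) as [K2 [HK2 H2]].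
assert (HF : cont2 F).
{ unfold F, gam_wc. cont_2d. }
assert (HFd : udom2 (/ 2) (K1 * K2) F).
{ intros l t. unfold F. rewrite Rabs_mult, (Rabs_pos_eq (gam_wc _ _ _)) by (left; apply exp_pos).
  apply Rle_trans with (1 * gam_wc (/ 2 + 1) (p ^ 2 + 2 * (1 + cosh t)) l).
  { apply Rmult_le_compat_r; [left; apply exp_pos | apply Rabs_cos_le_1]. }
  rewrite Rmult_1_l.
  apply Rle_trans with (gam_w 1 l * (exp (/ 2 * (l + Rabs t) - exp (l + Rabs t)) * exp (- (/ 2 * Rabs t)))).
  - unfold gam_wc, gam_w. rewrite <- !exp_plus. apply exp_le_mono.
    rewrite (exp_plus l). assert (Hc := exp_Rabs_le_cosh t). assert (Hl := exp_pos l).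
    assert (exp l * exp (Rabs t) <= exp l * (2 * cosh t)) by (apply Rmult_le_compat_l; lra).
    assert (0 < exp l * p ^ 2) by (apply Rmult_lt_0_compat; lra). lra.
  - apply Rle_trans with ((K1 * exp (- (1 * Rabs l))) * (K2 * exp (- (/ 2 * Rabs t)))).
    + apply Rmult_le_compat; [left; apply exp_pos | apply Rmult_le_pos; left; apply exp_pos | apply H1 |].
      apply Rmult_le_compat_r; [left; apply exp_pos | apply H2].
    + replace (K1 * exp (- (1 * Rabs l)) * (K2 * exp (- (/ 2 * Rabs t)))) with (K1 * K2 * (exp (- (1 * Rabs l)) * exp (- (/ 2 * Rabs t)))) by ring.
      apply Rmult_le_compat_l; [nra |]. apply Rmult_le_compat_r; [left; apply exp_pos |].
      apply exp_le_mono. assert (H := Rabs_pos l). lra. }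
assert (HFub := Fubini_IR (/ 2) _ F ltac:(lra) HF HFd).
assert (GI := IR_inner_Good (/ 2) _ F ltac:(lra) HF HFd).
assert (E1 : IR (fun l => gam_wc (/ 2 + 1) (p ^ 2) l * W tau l) = - (asq tau * tau / 4) * IR (fun l => IR (fun t => F l t))).
{ rewrite <- IR_scal by exact GI. apply IR_ext. intros l. rewrite W_eq_Vk by exact Ht.
  rewrite <- Rmult_assoc, (Rmult_comm (gam_wc _ _ _)), Rmult_assoc. f_equal.
  unfold Vk. rewrite <- IR_scal by (apply Good_mult_cos, Good_VE).
  apply IR_ext. intros t. unfold F. rewrite <- Rmult_assoc, (Rmult_comm (gam_wc _ _ _)), Rmult_assoc. f_equal.
  unfold gam_wc, VE, VX. rewrite <- exp_plus. f_equal. ring. }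
assert (E2 : IR (fun t => IR (fun l => F l t)) = / 2 * IR (gam_w (/ 2)) * IR (fun t => cos (tau * t) * pw32 (p ^ 2 + 2 * (1 + cosh t)))).
{ assert (Ei : forall t, IR (fun l => F l t) = / 2 * IR (gam_w (/ 2)) * (cos (tau * t) * pw32 (p ^ 2 + 2 * (1 + cosh t)))).
  { intros t. unfold F. assert (HC := cosh_ge_1 t).
    assert (Gc : Good (gam_wc (/ 2 + 1) (p ^ 2 + 2 * (1 + cosh t)))).
    { eapply Good_ext; [intros l; symmetry; apply gam_wc_shift; lra |].
      apply Good_scal, Good_shift, Good_gam_w. lra. }
    rewrite IR_scal by exact Gc. rewrite IR_gam_wc, IR_gam_w_succ by lra. unfold pw32. ring. }
  rewrite (IR_ext _ _ Ei). apply IR_scal.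
  assert (GI2 := IR_inner_Good (/ 2) _ _ ltac:(lra) (cont2_swap _ HF) (udom2_swap _ _ _ HFd)).
  assert (GI' := Good_scal (2 / IR (gam_w (/ 2))) _ (Good_ext _ _ Ei GI2)).
  eapply Good_ext; [| exact GI']. intros t. cbv beta. field. lra. }
rewrite E1, HFub, E2 in E.
apply Rmult_eq_reg_l with (IR (gam_w (/ 2)) / p); [| apply Rgt_not_eq, Rdiv_lt_0_compat; lra].
rewrite E. field. lra.
Qed.

(** * The Struve kernel *)

(* [Sw] is [1 - 1/cosh t] when [sinh t = e^l]; with this substitution [khat (ln y)] becomes
   [y int_0^oo (cosh t - 1) e^{-y sinh t} dt], which is [1 - (PI/2) y K_0(y)]. *)
Definition Sw l := 1 - / sqrt (1 + exp (2 * l)).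

Lemma Sw_bounds l : 0 <= Sw l <= 1 /\ Sw l <= exp (2 * l).
Proof.
assert (He := exp_pos (2 * l)). unfold Sw.
assert (H1 : 1 <= sqrt (1 + exp (2 * l))).
{ rewrite <- sqrt_1 at 1. apply sqrt_le_1; lra. }
assert (H2 : sqrt (1 + exp (2 * l)) <= 1 + exp (2 * l)).
{ assert (E := sqrt_sqrt (1 + exp (2 * l)) ltac:(lra)). nra. }
assert (H3 : / sqrt (1 + exp (2 * l)) <= 1).
{ apply Rle_trans with (/ 1); [apply Rinv_le_contravar; lra | rewrite Rinv_1; lra]. }
assert (H4 : 0 < / sqrt (1 + exp (2 * l))) by (apply Rinv_0_lt_compat; lra).
assert (H5 : / (1 + exp (2 * l)) <= / sqrt (1 + exp (2 * l))) by (apply Rinv_le_contravar; lra).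
assert (H6 : 1 - exp (2 * l) <= / (1 + exp (2 * l))).
{ apply Rmult_le_reg_r with (1 + exp (2 * l)); [lra |]. rewrite Rinv_l by lra.
  assert (H := Rmult_lt_0_compat _ _ He He). lra. }
repeat split; lra.
Qed.

Lemma Sw_le th l : 0 <= th <= 2 -> Sw l <= exp (th * l).
Proof.
intros Hth. destruct (Sw_bounds l) as [[H0 H1] H2].
destruct (Rle_dec 0 l).
- apply Rle_trans with 1; [exact H1 |]. rewrite <- exp_0. apply exp_le_mono. nra.
- eapply Rle_trans; [exact H2 |]. apply exp_le_mono. nra.
Qed.

Lemma cont_Sw : cont Sw.
Proof.
apply cont_of_ex_derive. intros l. assert (He := exp_pos (2 * l)). unfold Sw. auto_derive.
repeat split; [lra | apply Rgt_not_eq, sqrt_lt_R0; lra].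
Qed.

Definition khat h := IR (fun l => gam_w 1 (h + l) * Sw l).

(** The weight at [h + l] is below a multiple of [e^(-th (h + l))] for [th = 1/2] and for
    [th = 3/2], and [Sw l] is below both 1 and [e^(2 l)]. The signs of [h] and [l] decide which pair
    makes the product decay in both variables. *)
Lemma khat_dom : exists K, 0 < K /\ forall h l,
  exp h * (gam_w 1 (h + l) * Sw l) <= K * (exp (- (/ 2 * Rabs h)) * exp (- (/ 2 * Rabs l))).
Proof.
destruct (phi_bound (3 / 2) ltac:(lra)) as [K1 [HK1 H1]].
destruct (phi_bound (/ 2) ltac:(lra)) as [K2 [HK2 H2]].
exists (K1 + K2). split; [lra |]. intros h l. rewrite <- phi_gam_w.
assert (HS := Sw_bounds l). assert (Hp : 0 < phi (h + l)) by apply exp_pos.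
assert (A : forall K th e, 0 < K <= K1 + K2 -> phi (h + l) <= K * exp (- (th * (h + l))) -> Sw l <= exp (e * l) ->
   h - th * (h + l) + e * l <= - (/ 2 * Rabs h) + - (/ 2 * Rabs l) ->
   exp h * (phi (h + l) * Sw l) <= (K1 + K2) * (exp (- (/ 2 * Rabs h)) * exp (- (/ 2 * Rabs l)))).
{ intros K th e HK Hphi HSe Hexp.
  apply Rle_trans with (exp h * (K * exp (- (th * (h + l))) * exp (e * l))).
  - apply Rmult_le_compat_l; [left; apply exp_pos |]. apply Rmult_le_compat; lra.
  - replace (exp h * (K * exp (- (th * (h + l))) * exp (e * l))) with (K * (exp h * exp (- (th * (h + l))) * exp (e * l))) by ring.
    rewrite <- !exp_plus. apply Rmult_le_compat; [lra | left; apply exp_pos | lra |].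
    apply exp_le_mono. lra. }
assert (S0 : Sw l <= exp (0 * l)) by (apply Sw_le; lra).
assert (S2 : Sw l <= exp (2 * l)) by (apply Sw_le; lra).
unfold Rabs in *. destruct (Rcase_abs h); destruct (Rcase_abs l).
- apply (A K2 (/ 2) 2); [lra | apply H2 | exact S2 | lra].
- apply (A K2 (/ 2) 0); [lra | apply H2 | exact S0 | lra].
- apply (A K1 (3 / 2) 2); [lra | apply H1 | exact S2 | lra].
- apply (A K1 (3 / 2) 0); [lra | apply H1 | exact S0 | lra].
Qed.

Lemma cont2_khat : cont2 (fun l h => exp h * (gam_w 1 (h + l) * Sw l)).
Proof.
intros l h. apply continuity_2d_pt_mult; [cont_2d |].
apply continuity_2d_pt_mult; [unfold gam_w; cont_2d |].
apply continuity_2d_pt_fst, continuity_pt_filterlim, cont_Sw.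
Qed.

Lemma khat_integrand_nonneg h l : 0 <= exp h * (gam_w 1 (h + l) * Sw l).
Proof.
apply Rmult_le_pos; [left; apply exp_pos |]. apply Rmult_le_pos; [left; apply exp_pos |].
apply Sw_bounds.
Qed.

Lemma Good_khat_integrand h : Good (fun l => gam_w 1 (h + l) * Sw l).
Proof.
apply Good_ext with (fun l => exp (- h) * (exp h * (gam_w 1 (h + l) * Sw l))).
- intros l. rewrite <- Rmult_assoc, <- exp_plus. replace (- h + h) with 0 by ring. rewrite exp_0. ring.
- apply Good_scal. destruct khat_dom as [K [HK H]].
  split; [apply (cont2_slice_l _ h cont2_khat) |].
  exists (/ 2), (K * exp (- (/ 2 * Rabs h))). split; [lra |]. intros l.
  rewrite Rabs_pos_eq by apply khat_integrand_nonneg. rewrite Rmult_assoc. apply H.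
Qed.

Lemma Good_exp_khat : Good (fun h => exp h * khat h).
Proof.
destruct khat_dom as [K [HK H]].
apply Good_ext with (fun h => IR (fun l => exp h * (gam_w 1 (h + l) * Sw l))).
- intros h. apply IR_scal, Good_khat_integrand.
- apply (IR_inner_Good (/ 2) K); [lra | apply (cont2_swap _ cont2_khat) |].
  intros h l. rewrite Rabs_pos_eq by apply khat_integrand_nonneg. apply H.
Qed.

Lemma cont_khat : cont khat.
Proof.
intros h. apply continuous_ext with (fun h => exp (- h) * (exp h * khat h)).
- intros x. rewrite <- Rmult_assoc, <- exp_plus. replace (- x + x) with 0 by ring. rewrite exp_0. apply Rmult_1_l.
- apply (cont_mult (fun h => exp (- h))); [| apply Good_exp_khat].
  apply cont_of_ex_derive. intros x. auto_derive. exact I.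
Qed.

Lemma is_RInt_gen_of_lim (f : R -> R) (Fa Fb : (R -> Prop) -> Prop) {FFa : Filter Fa} {FFb : Filter Fb} (l : R) :
  (forall eps : posreal, filter_prod Fa Fb
     (fun ab => ex_RInt f (fst ab) (snd ab) /\ Rabs (RInt f (fst ab) (snd ab) - l) < eps)) ->
  is_RInt_gen f Fa Fb l.
Proof.
intros H P [eps HP]. unfold filtermapi. generalize (H eps). apply filter_imp.
intros [a b] [H1 H2]. exists (RInt f a b). split; [now apply @RInt_correct |].
apply HP. exact H2.
Qed.

Lemma Struve_subst y a b : 0 < y -> 0 < a -> a <= b ->
  RInt (fun s => y * (cosh s - 1) * exp (- (y * sinh s))) a b =
  RInt (fun l => gam_w 1 (ln y + l) * Sw l) (ln (sinh a)) (ln (sinh b)).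
Proof.
intros Hy Ha Hab.
rewrite <- (RInt_comp (fun l => gam_w 1 (ln y + l) * Sw l) (fun s => ln (sinh s)) (fun s => cosh s / sinh s)).
- apply RInt_ext. intros s. rewrite Rmin_left, Rmax_right by exact Hab. intros Hs.
  assert (Hsh : 0 < sinh s) by (apply sinh_pos; lra). assert (Hc := cosh_ge_1 s).
  unfold scal; simpl; unfold mult; simpl.
  assert (Eg : gam_w 1 (ln y + ln (sinh s)) = y * sinh s * exp (- (y * sinh s))).
  { unfold gam_w, Rminus. now rewrite Rmult_1_l, exp_plus, (exp_plus (ln y)), !exp_ln by assumption. }
  rewrite Eg. unfold Sw.
  replace (exp (2 * ln (sinh s))) with (sinh s * sinh s).
  2:{ replace (2 * ln (sinh s)) with (ln (sinh s) + ln (sinh s)) by ring. now rewrite exp_plus, exp_ln. }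
  rewrite sinh_sq. replace (1 + (cosh s * cosh s - 1)) with (cosh s * cosh s) by ring.
  rewrite sqrt_square by lra. field. lra.
- intros s. rewrite Rmin_left, Rmax_right by exact Hab. intros Hs. apply (Good_khat_integrand (ln y)).
- intros s. rewrite Rmin_left, Rmax_right by exact Hab. intros Hs.
  assert (Hsh : 0 < sinh s) by (apply sinh_pos; lra). split.
  + auto_derive; [exact Hsh |]. field. lra.
  + apply @ex_derive_continuous. auto_derive. lra.
Qed.

(** Write [1 = cosh t - (cosh t - 1)] in front of the exponential: the [cosh t] part has an explicit
    primitive and yields the limit [2/pi], the rest becomes [khat] under [sinh t = e^l]. *)
Lemma StruveK0_khat y : 0 < y -> y * StruveK0 y - 2 / PI = - (2 / PI) * khat (ln y).
Proof.
intros Hy. assert (HP := PI_RGT_0).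
set (f := fun t => exp (- (y * sinh t))).
set (j := fun s => y * (cosh s - 1) * exp (- (y * sinh s))).
assert (Cf : cont f) by (apply cont_of_ex_derive; intros x; unfold f; auto_derive; exact I).
assert (Cj : cont j) by (apply cont_of_ex_derive; intros x; unfold j; auto_derive; exact I).
set (g := fun l => gam_w 1 (ln y + l) * Sw l).
assert (Gg : Good g) by apply Good_khat_integrand.
assert (Efj : forall M, RInt f 0 M = / y * (1 - exp (- (y * sinh M)) - RInt j 0 M)).
{ intros M. apply is_RInt_unique.
  apply is_RInt_ext with (fun s => / y * (y * cosh s * exp (- (y * sinh s)) - j s)).
  { intros s _. unfold f, j. match goal with |- ?u = ?v => change (@eq R u v) end. field. lra. }
  apply (is_RInt_scal (fun s => y * cosh s * exp (- (y * sinh s)) - j s) 0 M (/ y)).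
  apply (is_RInt_minus (fun s => y * cosh s * exp (- (y * sinh s))) j).
  - replace (1 - exp (- (y * sinh M))) with (- exp (- (y * sinh M)) - - exp (- (y * sinh 0)))
      by (rewrite sinh_0, Rmult_0_r, Ropp_0, exp_0; ring).
    apply (is_RInt_FTC (fun s => - exp (- (y * sinh s)))).
    + intros s. auto_derive; [exact I |]. ring.
    + apply cont_of_ex_derive. intros s. auto_derive. exact I.
  - apply @RInt_correct. now apply cont_ex_RInt. }
destruct Gg as [Cg [d [C [Hd HC]]]].
assert (HC0 := dominated_nonneg _ _ _ HC).
assert (Hj : forall eps, 0 < eps -> exists M0, forall M, M0 < M -> Rabs (RInt j 0 M - IR g) <= eps /\ exp (- (y * sinh M)) <= eps).
{ intros eps He.
  destruct (exp_neg_small d (2 * C / d) (eps / 2) Hd) as [N [HN0 HN]];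
    [apply Rdiv_le_0_compat; lra | lra |].
  destruct (exp_neg_small y 1 eps Hy ltac:(lra) He) as [N2 [HN20 HN2]].
  set (T := Rmax (exp N) N2).
  exists (Rmax 1 (2 * T)). intros M HM.
  assert (HM1 : 1 < M) by (eapply Rle_lt_trans; [apply Rmax_l | exact HM]).
  assert (HM2 : 2 * T < M) by (eapply Rle_lt_trans; [apply Rmax_r | exact HM]).
  assert (HshM : T <= sinh M).
  { assert (H := Rabs_le_sinh M). rewrite !Rabs_pos_eq in H; [| left; apply sinh_pos; lra | lra].
    lra. }
  assert (HN2' : N2 <= sinh M) by (eapply Rle_trans; [apply Rmax_r | exact HshM]).
  assert (HeN : exp N <= sinh M) by (eapply Rle_trans; [apply Rmax_l | exact HshM]).
  split.
  - assert (CR : continuous (fun t => RInt j 0 t) 0).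
    { apply @ex_derive_continuous. eexists. now apply RInt_derive_upper. }
    apply continuity_pt_filterlim in CR. destruct (CR (eps / 2)) as [dl [Hdl CR']]; [lra |].
    assert (Hm : 0 < Rmin 1 (Rmin dl (exp (- N) / 2))).
    { repeat apply Rmin_glb_lt; try lra. assert (H := exp_pos (- N)). lra. }
    (* The substitution [l = ln (sinh s)] is singular at 0, so [[0, e]] is cut off: [e < 1] gives
       [sinh e <= 2 e], [e < dl] makes the piece small, and [e <= exp (- N) / 4] puts [ln (sinh e)]
       below [- N]. *)
    set (e := Rmin 1 (Rmin dl (exp (- N) / 2)) / 2).
    assert (He1 : 0 < e) by (unfold e; lra).
    assert (He2 : e < 1) by (unfold e; assert (H := Rmin_l 1 (Rmin dl (exp (- N) / 2))); lra).
    assert (He3 : e < dl).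
    { unfold e. assert (H := Rmin_r 1 (Rmin dl (exp (- N) / 2))). assert (H' := Rmin_l dl (exp (- N) / 2)). lra. }
    assert (He4 : e <= exp (- N) / 4).
    { unfold e. assert (H := Rmin_r 1 (Rmin dl (exp (- N) / 2))). assert (H' := Rmin_r dl (exp (- N) / 2)). lra. }
    assert (Hse : sinh e <= 2 * e).
    { destruct (MVT_gen sinh 0 e cosh) as [z [Hz E]].
      - intros x _. apply is_derive_sinh.
      - intros x _. apply continuity_pt_of_ex_derive. eexists. apply is_derive_sinh.
      - rewrite sinh_0, !Rminus_0_r in E. rewrite E. rewrite Rmin_left, Rmax_right in Hz by lra.
        assert (cosh z <= 2).
        { unfold cosh. assert (exp z <= exp 1) by (apply exp_le_mono; lra).
          assert (exp (- z) <= exp 0) by (apply exp_le_mono; lra). rewrite exp_0 in *.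
          assert (H3 := exp_le_3). lra. }
        nra. }
    assert (Hshe : 0 < sinh e) by (apply sinh_pos; exact He1).
    assert (K1 : Rabs (RInt j 0 e) < eps / 2).
    { specialize (CR' e). simpl in CR'. unfold Rdist in CR'. rewrite (RInt_point 0 j) in CR'.
      rewrite !Rminus_0_r in CR'. apply CR'.
      split; [split; [exact I | lra] | rewrite Rabs_pos_eq; lra]. }
    assert (K2 : Rabs (RInt j e M - IR g) < eps / 2).
    { unfold j. rewrite Struve_subst by lra.
      eapply Rle_lt_trans; [apply (IR_tail d C g N); try assumption | apply HN; lra].
      - rewrite <- (ln_exp (- N)). apply ln_le; [exact Hshe |]. lra.
      - rewrite <- (ln_exp N) at 1. apply ln_le; [apply exp_pos | exact HeN]. }
    assert (E : RInt j 0 M = RInt j 0 e + RInt j e M).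
    { symmetry. apply (RInt_Chasles j); now apply cont_ex_RInt. }
    rewrite E. replace (RInt j 0 e + RInt j e M - IR g) with (RInt j 0 e + (RInt j e M - IR g)) by ring.
    eapply Rle_trans; [apply Rabs_triang |]. lra.
  - left. rewrite <- (Rmult_1_l (exp _)). now apply HN2. }
assert (Hgen : is_RInt_gen f (at_point 0) (Rbar_locally p_infty) (/ y * (1 - IR g))).
{ apply (is_RInt_gen_of_lim f (at_point 0) (Rbar_locally p_infty)). intros eps.
  destruct (Hj (y * eps / 4)) as [M0 HM0].
  { assert (He := cond_pos eps). nra. }
  exists (fun a => a = 0) (fun b => M0 < b); [reflexivity | now exists M0 |].
  intros a b -> Hb. simpl. split; [now apply cont_ex_RInt |].
  rewrite Efj. destruct (HM0 b Hb) as [B1 B2]. assert (B3 := exp_pos (- (y * sinh b))).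

  rewrite <- Rmult_minus_distr_l, Rabs_mult, Rabs_pos_eq by (left; now apply Rinv_0_lt_compat).
  apply Rmult_lt_reg_l with y; [exact Hy |]. rewrite <- Rmult_assoc, Rinv_r, Rmult_1_l by lra.
  apply Rabs_le_between in B1. apply Rle_lt_trans with (y * eps / 2); [apply Rabs_le; lra | nra]. }
unfold StruveK0. fold f.
apply (is_RInt_gen_unique (V := R_CompleteNormedModule)) in Hgen. rewrite Hgen. unfold khat. fold g. field. lra.
Qed.

Lemma pw32_sqrt x : 0 < x -> pw32 x = / (x * sqrt x).
Proof.
intros Hx. unfold pw32. rewrite exp_Ropp. f_equal.
rewrite Rmult_plus_distr_r, Rmult_1_l, exp_plus, exp_ln by exact Hx. rewrite Rmult_comm. f_equal.
rewrite <- (Rpower_sqrt x Hx). reflexivity.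
Qed.

Lemma Sw_pw32_integral a b2 : 0 < a -> 0 < b2 ->
  Good (fun l => Sw l * (a * exp l) ^ 2 * pw32 ((a * exp l) ^ 2 + b2)) ->
  IR (fun l => Sw l * (a * exp l) ^ 2 * pw32 ((a * exp l) ^ 2 + b2)) = / (a + sqrt b2).
Proof.
intros Ha Hb HG.
assert (Hsb : 0 < sqrt b2) by now apply sqrt_lt_R0.
(* Antiderivative in [v = e^l]. With [c = sqrt (1 + v^2)] and [y = sqrt ((a v)^2 + b2)], the second
   summand is [(a^2 c / y - a) / (a^2 - b2)], rationalized so that the case [a^2 = b2] is
   included. *)
set (Psi := fun v => - / sqrt ((a * v) ^ 2 + b2) +
   a / (sqrt ((a * v) ^ 2 + b2) * (a * sqrt (1 + v ^ 2) + sqrt ((a * v) ^ 2 + b2)))).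
assert (Pos : forall v, 0 < (a * v) ^ 2 + b2 /\ 0 < 1 + v ^ 2).
{ intros v. assert (H1 := pow2_ge_0 (a * v)). assert (H2 := pow2_ge_0 v). lra. }
assert (HD : forall v, ex_derive Psi v).
{ intros v. destruct (Pos v) as [P1' P2']. unfold Psi. auto_derive.
  assert (S1 := sqrt_lt_R0 _ P1'). assert (S2 := sqrt_lt_R0 _ P2').
  repeat split; try assumption; try lra; apply Rgt_not_eq; repeat first [assumption | apply Rmult_lt_0_compat | apply Rplus_lt_0_compat]. }
assert (L : is_lim (fun l => Psi (exp l)) m_infty (Psi 0)).
{ apply is_lim_comp_continuous; [apply is_lim_exp_m | now apply @ex_derive_continuous]. }
assert (E0 : Psi 0 = - / (a + sqrt b2)).
{ unfold Psi. replace ((a * 0) ^ 2 + b2) with b2 by ring. replace (1 + 0 ^ 2) with 1 by ring.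
  rewrite sqrt_1. field. lra. }
rewrite (IR_FTC (fun l => Psi (exp l)) _ (Psi 0) 0 HG).
- rewrite E0. ring.
- intros l. destruct (Pos (exp l)) as [P1' P2'].
  assert (S1 := sqrt_lt_R0 _ P1'). assert (S2 := sqrt_lt_R0 _ P2').
  assert (Q1' := sqrt_sqrt _ (Rlt_le _ _ P1')). assert (Q2' := sqrt_sqrt _ (Rlt_le _ _ P2')).
  rewrite pw32_sqrt by exact P1'. unfold Sw.
  replace (exp (2 * l)) with (exp l ^ 2).
  2:{ simpl. rewrite Rmult_1_r, <- exp_plus. f_equal. ring. }
  unfold Psi. auto_derive; simpl in *.
  + repeat split; try assumption; try lra; apply Rgt_not_eq; repeat first [assumption | apply Rmult_lt_0_compat | apply Rplus_lt_0_compat].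
  + set (y := sqrt (a * exp l * (a * exp l * 1) + b2)) in *.
    set (c := sqrt (1 + exp l * (exp l * 1))) in *. set (v := exp l) in *.
    rewrite <- Q1'.
    assert (Ev : v * v = c * c - 1) by lra.
    transitivity (a * a * (v * v) * (/ (y * y * y)) - a * ((a * a * (v * v) / y) * (a * c + y) + y * (a * (v * v) / c + a * a * (v * v) / y)) / (y * y * ((a * c + y) * (a * c + y)))).
    * field. repeat split; try lra; nra.
    * transitivity ((1 - / c) * (a * a * (v * v)) / (y * y * y)); [rewrite Ev | ]; field; repeat split; try lra; nra.
- exact L.
- apply is_lim_p_of_bound with 1 (2 / a); [lra | apply Rdiv_le_0_compat; lra |].
  intros l _. assert (He := exp_pos l). destruct (Pos (exp l)) as [P1' P2'].
  assert (S1 := sqrt_lt_R0 _ P1').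
  assert (S2 : 1 <= sqrt (1 + exp l ^ 2)).
  { rewrite <- sqrt_1 at 1. apply sqrt_le_1; try lra. assert (H := pow2_ge_0 (exp l)). lra. }
  assert (S3 : a * exp l <= sqrt ((a * exp l) ^ 2 + b2)).
  { rewrite <- (sqrt_pow2 (a * exp l)) at 1 by nra. apply sqrt_le_1; try lra. apply pow2_ge_0. }
  unfold Psi. set (y := sqrt ((a * exp l) ^ 2 + b2)) in *. set (c := sqrt (1 + exp l ^ 2)) in *.
  assert (Hac : 0 < a * c + y) by nra.
  replace (- / y + a / (y * (a * c + y)) - 0) with (- (/ y * ((a * c + y - a) / (a * c + y)))) by (field; nra).
  rewrite Rabs_Ropp, Rabs_mult, (Rabs_pos_eq (/ y)) by (left; now apply Rinv_0_lt_compat).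
  assert (B : Rabs ((a * c + y - a) / (a * c + y)) <= 1).
  { rewrite Rabs_pos_eq by (apply Rdiv_le_0_compat; nra).
    apply Rmult_le_reg_r with (a * c + y); [exact Hac |].
    unfold Rdiv. rewrite Rmult_assoc, Rinv_l by lra. lra. }
  rewrite Rmult_1_l, exp_Ropp.
  apply Rle_trans with (/ (a * exp l) * 1).
  + apply Rmult_le_compat; [left; now apply Rinv_0_lt_compat | apply Rabs_pos | | exact B].
    apply Rinv_le_contravar; [nra | exact S3].
  + rewrite Rinv_mult. assert (0 < / a) by (now apply Rinv_0_lt_compat).
    assert (0 < / exp l) by (now apply Rinv_0_lt_compat). nra.
Qed.

Lemma Good_Lam tau p : 0 < tau -> 0 < p -> Good (fun s => exp (s - 2 * p * exp (s / 2)) * Y tau s).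
Proof.
intros Ht Hp. destruct (gam_wc_dom 2 (2 * p) ltac:(lra) ltac:(lra)) as [K [HK H]].
apply Good_mult_bounded with (asq tau); [| apply cont_Y | intros; now apply Y_bound].
split; [apply cont_of_ex_derive; intros x; auto_derive; exact I |].
exists (/ 2), K. split; [lra |]. intros s. rewrite Rabs_pos_eq by (left; apply exp_pos).
specialize (H (s / 2)). unfold gam_wc in H. replace (2 * (s / 2)) with s in H by field.
eapply Rle_trans; [exact H |]. right. f_equal. f_equal.
unfold Rdiv. rewrite Rabs_mult, (Rabs_pos_eq (/ 2)) by lra. ring.
Qed.

(* The transform of [Y] against the Struve kernel at [a x], where [x = 2 e^{s/2}]. *)
Definition Qf tau a := IR (fun s => exp (s / 2) * khat (ln (2 * a) + s / 2) * Y tau s).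

Lemma Rabs_shift_half c s : / 2 * Rabs s <= Rabs (c + s / 2) + Rabs c.
Proof.
replace (/ 2 * Rabs s) with (Rabs (s / 2)).
- replace (s / 2) with ((c + s / 2) + - c) at 1 by ring. rewrite <- (Rabs_Ropp c). apply Rabs_triang.
- unfold Rdiv. rewrite Rabs_mult, (Rabs_pos_eq (/ 2)) by lra. ring.
Qed.

(** [khat] is a mixture of exponentials: [gam_w 1 (ln (2 a) + s/2 + l)] equals
    [2 p e^(s/2) exp (- 2 p e^(s/2))] with [p = a e^l], so the [s]-integral is the Laplace transform
    [Lam] at [p]. *)
Lemma Qf_Lam tau a : 0 < tau -> 0 < a ->
  Qf tau a = IR (fun l => Sw l * (2 * (a * exp l)) * Lam tau (a * exp l)).
Proof.
intros Ht Ha. assert (Hq := asq_pos tau Ht).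
set (c := ln (2 * a)).
set (F := fun s l => exp (s / 2) * (gam_w 1 (c + s / 2 + l) * Sw l) * Y tau s).
destruct khat_dom as [K [HK H]].
assert (He : forall s, exp (s / 2) = / (2 * a) * exp (c + s / 2)).
{ intros s. rewrite exp_plus. unfold c. rewrite exp_ln by lra. field. lra. }
assert (HF : cont2 F).
{ intros s l. apply continuity_2d_pt_mult; [apply continuity_2d_pt_mult |].
  - apply (continuity_2d_pt_fst (fun s => exp (s / 2))). cont_1d. exact I.
  - apply continuity_2d_pt_mult.
    +
      assert (C : continuity_2d_pt (fun u v => c + u / 2 + v) s l).
      { apply (continuity_2d_pt_plus (fun u v => c + u / 2) (fun u v => v)); [| apply continuity_2d_pt_id2].
        apply (continuity_2d_pt_fst (fun s => c + s / 2)). cont_1d. exact I. }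
      apply (continuity_1d_2d_pt_comp (fun x => exp (1 * x - exp x)) (fun u v => c + u / 2 + v)); [cont_1d; exact I | exact C].
    + apply continuity_2d_pt_snd, continuity_pt_filterlim, cont_Sw.
  - apply continuity_2d_pt_fst, continuity_pt_filterlim, cont_Y. }
assert (HFd : udom2 (/ 4) (/ (2 * a) * K * exp (/ 2 * Rabs c) * asq tau) F).
{ intros s l. unfold F. rewrite He, Rmult_assoc, (Rmult_assoc (/ (2 * a))), Rabs_mult, (Rabs_pos_eq (/ (2 * a)))
    by (left; apply Rinv_0_lt_compat; lra).
  rewrite <- Rmult_assoc, Rabs_mult.
  assert (HY := Y_bound tau s Ht).
  rewrite (Rabs_pos_eq (exp _ * _)) by apply khat_integrand_nonneg.
  assert (B := H (c + s / 2) l). assert (B0 := khat_integrand_nonneg (c + s / 2) l).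
  apply Rle_trans with (/ (2 * a) * (K * (exp (- (/ 2 * Rabs (c + s / 2))) * exp (- (/ 2 * Rabs l))) * asq tau)).
  - apply Rmult_le_compat_l; [left; apply Rinv_0_lt_compat; lra |].
    apply Rmult_le_compat; [exact B0 | apply Rabs_pos | exact B | exact HY].
  - replace (/ (2 * a) * K * exp (/ 2 * Rabs c) * asq tau * (exp (- (/ 4 * Rabs s)) * exp (- (/ 4 * Rabs l))))
      with (/ (2 * a) * (K * (exp (/ 2 * Rabs c) * exp (- (/ 4 * Rabs s)) * exp (- (/ 4 * Rabs l))) * asq tau)) by ring.
    apply Rmult_le_compat_l; [left; apply Rinv_0_lt_compat; lra |].
    apply Rmult_le_compat_r; [lra |]. apply Rmult_le_compat_l; [lra |].
    rewrite <- !exp_plus. apply exp_le_mono.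
    assert (T := Rabs_shift_half c s). assert (T' := Rabs_pos l). lra. }
assert (E1 : forall s, IR (fun l => F s l) = exp (s / 2) * khat (c + s / 2) * Y tau s).
{ intros s. unfold F. rewrite (IR_ext _ (fun l => (exp (s / 2) * Y tau s) * (gam_w 1 (c + s / 2 + l) * Sw l))) by (intros; ring).
  rewrite IR_scal by apply Good_khat_integrand. unfold khat. ring. }
assert (E2 : forall l, IR (fun s => F s l) = Sw l * (2 * (a * exp l)) * Lam tau (a * exp l)).
{ intros l. assert (Hl := exp_pos l).
  rewrite (IR_ext _ (fun s => (Sw l * (2 * (a * exp l))) * (exp (s - 2 * (a * exp l) * exp (s / 2)) * Y tau s))).
  - apply IR_scal, Good_Lam; [exact Ht | now apply Rmult_lt_0_compat].
  - intros s. unfold F, gam_w, Rminus. rewrite Rmult_1_l, (exp_plus (c + s / 2 + l)), (exp_plus (c + s / 2)), (exp_plus c).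
    unfold c. rewrite exp_ln by lra. rewrite (exp_plus s).
    replace (exp s) with (exp (s / 2) * exp (s / 2)) by (rewrite <- exp_plus; f_equal; field).
    replace (2 * (a * exp l) * exp (s / 2)) with (2 * a * exp (s / 2) * exp l) by ring. ring. }
unfold Qf. fold c. rewrite <- (IR_ext _ _ E1), <- (IR_ext _ _ E2).
now apply (Fubini_IR (/ 4) (/ (2 * a) * K * exp (/ 2 * Rabs c) * asq tau)); [lra | |].
Qed.

Lemma pw32_le x y1 y2 th1 th2 : 0 < x -> y1 <= ln x -> y2 <= ln x -> 0 <= th1 -> 0 <= th2 -> th1 + th2 = / 2 + 1 ->
  pw32 x <= exp (- (th1 * y1)) * exp (- (th2 * y2)).
Proof.
intros Hx H1 H2 Ht1 Ht2 Hs. rewrite <- exp_plus. unfold pw32. rewrite <- Hs. apply exp_le_mono. nra.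
Qed.

(** Insert [Lam_eq] at [p = a e^l], exchange, and evaluate the [l]-integral by [Sw_pw32_integral]
    with [b2 = 2 (1 + cosh t)]. *)
Lemma Qf_eq tau a : 0 < tau -> 0 < a ->
  Qf tau a = - (asq tau * tau / 4) * IR (fun t => cos (tau * t) * / (a + sqrt (2 * (1 + cosh t)))).
Proof.
intros Ht Ha.
set (X := fun l t => (a * exp l) ^ 2 + 2 * (1 + cosh t)).
assert (HX : forall l t, 0 < X l t).
{ intros l t. unfold X. assert (H := cosh_ge_1 t). assert (H1 := pow2_ge_0 (a * exp l)). lra. }
set (F := fun l t => cos (tau * t) * (Sw l * (a * exp l) ^ 2 * pw32 (X l t))).
assert (HF : cont2 F).
{ intros l t. apply continuity_2d_pt_mult; [cont_2d |]. apply continuity_2d_pt_mult.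
  - apply (continuity_2d_pt_fst (fun l => Sw l * (a * exp l) ^ 2)). apply continuity_pt_filterlim.
    apply (cont_mult Sw (fun l => (a * exp l) ^ 2)); [apply cont_Sw |].
    apply cont_of_ex_derive. intros x. auto_derive. exact I.
  - apply (continuity_1d_2d_pt_comp pw32 X).
    + unfold pw32. cont_1d. apply HX.
    + apply continuity_2d_pt_plus; [| cont_2d].
      apply (continuity_2d_pt_fst (fun l => (a * exp l) ^ 2)). cont_1d. exact I. }
(* One summand per sign of [l]. For [l >= 0] the exponent [3/2] of [pw32] is split as [5/4] on
   [(a e^l)^2] and [1/4] on [e^|t|]; for [l < 0] it goes entirely to [e^|t|], and [e^(2 l)] provides
   the decay in [l]. *)
set (C := a ^ 2 * exp (- (5 / 4 * (2 * ln a))) + a ^ 2).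
assert (HC0 : 0 <= a ^ 2 * exp (- (5 / 4 * (2 * ln a))) /\ 0 <= a ^ 2).
{ split; [apply Rmult_le_pos; [apply pow2_ge_0 | left; apply exp_pos] | apply pow2_ge_0]. }
assert (HFd : udom2 (/ 4) C F).
{ intros l t. assert (HS := Sw_bounds l). assert (Hl := exp_pos l). assert (Hx := HX l t).
  assert (L1 : 2 * (ln a + l) <= ln (X l t)).
  { replace (2 * (ln a + l)) with (ln ((a * exp l) ^ 2)).
    - apply ln_le; [apply pow_lt; nra |]. unfold X. assert (Hc := cosh_ge_1 t). lra.
    - rewrite ln_pow by nra. rewrite ln_mult, ln_exp by lra. simpl. ring. }
  assert (L2 : Rabs t <= ln (X l t)).
  { rewrite <- (ln_exp (Rabs t)). apply ln_le; [apply exp_pos |]. unfold X.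
    assert (Hc := exp_Rabs_le_cosh t). assert (Hp := pow2_ge_0 (a * exp l)). lra. }
  assert (Hw : 0 < pw32 (X l t)) by apply exp_pos.
  assert (Hpow := pow2_ge_0 (a * exp l)).
  unfold F. rewrite Rabs_mult, (Rabs_pos_eq (Sw l * _ * _)) by (repeat apply Rmult_le_pos; lra).
  apply Rle_trans with (1 * (Sw l * (a * exp l) ^ 2 * pw32 (X l t))).
  { apply Rmult_le_compat_r; [repeat apply Rmult_le_pos; lra | apply Rabs_cos_le_1]. }
  rewrite Rmult_1_l.
  apply Rle_trans with ((a * exp l) ^ 2 * pw32 (X l t)).
  { apply Rmult_le_compat_r; [lra |]. rewrite <- (Rmult_1_l ((a * exp l) ^ 2)) at 2. apply Rmult_le_compat_r; lra. }
  rewrite Rpow_mult_distr.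
  assert (El : exp l ^ 2 = exp (2 * l)) by (simpl; rewrite Rmult_1_r, <- exp_plus; f_equal; ring).
  rewrite El. unfold C. rewrite Rmult_plus_distr_r.
  assert (HE : 0 < exp (- (/ 4 * Rabs l)) * exp (- (/ 4 * Rabs t))) by (apply Rmult_lt_0_compat; apply exp_pos).
  assert (Ht0 := Rabs_pos t).
  destruct (Rle_dec 0 l) as [H0|H0].
  - apply Rle_trans with (a ^ 2 * exp (- (5 / 4 * (2 * ln a))) * (exp (- (/ 4 * Rabs l)) * exp (- (/ 4 * Rabs t)))).
    + rewrite !Rmult_assoc. apply Rmult_le_compat_l; [apply HC0 |].
      apply Rle_trans with (exp (2 * l) * (exp (- (5 / 4 * (2 * (ln a + l)))) * exp (- (/ 4 * Rabs t)))).
      * apply Rmult_le_compat_l; [left; apply exp_pos |]. apply pw32_le; try assumption; lra.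
      * rewrite <- !exp_plus. apply exp_le_mono. rewrite (Rabs_pos_eq l) by exact H0. lra.
    + assert (0 <= a ^ 2 * (exp (- (/ 4 * Rabs l)) * exp (- (/ 4 * Rabs t)))) by (apply Rmult_le_pos; lra). lra.
  - apply Rle_trans with (a ^ 2 * (exp (- (/ 4 * Rabs l)) * exp (- (/ 4 * Rabs t)))).
    + rewrite Rmult_assoc. apply Rmult_le_compat_l; [lra |].
      apply Rle_trans with (exp (2 * l) * (exp (- (0 * 0)) * exp (- ((/ 2 + 1) * Rabs t)))).
      * apply Rmult_le_compat_l; [left; apply exp_pos |]. apply pw32_le; try assumption; lra.
      * rewrite <- !exp_plus. apply exp_le_mono. rewrite (Rabs_left l) by lra. lra.
    + assert (0 <= a ^ 2 * exp (- (5 / 4 * (2 * ln a))) * (exp (- (/ 4 * Rabs l)) * exp (- (/ 4 * Rabs t)))) by (apply Rmult_le_pos; lra). lra. }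
assert (HFub := Fubini_IR (/ 4) C F ltac:(lra) HF HFd).
assert (GI := IR_inner_Good (/ 4) C F ltac:(lra) HF HFd).
assert (Gt : forall t, Good (fun l => F l t)).
{ intros t. apply (udom_Good (/ 4) C F); [lra | exact HF |].
  apply udom2_udom; [lra | exact HFd]. }
assert (Gp : forall l, Good (fun t => cos (tau * t) * pw32 (X l t))).
{ intros l. apply Good_mult_cos. apply Good_of_cosh with 1.
  - apply cont_of_ex_derive. intros t. unfold pw32. specialize (HX l t). unfold X in *. auto_derive. exact HX.
  - intros t. rewrite Rabs_pos_eq by (left; apply exp_pos). assert (Hc := cosh_ge_1 t).
    rewrite pw32_sqrt by apply HX. unfold Rdiv. rewrite Rmult_1_l.
    assert (HXc : cosh t <= X l t) by (unfold X; assert (Hp := pow2_ge_0 (a * exp l)); lra).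
    assert (1 <= sqrt (X l t)) by (rewrite <- sqrt_1; apply sqrt_le_1; lra).
    apply Rinv_le_contravar; nra. }
assert (E1 : Qf tau a = - (asq tau * tau / 4) * IR (fun l => IR (fun t => F l t))).
{ rewrite Qf_Lam by assumption. rewrite <- IR_scal by exact GI. apply IR_ext. intros l.
  assert (Hl := exp_pos l).
  rewrite Lam_eq by (try assumption; now apply Rmult_lt_0_compat).
  rewrite (IR_ext (fun t => F l t) (fun t => (Sw l * (a * exp l) ^ 2) * (cos (tau * t) * pw32 (X l t)))) by (intros; unfold F; ring).
  rewrite IR_scal by apply Gp. unfold X. field. }
rewrite E1, HFub. f_equal. apply IR_ext. intros t.
assert (HC := cosh_ge_1 t).
(* Integrability of the [l]-integrand without the cosine is recovered from that of [F] by division,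
   hence the separate case of a vanishing cosine. *)
destruct (Req_dec (cos (tau * t)) 0) as [Hz|Hz].
- rewrite (IR_ext _ (fun l => 0 * F l t)).
  + rewrite IR_scal by apply Gt. rewrite Hz. ring.
  + intros l. unfold F. rewrite Hz. ring.
- assert (Gs : Good (fun l => Sw l * (a * exp l) ^ 2 * pw32 ((a * exp l) ^ 2 + 2 * (1 + cosh t)))).
  { apply Good_ext with (fun l => / cos (tau * t) * F l t); [| apply Good_scal, Gt].
    intros l. unfold F, X. field. exact Hz. }
  unfold F, X. rewrite IR_scal by exact Gs. rewrite Sw_pw32_integral by (try assumption; lra). reflexivity.
Qed.

(** * Orthogonality and expansion *)

Lemma Good_half f : Good f -> Good (fun t => f (t / 2)).
Proof.
intros [Hf [d [C [Hd HC]]]]. split.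
- apply (cont_comp f (fun t => t / 2)); [exact Hf |]. apply cont_of_ex_derive. intros t. auto_derive. exact I.
- exists (d / 2), C. split; [lra |]. intros t. eapply Rle_trans; [apply HC |]. right. f_equal. f_equal.
  unfold Rdiv. rewrite Rabs_mult, (Rabs_pos_eq (/ 2)) by lra. ring.
Qed.

Lemma IR_half f : Good f -> IR (fun t => f (t / 2)) = 2 * IR f.
Proof.
intros Hf. assert (Hf2 := Good_half f Hf).
assert (E : IR f = / 2 * IR (fun t => f (t / 2))).
{ apply (IR_unique f (fun n => / 2 * - INR n) (fun n => / 2 * INR n)); [exact Hf | | |].
  - assert (L := is_lim_seq_scal_l _ (/ 2) _ is_lim_seq_opp_INR).
    replace (Rbar_mult (/ 2) m_infty) with m_infty in L; [exact L |].
    simpl. destruct (Rle_dec 0 (/ 2)); [| lra]. destruct (Rle_lt_or_eq_dec _ _ r); [reflexivity | lra].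
  - assert (L := is_lim_seq_scal_l _ (/ 2) _ is_lim_seq_INR).
    replace (Rbar_mult (/ 2) p_infty) with p_infty in L; [exact L |].
    simpl. destruct (Rle_dec 0 (/ 2)); [| lra]. destruct (Rle_lt_or_eq_dec _ _ r); [reflexivity | lra].
  - apply is_lim_seq_ext with (fun n => / 2 * RInt (fun t => f (t / 2)) (- INR n) (INR n)).
    + intros n. assert (L := RInt_comp_lin f (/ 2) 0 (- INR n) (INR n)). rewrite !Rplus_0_r in L.
      rewrite <- L by (apply cont_ex_RInt; apply Hf).
      rewrite <- (RInt_scal (fun t => f (t / 2))) by (apply cont_ex_RInt; apply Hf2).
      apply RInt_ext. intros t _. f_equal. f_equal. field.
    + apply (is_lim_seq_scal_l _ (/ 2) (IR (fun t => f (t / 2)))). now apply Good_IR_lim. }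
rewrite E. field.
Qed.

Lemma sqrt_half_angle t : sqrt (2 * (1 + cosh t)) = 2 * cosh (t / 2).
Proof.
assert (H := cosh_ge_1 (t / 2)).
replace (2 * (1 + cosh t)) with ((2 * cosh (t / 2)) * (2 * cosh (t / 2))).
- apply sqrt_square. lra.
- unfold cosh. rewrite exp_Ropp.
  replace (exp t) with (exp (t / 2) * exp (t / 2)) by (rewrite <- exp_plus; f_equal; field).
  rewrite exp_Ropp. replace (exp t) with (exp (t / 2) * exp (t / 2)) by (rewrite <- exp_plus; f_equal; field).
  assert (He := exp_pos (t / 2)). field. lra.
Qed.

Lemma Good_inv_cosh_cosh u : Good (fun t => / (cosh u + cosh t)).
Proof.
assert (Hu := cosh_ge_1 u). apply Good_of_cosh with 1.
- apply cont_of_ex_derive. intros t. assert (H := cosh_ge_1 t). auto_derive. lra.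
- intros t. assert (H := cosh_ge_1 t).
  rewrite Rabs_pos_eq by (left; apply Rinv_0_lt_compat; lra).
  unfold Rdiv. rewrite Rmult_1_l. apply Rinv_le_contravar; lra.
Qed.

(** As [sqrt (2 (1 + cosh t)) = 2 cosh (t/2)], rescaling [t] by 2 doubles the frequency and leads to
    the kernel of [IR_cos_sinh_cosh]. Order [tau] thus yields [sin (2 tau u)], and the orders [m/2]
    yield the sines with integer frequency. *)
Lemma Qf_cosh tau u : 0 < tau ->
  sinh u * Qf tau (2 * cosh u) = - (sinh (PI * tau) / 2) * sin (2 * tau * u) / sinh (PI * (2 * tau)).
Proof.
intros Ht. assert (Hu := cosh_ge_1 u). assert (HP := PI_RGT_0).
rewrite Qf_eq by lra.
assert (G1 : Good (fun t => cos (2 * tau * t) * / (cosh u + cosh t))) by apply Good_mult_cos, Good_inv_cosh_cosh.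
assert (E1 : IR (fun t => cos (tau * t) * / (2 * cosh u + sqrt (2 * (1 + cosh t))))
   = IR (fun t => cos (2 * tau * t) * / (cosh u + cosh t))).
{ rewrite (IR_ext _ (fun t => / 2 * ((fun t => cos (2 * tau * t) * / (cosh u + cosh t)) (t / 2)))).
  - rewrite IR_scal by exact (Good_half _ G1).
    rewrite (IR_half (fun t => cos (2 * tau * t) * / (cosh u + cosh t))) by exact G1. field.
  - intros t. rewrite sqrt_half_angle. assert (Hc := cosh_ge_1 (t / 2)).
    replace (2 * tau * (t / 2)) with (tau * t) by field. field. lra. }
rewrite E1.
assert (E2 : sinh u * IR (fun t => cos (2 * tau * t) * / (cosh u + cosh t)) = sin (2 * tau * u) / (2 * tau) * sech_int (2 * tau)).
{ rewrite <- IR_cos_sinh_cosh by lra. rewrite <- IR_scal by exact G1. apply IR_ext. intros t. unfold Rdiv. ring. }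
rewrite sech_int_eq in E2 by lra.
assert (Hs : 0 < sinh (PI * (2 * tau))) by (apply sinh_pos; nra).
transitivity (- (asq tau * tau / 4) * (sinh u * IR (fun t => cos (2 * tau * t) * / (cosh u + cosh t)))); [ring |].
rewrite E2. unfold asq. field. lra.
Qed.

Lemma sin_nat_PI (k : Z) : sin (IZR k * PI) = 0.
Proof. apply sin_eq_0_1. now exists k. Qed.

Lemma RInt_sin_sin (n m : nat) : (1 <= n)%nat -> (1 <= m)%nat ->
  RInt (fun u => sin (INR n * u) * sin (INR m * u)) 0 PI = if Nat.eq_dec n m then PI / 2 else 0.
Proof.
intros Hn Hm. apply is_RInt_unique.
assert (HN : 0 < INR n) by (apply lt_0_INR; lia). assert (HM : 0 < INR m) by (apply lt_0_INR; lia).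
assert (Cc : cont (fun u => sin (INR n * u) * sin (INR m * u))).
{ apply cont_of_ex_derive. intros u. auto_derive. exact I. }
assert (Z : forall z : Z, forall x, x = IZR z -> sin (x * PI) = 0) by (intros z x ->; apply sin_nat_PI).
destruct (Nat.eq_dec n m) as [<-|Hne].
- replace (PI / 2) with ((PI / 2 - sin (2 * INR n * PI) / (4 * INR n)) - (0 / 2 - sin (2 * INR n * 0) / (4 * INR n))).
  + apply (is_RInt_FTC (fun u => u / 2 - sin (2 * INR n * u) / (4 * INR n))); [| exact Cc].
    intros u. auto_derive; [lra |].
    replace (2 * INR n * u) with (2 * (INR n * u)) by ring. rewrite cos_2a_sin. field. lra.
  + rewrite Rmult_0_r, sin_0. rewrite (Z (2 * Z.of_nat n)%Z (2 * INR n)).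
    * field. lra.
    * now rewrite mult_IZR, INR_IZR_INZ.
- assert (Hd : INR n - INR m <> 0) by (intros E; apply Hne, INR_eq; lra).

  replace 0 with ((sin ((INR n - INR m) * PI) / (2 * (INR n - INR m)) - sin ((INR n + INR m) * PI) / (2 * (INR n + INR m)))
    - (sin ((INR n - INR m) * 0) / (2 * (INR n - INR m)) - sin ((INR n + INR m) * 0) / (2 * (INR n + INR m)))) at 2.
  + apply (is_RInt_FTC (fun u => sin ((INR n - INR m) * u) / (2 * (INR n - INR m)) - sin ((INR n + INR m) * u) / (2 * (INR n + INR m)))); [| exact Cc].
    intros u. auto_derive; [split; lra |].
    rewrite (Rmult_minus_distr_r _ _ u), (Rmult_plus_distr_r _ _ u), cos_minus, cos_plus. field. lra.
  + rewrite !Rmult_0_r, sin_0.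
    rewrite (Z (Z.of_nat n - Z.of_nat m)%Z), (Z (Z.of_nat n + Z.of_nat m)%Z).
    * field. lra.
    * now rewrite plus_IZR, <- !INR_IZR_INZ.
    * now rewrite minus_IZR, <- !INR_IZR_INZ.
Qed.

(* [Omega n] in the variable [x = 2 e^{s/2}], including the Jacobian [dx/ds]. *)
Definition wOm n s := exp (s / 2) * Omega n (2 * exp (s / 2)).

(** [sinh (2 u) = 2 sinh u cosh u] supplies the factor that turns the bracket into [y K_0(y) - 2/pi]
    at [y = 2 x cosh u]; the remaining [sinh u] is the one that [Qf_cosh] needs. *)
Lemma Omega_khat n s : Omega n (2 * exp (s / 2)) =
  - (2 / PI) * RInt (fun u => khat (ln (4 * cosh u) + s / 2) * (sinh u * sin (INR n * u))) 0 PI.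
Proof.
assert (HP := PI_RGT_0). assert (He := exp_pos (s / 2)).
assert (Cu : cont (fun u => khat (ln (4 * cosh u) + s / 2) * (sinh u * sin (INR n * u)))).
{ apply cont_mult.
  - apply (cont_comp khat (fun u => ln (4 * cosh u) + s / 2)); [apply cont_khat |].
    apply cont_of_ex_derive. intros u. assert (H := cosh_ge_1 u). auto_derive. lra.
  - apply cont_of_ex_derive. intros u. auto_derive. exact I. }
rewrite <- (RInt_scal (fun u => khat (ln (4 * cosh u) + s / 2) * (sinh u * sin (INR n * u)))) by now apply cont_ex_RInt.
apply RInt_ext. intros u _. assert (Hc := cosh_ge_1 u).
unfold scal; simpl; unfold mult; simpl.
set (y := 2 * (2 * exp (s / 2)) * cosh u). assert (Hy : 0 < y) by (unfold y; nra).
assert (E := StruveK0_khat y Hy).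
assert (El : ln y = ln (4 * cosh u) + s / 2).
{ unfold y. replace (2 * (2 * exp (s / 2)) * cosh u) with (4 * cosh u * exp (s / 2)) by ring.
  rewrite ln_mult, ln_exp by lra. reflexivity. }
rewrite El in E.
assert (E2 : sinh (2 * u) = 2 * sinh u * cosh u).
{ unfold sinh, cosh. rewrite !exp_Ropp. replace (exp (2 * u)) with (exp u * exp u) by (rewrite <- exp_plus; f_equal; ring).
  assert (Hu := exp_pos u). field. lra. }
rewrite E2.
transitivity ((y * StruveK0 y - 2 / PI) * (sinh u * sin (INR n * u))).
- unfold y. field. lra.
- rewrite E. ring.
Qed.

(** On [[0, pi]] the shift [ln (4 cosh u)] stays between 0 and [ln (4 cosh pi)], so the decay of
    [e^h khat h] is uniform in [u]; the rate halves because the argument contains [s/2]. A general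
    [Z] covers both [Z = 1], for the integrability of [wOm], and [Z = Y], for the
    biorthogonality. *)
Lemma Fubini_Omega n Z B : cont Z -> (forall s, Rabs (Z s) <= B) ->
  Good (fun s => wOm n s * Z s) /\
  IR (fun s => wOm n s * Z s) = - (2 / PI) * RInt (fun u => (sinh u * sin (INR n * u)) *
     IR (fun s => exp (s / 2) * khat (ln (2 * (2 * cosh u)) + s / 2) * Z s)) 0 PI.
Proof.
intros HZ HB. assert (HP := PI_RGT_0).
destruct Good_exp_khat as [_ [d [K [Hd HK]]]].
assert (HK0 := dominated_nonneg _ _ _ HK).
set (F0 := fun s u => exp (s / 2) * khat (ln (4 * cosh u) + s / 2) * Z s * (sinh u * sin (INR n * u))).
set (F := fun s u => F0 s (clamp 0 PI u)).
assert (HF : cont2 F).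
{ apply cont2_clamp; [lra |]. intros s u _. assert (Hc := cosh_ge_1 u).
  apply continuity_2d_pt_mult; [apply continuity_2d_pt_mult; [apply continuity_2d_pt_mult |] |].
  - apply (continuity_2d_pt_fst (fun s => exp (s / 2))). cont_1d. exact I.
  - apply (continuity_1d_2d_pt_comp khat (fun s u => ln (4 * cosh u) + s / 2)).
    + apply continuity_pt_filterlim, cont_khat.
    + apply continuity_2d_pt_plus.
      * apply (continuity_2d_pt_snd (fun u => ln (4 * cosh u))). cont_1d. lra.
      * apply (continuity_2d_pt_fst (fun s => s / 2)). cont_1d. exact I.
  - apply continuity_2d_pt_fst, continuity_pt_filterlim, HZ.
  - apply (continuity_2d_pt_snd (fun u => sinh u * sin (INR n * u))). cont_1d. exact I. }
set (C := K * exp (d * ln (4 * cosh PI)) * B).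
assert (HFd : udom (d / 2) C F).
{ intros s u'. unfold F. assert (Hu := clamp_in 0 PI u' ltac:(lra)). set (u := clamp 0 PI u') in *.
  unfold F0. assert (Hc := cosh_ge_1 u).
  set (h := ln (4 * cosh u) + s / 2).
  assert (Ee : exp (s / 2) = / (4 * cosh u) * exp h).
  { unfold h. rewrite exp_plus, exp_ln by lra. field. lra. }
  rewrite Ee.
  replace (/ (4 * cosh u) * exp h * khat h * Z s * (sinh u * sin (INR n * u)))
    with ((exp h * khat h) * Z s * ((sinh u * / (4 * cosh u)) * sin (INR n * u))) by ring.
  assert (B1 : Rabs ((sinh u * / (4 * cosh u)) * sin (INR n * u)) <= 1 * 1).
  { apply Rabs_mult_le; [| apply Rabs_sin_le_1].
    rewrite Rabs_mult, (Rabs_pos_eq (/ _)) by (left; apply Rinv_0_lt_compat; lra).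
    assert (H := Rabs_sinh_le_cosh u).
    apply Rmult_le_reg_r with (4 * cosh u); [lra |]. rewrite Rmult_assoc, Rinv_l by lra. lra. }
  assert (Hln0 : 0 <= ln (4 * cosh u)) by (rewrite <- ln_1; apply ln_le; lra).
  assert (Hcm : cosh u <= cosh PI).
  { unfold cosh.
    assert (E : exp PI + exp (- PI) - (exp u + exp (- u)) = (exp PI - exp u) * (1 - exp (- PI) * exp (- u))).
    { rewrite !exp_Ropp. assert (H1 := exp_pos PI). assert (H2 := exp_pos u). field. lra. }
    assert (H1 : exp u <= exp PI) by (apply exp_le_mono; lra).
    assert (H2 : exp (- PI) * exp (- u) <= 1).
    { rewrite <- exp_plus, <- exp_0. apply exp_le_mono. lra. }
    assert (0 <= (exp PI - exp u) * (1 - exp (- PI) * exp (- u))) by (apply Rmult_le_pos; lra). lra. }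
  assert (Hlnm : ln (4 * cosh u) <= ln (4 * cosh PI)) by (apply ln_le; lra).
  assert (B2 : Rabs (exp h * khat h) <= K * (exp (d * ln (4 * cosh PI)) * exp (- (d / 2 * Rabs s)))).
  { eapply Rle_trans; [apply HK |]. apply Rmult_le_compat_l; [exact HK0 |].
    rewrite <- exp_plus. apply exp_le_mono.
    assert (T := Rabs_shift_half (ln (4 * cosh u)) s). fold h in T. rewrite (Rabs_pos_eq (ln _)) in T by exact Hln0. nra. }
  assert (B3 := Rabs_mult_le _ _ _ _ (Rabs_mult_le _ _ _ _ B2 (HB s)) B1).
  eapply Rle_trans; [exact B3 |]. right. unfold C. ring. }
destruct (Fubini_mixed (d / 2) C F 0 PI ltac:(lra) HF HFd) as [G E].
assert (E1 : forall s, - (2 / PI) * RInt (fun u => F s u) 0 PI = wOm n s * Z s).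
{ intros s. unfold wOm. rewrite Omega_khat.
  assert (Er : RInt (fun u => F s u) 0 PI = exp (s / 2) * Z s *
     RInt (fun u => khat (ln (4 * cosh u) + s / 2) * (sinh u * sin (INR n * u))) 0 PI).
  { rewrite <- (RInt_scal (fun u => khat (ln (4 * cosh u) + s / 2) * (sinh u * sin (INR n * u)))).
    - apply RInt_ext. intros u. rewrite Rmin_left, Rmax_right by lra. intros Hu.
      unfold F. rewrite clamp_id by lra. unfold F0, scal; simpl; unfold mult; simpl. ring.
    - apply cont_ex_RInt. apply cont_mult.
      + apply (cont_comp khat (fun u => ln (4 * cosh u) + s / 2)); [apply cont_khat |].
        apply cont_of_ex_derive. intros u. assert (H := cosh_ge_1 u). auto_derive. lra.
      + apply cont_of_ex_derive. intros u. auto_derive. exact I. }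
  rewrite Er. ring. }
split.
- apply (Good_ext _ _ E1). now apply Good_scal.
- rewrite <- (IR_ext _ _ E1), IR_scal by exact G. f_equal. rewrite E. apply RInt_ext.
  intros u. rewrite Rmin_left, Rmax_right by lra. intros Hu.
  unfold F. rewrite clamp_id by lra. unfold F0.
  replace (2 * (2 * cosh u)) with (4 * cosh u) by ring.
  assert (GZ : Good (fun s => exp (s / 2) * khat (ln (4 * cosh u) + s / 2) * Z s)).
  { apply Good_mult_bounded with B; [| exact HZ | exact HB].
    assert (Hc := cosh_ge_1 u).
    split.
    - apply cont_mult; [apply cont_of_ex_derive; intros s; auto_derive; exact I |].
      apply (cont_comp khat (fun s => ln (4 * cosh u) + s / 2)); [apply cont_khat |].
      apply cont_of_ex_derive. intros s. auto_derive. exact I.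
    - set (c := ln (4 * cosh u)).
      exists (d / 2), (/ (4 * cosh u) * K * exp (d * Rabs c)). split; [lra |]. intros s.
      replace (exp (s / 2) * khat (c + s / 2)) with (/ (4 * cosh u) * (exp (c + s / 2) * khat (c + s / 2))).
      + rewrite Rabs_mult, Rabs_pos_eq by (left; apply Rinv_0_lt_compat; lra).
        rewrite !Rmult_assoc. apply Rmult_le_compat_l; [left; apply Rinv_0_lt_compat; lra |].
        eapply Rle_trans; [apply HK |]. apply Rmult_le_compat_l; [exact HK0 |].
        rewrite <- exp_plus. apply exp_le_mono. assert (T := Rabs_shift_half c s). nra.
      + rewrite exp_plus. unfold c. rewrite exp_ln by lra. field. lra. }
  rewrite <- IR_scal by exact GZ. apply IR_ext. intros s. ring.
Qed.

(** The function multiplying the coefficient of index [m] in [f], in the variable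
    [x = 2 e^(s/2)]. *)
Definition gJ m s := 2 * Y (INR m / 2) s / sinh (PI * INR m / 2).

Lemma IR_Omega_gJ (n m : nat) : (1 <= n)%nat -> (1 <= m)%nat ->
  IR (fun s => wOm n s * gJ m s) = if Nat.eq_dec n m then / sinh (PI * INR n) else 0.
Proof.
intros Hn Hm. assert (HP := PI_RGT_0).
assert (HM : 0 < INR m) by (apply lt_0_INR; lia).
set (tau := INR m / 2). assert (Ht : 0 < tau) by (unfold tau; lra).
destruct (Fubini_Omega n (Y tau) (asq tau) (cont_Y tau) (fun s => Y_bound tau s Ht)) as [G E].
assert (Hs1 : 0 < sinh (PI * tau)) by (apply sinh_pos; nra).
assert (Hs2 : 0 < sinh (PI * INR m)) by (apply sinh_pos; nra).
rewrite (IR_ext _ (fun s => 2 / sinh (PI * tau) * (wOm n s * Y tau s))).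
2:{ intros s. unfold gJ. fold tau. replace (PI * INR m / 2) with (PI * tau) by (unfold tau; field). field. lra. }
rewrite IR_scal, E by exact G.
assert (E2 : RInt (fun u => (sinh u * sin (INR n * u)) *
     IR (fun s => exp (s / 2) * khat (ln (2 * (2 * cosh u)) + s / 2) * Y tau s)) 0 PI =
   - (sinh (PI * tau) / 2) / sinh (PI * INR m) * (if Nat.eq_dec n m then PI / 2 else 0)).
{ rewrite <- RInt_sin_sin by assumption.
  rewrite <- (RInt_scal (fun u => sin (INR n * u) * sin (INR m * u))).
  - apply RInt_ext. intros u _. change (IR (fun s => exp (s / 2) * khat (ln (2 * (2 * cosh u)) + s / 2) * Y tau s)) with (Qf tau (2 * cosh u)).
    unfold scal; simpl; unfold mult; simpl.
    transitivity (sin (INR n * u) * (sinh u * Qf tau (2 * cosh u))); [ring |].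
    rewrite Qf_cosh by exact Ht. replace (2 * tau) with (INR m) by (unfold tau; field). field. lra.
  - apply cont_ex_RInt, cont_of_ex_derive. intros u. auto_derive. exact I. }
rewrite E2. destruct (Nat.eq_dec n m) as [<-|_].
- field. lra.
- field. lra.
Qed.

(** The factor [sinh (pi tau)] of the energy bound is exactly the normalization of the series; what
    is left is [2 / (pi tau)], and [pi tau >= 1] because [tau >= 1/2]. *)
Lemma gJ_bound m s : (1 <= m)%nat -> Rabs (gJ m s) <= 2.
Proof.
intros Hm. assert (HP := PI2_3_2).
assert (HM : 1 <= INR m) by (apply (le_INR 1); exact Hm).
set (tau := INR m / 2). assert (Ht : 0 < tau) by (unfold tau; lra).
assert (Hs1 : 0 < sinh (PI * tau)) by (apply sinh_pos; nra).
unfold gJ. fold tau. replace (PI * INR m / 2) with (PI * tau) by (unfold tau; field).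
assert (HY := Y_bound tau s Ht). unfold asq in HY.
unfold Rdiv. rewrite !Rabs_mult, (Rabs_pos_eq 2), (Rabs_pos_eq (/ _)) by (try (left; apply Rinv_0_lt_compat); lra).
apply Rmult_le_reg_r with (sinh (PI * tau)); [exact Hs1 |].
rewrite Rmult_assoc, Rinv_l by lra.
assert (Hpt : 1 <= PI * tau) by (unfold tau; nra).
assert (sinh (PI * tau) / (PI * tau) <= sinh (PI * tau)).
{ apply Rmult_le_reg_r with (PI * tau); [lra |]. unfold Rdiv. rewrite Rmult_assoc, Rinv_l by lra. nra. }
lra.
Qed.

Lemma cont_gJ m : cont (gJ m).
Proof.
apply (cont_mult (fun s => 2 * Y (INR m / 2) s) (fun _ => / sinh (PI * INR m / 2))); [| apply cont_const].
apply (cont_mult (fun _ => 2)); [apply cont_const | apply cont_Y].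
Qed.

(** * The series and its term-by-term integration *)

Lemma cont_unif_limit (f : R -> R) :
  (forall eps, 0 < eps -> exists h, cont h /\ forall x, Rabs (f x - h x) <= eps) -> cont f.
Proof.
intros H x. apply continuity_pt_filterlim. intros eps He.
destruct (H (eps / 4)) as [h [Hh Hfh]]; [lra |].
assert (C := Hh x). apply continuity_pt_filterlim in C. destruct (C (eps / 4)) as [dl [Hdl HC]]; [lra |].
exists dl. split; [exact Hdl |]. intros y Hy. specialize (HC y Hy). simpl in *. unfold Rdist in *.
assert (B1 := Hfh x). assert (B2 := Hfh y).
replace (f y - f x) with ((f y - h y) + (h y - h x) + - (f x - h x)) by ring.
eapply Rle_lt_trans; [apply Rabs_triang |]. rewrite Rabs_Ropp.
assert (T := Rabs_triang (f y - h y) (h y - h x)). lra.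
Qed.

(** [f] in the variable [s] for real coefficients; a complex sequence is handled by components. The
    index is shifted: [b k] belongs to the order [(k + 1)/2]. *)
Definition Fs (b : nat -> R) s := Series (fun k => b k * gJ (S k) s).

Lemma ex_series_Fs (b : nat -> R) (Hb : ex_series (fun k => Rabs (b k))) s : ex_series (fun k => b k * gJ (S k) s).
Proof.
apply (ex_series_le (V := R_CompleteNormedModule) _ (fun k => Rabs (b k) * 2)).
- intros k. rewrite Rabs_mult.
  apply Rmult_le_compat_l; [apply Rabs_pos | apply gJ_bound; lia].
- now apply @ex_series_scal_r.
Qed.

(** Weierstrass' test: by [gJ_bound] the tail of the series of [|b k|] controls the remainder for
    all [s] at once. *)
Lemma Fs_tail (b : nat -> R) (Hb : ex_series (fun k => Rabs (b k))) : forall eps, 0 < eps -> exists N0, forall N, (N0 <= N)%nat -> forall s,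
  Rabs (Fs b s - sum_n (fun k => b k * gJ (S k) s) N) <= eps.
Proof.
intros eps He.
assert (L : is_lim_seq (sum_n (fun k => Rabs (b k))) (Series (fun k => Rabs (b k)))).
{ apply Series_correct, Hb. }
apply is_lim_seq_spec in L. destruct (L (mkposreal (eps / 2) ltac:(lra))) as [N0 HN0].
exists N0. intros N HN s.
assert (Hs := ex_series_Fs b Hb s).
unfold Fs. rewrite (Series_incr_n _ (S N)) by (try lia; exact Hs). simpl pred.
rewrite <- sum_n_Reals.
set (T := Series (fun k => b (S N + k)%nat * gJ (S (S N + k)) s)).
replace (sum_n (fun k => b k * gJ (S k) s) N + T - sum_n (fun k => b k * gJ (S k) s) N) with T by ring.
assert (HbN : ex_series (fun k => Rabs (b (S N + k)%nat))) by (apply (ex_series_incr_n (fun k => Rabs (b k)) (S N)); exact Hb).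
assert (Hab : ex_series (fun k => Rabs (b (S N + k)%nat * gJ (S (S N + k)) s))).
{ apply (ex_series_le (V := R_CompleteNormedModule) _ (fun k => Rabs (b (S N + k)%nat) * 2)).
  - intros k. rewrite Rabs_Rabsolu, Rabs_mult.
    apply Rmult_le_compat_l; [apply Rabs_pos | apply gJ_bound; lia].
  - now apply @ex_series_scal_r. }
eapply Rle_trans; [now apply Series_Rabs |].
apply Rle_trans with (Series (fun k => Rabs (b (S N + k)%nat) * 2)).
- apply Series_le; [| now apply @ex_series_scal_r].
  intros k. split; [apply Rabs_pos |]. rewrite Rabs_mult.
  apply Rmult_le_compat_l; [apply Rabs_pos | apply gJ_bound; lia].
- rewrite Series_scal_r. specialize (HN0 N HN).
  rewrite (Series_incr_n (fun k => Rabs (b k)) (S N)) in HN0 by (try lia; exact Hb). simpl pred in HN0.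
  rewrite <- sum_n_Reals in HN0. apply Rabs_lt_between in HN0. simpl in HN0 |- *. lra.
Qed.

Lemma cont_sum_n (f : nat -> R -> R) N : (forall k, cont (f k)) -> cont (fun s => sum_n (fun k => f k s) N).
Proof.
intros H. induction N as [|N IH].
- intros x. apply continuous_ext with (f 0%nat); [intros; now rewrite sum_O | apply H].
- intros x. apply continuous_ext with (fun s => sum_n (fun k => f k s) N + f (S N) s).
  + intros; now rewrite sum_Sn.
  + now apply (cont_plus (fun s => sum_n (fun k => f k s) N) (f (S N))).
Qed.

Lemma cont_term (b : nat -> R) k : cont (fun s => b k * gJ (S k) s).
Proof. apply (cont_mult (fun _ => b k)); [apply cont_const | apply cont_gJ]. Qed.

Lemma cont_Fs (b : nat -> R) (Hb : ex_series (fun k => Rabs (b k))) : cont (Fs b).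
Proof.
apply cont_unif_limit. intros eps He. destruct (Fs_tail b Hb eps He) as [N0 H].
exists (fun s => sum_n (fun k => b k * gJ (S k) s) N0). split.
- apply (cont_sum_n (fun k s => b k * gJ (S k) s)). intros k. apply cont_term.
- now apply H.
Qed.

Lemma Fs_bound (b : nat -> R) (Hb : ex_series (fun k => Rabs (b k))) : exists B, forall s, Rabs (Fs b s) <= B.
Proof.
exists (Series (fun k => Rabs (b k)) * 2). intros s.
assert (Hab : ex_series (fun k => Rabs (b k * gJ (S k) s))).
{ apply (ex_series_le (V := R_CompleteNormedModule) _ (fun k => Rabs (b k) * 2)).
  - intros k. rewrite Rabs_Rabsolu, Rabs_mult.
    apply Rmult_le_compat_l; [apply Rabs_pos | apply gJ_bound; lia].
  - now apply @ex_series_scal_r. }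
eapply Rle_trans; [now apply Series_Rabs |].
rewrite <- Series_scal_r. apply Series_le; [| now apply @ex_series_scal_r].
intros k. split; [apply Rabs_pos |]. rewrite Rabs_mult.
apply Rmult_le_compat_l; [apply Rabs_pos | apply gJ_bound; lia].
Qed.

Lemma Good_wOm n : Good (wOm n).
Proof.
assert (H := proj1 (Fubini_Omega n (fun _ => 1) 1 (cont_const 1) (fun _ => Req_le _ _ Rabs_R1))).
eapply Good_ext; [| exact H]. intros s. simpl. ring.
Qed.

Lemma IR_Omega_sum (b : nat -> R) n N : (n <= N)%nat ->
  Good (fun s => wOm (S n) s * sum_n (fun k => b k * gJ (S k) s) N) /\
  IR (fun s => wOm (S n) s * sum_n (fun k => b k * gJ (S k) s) N) = b n / sinh (PI * INR (S n)).
Proof.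
intros HnN.
(* The induction starts at [N = 0], possibly below [n], so the value is tracked for [N < n] too,
   where the partial sum is orthogonal to the kernel. *)
assert (K : forall N, Good (fun s => wOm (S n) s * sum_n (fun k => b k * gJ (S k) s) N) /\
  IR (fun s => wOm (S n) s * sum_n (fun k => b k * gJ (S k) s) N) =
  if Compare_dec.le_dec n N then b n / sinh (PI * INR (S n)) else 0).
{ assert (GT : forall k, Good (fun s => b k * (wOm (S n) s * gJ (S k) s))).
  { intros k. apply Good_scal. apply Good_mult_bounded with 2; [apply Good_wOm | apply cont_gJ |].
    intros s. apply gJ_bound. lia. }
  assert (IT : forall k, IR (fun s => b k * (wOm (S n) s * gJ (S k) s)) =
     if Nat.eq_dec (S n) (S k) then b k / sinh (PI * INR (S n)) else 0).
  { intros k. rewrite IR_scal.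
    - rewrite IR_Omega_gJ by lia. destruct (Nat.eq_dec (S n) (S k)); unfold Rdiv; ring.
    - apply Good_mult_bounded with 2; [apply Good_wOm | apply cont_gJ |]. intros s. apply gJ_bound. lia. }
  clear N HnN. induction N as [|N [IHG IHI]].
  - assert (E : forall s, b 0%nat * (wOm (S n) s * gJ 1 s) = wOm (S n) s * sum_n (fun k => b k * gJ (S k) s) 0).
    { intros s. rewrite sum_O. ring. }
    split; [exact (Good_ext _ _ E (GT 0%nat)) |].
    rewrite <- (IR_ext _ _ E), IT.
    destruct (Nat.eq_dec (S n) 1); destruct (Compare_dec.le_dec n 0); try lia; [| reflexivity].
    replace n with 0%nat by lia. reflexivity.
  - assert (E : forall s, wOm (S n) s * sum_n (fun k => b k * gJ (S k) s) N + b (S N) * (wOm (S n) s * gJ (S (S N)) s)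
       = wOm (S n) s * sum_n (fun k => b k * gJ (S k) s) (S N)).
    { intros s. rewrite sum_Sn. unfold plus; simpl. ring. }
    split; [exact (Good_ext _ _ E (Good_plus _ _ IHG (GT (S N)))) |].
    rewrite <- (IR_ext _ _ E), IR_plus, IHI, IT by (exact IHG || apply GT).
    destruct (Compare_dec.le_dec n N); destruct (Nat.eq_dec (S n) (S (S N))); destruct (Compare_dec.le_dec n (S N)); try lia; try ring.
    replace n with (S N) by lia. ring. }
destruct (K N) as [G I]. split; [exact G |]. rewrite I.
destruct (Compare_dec.le_dec n N); [reflexivity | lia].
Qed.

Lemma Good_Omega_Fs (b : nat -> R) (Hb : ex_series (fun k => Rabs (b k))) n : Good (fun s => wOm n s * Fs b s).
Proof.
destruct (Fs_bound b Hb) as [B HB]. apply Good_mult_bounded with B; [apply Good_wOm | apply (cont_Fs b Hb) | exact HB].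
Qed.

(** Partial sums converge uniformly and [wOm] is absolutely integrable, so the integral of the
    difference is at most the uniform error times [A]; [A + 1] in the divisor guards against
    [A = 0]. From the index [n] on, the integrals of the partial sums are constant. *)
Lemma IR_Omega_Fs (b : nat -> R) (Hb : ex_series (fun k => Rabs (b k))) n : IR (fun s => wOm (S n) s * Fs b s) = b n / sinh (PI * INR (S n)).
Proof.
assert (GA := Good_Rabs _ (Good_wOm (S n))).
set (A := IR (fun s => Rabs (wOm (S n) s))).
assert (HA : 0 <= A).
{ eapply Rle_trans; [apply Rabs_pos |]. apply (IR_abs_le (wOm (S n))); [apply Good_wOm | exact GA |].
  intros s. apply Rle_refl. }
apply Rminus_diag_uniq. apply Rabs_eq_0. apply Rle_antisym; [| apply Rabs_pos].
apply le_epsilon. intros eps He. rewrite Rplus_0_l.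
destruct (Fs_tail b Hb (eps / (A + 1))) as [N0 HN0]; [apply Rdiv_lt_0_compat; lra |].
set (N := Nat.max n N0).
destruct (IR_Omega_sum b n N ltac:(lia)) as [G E]. rewrite <- E.
rewrite <- IR_minus by (try exact G; apply (Good_Omega_Fs b Hb)).
apply Rle_trans with (eps / (A + 1) * A).
- unfold A. rewrite <- IR_scal by exact GA.
  apply IR_abs_le; [apply Good_minus; [apply (Good_Omega_Fs b Hb) | exact G] | now apply Good_scal |].
  intros s. rewrite <- Rmult_minus_distr_l, Rabs_mult, Rmult_comm.
  apply Rmult_le_compat_r; [apply Rabs_pos |]. apply HN0. lia.
- apply Rmult_le_reg_r with (A + 1); [lra |].
  replace (eps / (A + 1) * A * (A + 1)) with (eps * A) by (field; lra). nra.
Qed.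

(** * Return to the half-line *)

Lemma exp_half_ln x : 0 < x -> 2 * exp (2 * ln (x / 2) / 2) = x.
Proof.
intros Hx. replace (2 * ln (x / 2) / 2) with (ln (x / 2)) by field.
rewrite exp_ln by lra. field.
Qed.

(** [G] determines [h] at positive arguments, so [h] inherits continuity there. The substitution
    maps [[x1, x2]] to an interval that contains [[-M, M]] once [x1 < 2 e^(-M/2)] and
    [x2 > 2 e^(M/2)], and [IR_tail] applies. *)
Lemma RInt_gen_log (h G : R -> R) : Good G -> (forall s, G s = exp (s / 2) * h (2 * exp (s / 2))) ->
  forall P : posreal, filter_prod (at_right 0) (Rbar_locally p_infty)
   (fun ab => ex_RInt h (fst ab) (snd ab) /\ Rabs (RInt h (fst ab) (snd ab) - IR G) < P).
Proof.
intros [CG [d [C [Hd HC]]]] HGh eps.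
assert (HC0 := dominated_nonneg _ _ _ HC).
assert (Hh : forall x, 0 < x -> h x = 2 / x * G (2 * ln (x / 2))).
{ intros x Hx. rewrite HGh, exp_half_ln by exact Hx.
  replace (2 * ln (x / 2) / 2) with (ln (x / 2)) by field. rewrite exp_ln by lra. field. lra. }
assert (Ch : forall x, 0 < x -> continuous h x).
{ intros x Hx. apply continuous_ext_loc with (fun x => 2 / x * G (2 * ln (x / 2))).
  - exists (mkposreal x Hx). intros z Hz. symmetry. apply Hh.
    unfold ball in Hz; simpl in Hz; unfold AbsRing_ball, abs, minus, plus, opp in Hz; simpl in Hz.
    apply Rabs_lt_between in Hz. lra.
  - apply @continuous_mult.
    + apply @ex_derive_continuous. auto_derive. lra.
    + apply (continuous_comp (fun x => 2 * ln (x / 2)) G); [| apply CG].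
      apply @ex_derive_continuous. auto_derive. lra. }
destruct (exp_neg_small d (2 * C / d) eps Hd) as [M [HM0 HM]];
  [apply Rdiv_le_0_compat; lra | apply eps |].
exists (fun a => 0 < a < 2 * exp (- M / 2)) (fun b => 2 * exp (M / 2) < b).
- assert (He : 0 < 2 * exp (- M / 2)) by (assert (H := exp_pos (- M / 2)); lra).
  exists (mkposreal _ He). intros z Hz Hz0.
  unfold ball in Hz; simpl in Hz; unfold AbsRing_ball, abs, minus, plus, opp in Hz; simpl in Hz.
  apply Rabs_lt_between in Hz. lra.
- now exists (2 * exp (M / 2)).
- intros x1 x2 [H1 H1'] H2. simpl.

  assert (E12 : exp (- M / 2) <= exp (M / 2)) by (apply exp_le_mono; lra).
  set (al := 2 * ln (x1 / 2)). set (be := 2 * ln (x2 / 2)).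
  assert (Hal : al <= - M).
  { assert (L : ln (x1 / 2) <= ln (exp (- M / 2))) by (apply ln_le; lra). rewrite ln_exp in L. unfold al. lra. }
  assert (Hbe : M <= be).
  { assert (L : ln (exp (M / 2)) <= ln (x2 / 2)) by (apply ln_le; lra). rewrite ln_exp in L. unfold be. lra. }
  split.
  + apply @ex_RInt_continuous. intros z. rewrite Rmin_left, Rmax_right by lra. intros Hz. apply Ch. lra.
  + assert (E : RInt h x1 x2 = RInt G al be).
    { rewrite <- (exp_half_ln x1), <- (exp_half_ln x2) by lra. fold al. fold be.
      rewrite <- (RInt_comp h (fun s => 2 * exp (s / 2)) (fun s => exp (s / 2)) al be).
      - apply RInt_ext. intros s _. rewrite HGh. reflexivity.
      - intros s _. apply Ch. assert (H := exp_pos (s / 2)). lra.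
      - intros s _. split.
        + auto_derive; [exact I |]. unfold Rdiv. field.
        + apply @ex_derive_continuous. auto_derive. exact I. }
    rewrite E. eapply Rle_lt_trans; [apply (IR_tail d C G M); try assumption; lra | apply HM; lra].
Qed.

Lemma is_RInt_gen_log (h G : R -> R) : Good G -> (forall s, G s = exp (s / 2) * h (2 * exp (s / 2))) ->
  is_RInt_gen h (at_right 0) (Rbar_locally p_infty) (IR G).
Proof.
intros HG Hh. apply (is_RInt_gen_of_lim h (at_right 0) (Rbar_locally p_infty)). now apply RInt_gen_log.
Qed.

Lemma is_RInt_gen_C (h : R -> C) (Fa Fb : (R -> Prop) -> Prop) {FFa : Filter Fa} {FFb : Filter Fb} (l : C) :
  is_RInt_gen (fun x => Re (h x)) Fa Fb (Re l) -> is_RInt_gen (fun x => Im (h x)) Fa Fb (Im l) ->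
  is_RInt_gen (V := C_R_NormedModule) h Fa Fb l.
Proof.
intros H1 H2 P [eps HP]. unfold filtermapi.
assert (L1 := H1 _ (locally_ball (Re l) eps)). assert (L2 := H2 _ (locally_ball (Im l) eps)).
unfold filtermapi in L1, L2.
generalize (filter_and _ _ L1 L2). apply filter_imp. intros [a b] [[y1 [I1 B1]] [y2 [I2 B2]]].
exists (y1, y2). split.
- now apply (is_RInt_fct_extend_pair (U := R_NormedModule) (V := R_NormedModule)).
- apply HP. split; [exact B1 | exact B2].
Qed.

Lemma ex_series_component (p : C -> R) (u : nat -> C) : (forall z, Rabs (p z) <= Cmod z) ->
  ex_series (fun k => Cmod (u k)) -> ex_series (fun k => Rabs (p (u k))).
Proof.
intros Hp Hu. apply (ex_series_le (V := R_CompleteNormedModule) _ (fun k => Cmod (u k))); [| exact Hu].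
intros k. unfold norm; simpl. unfold abs; simpl. rewrite Rabs_Rabsolu. apply Hp.
Qed.

(** Both component series are shown to converge, so the total operation [Cseries] yields the actual
    sum here. *)
Lemma ffun_log (a : nat -> C) s : ex_series (fun k => Cmod (a (S k))) ->
  ffun a (2 * exp (s / 2)) = (Fs (fun k => Re (a (S k))) s, Fs (fun k => Im (a (S k))) s).
Proof.
intros Ha.
assert (HR := ex_series_component Re (fun k => a (S k)) re_le_Cmod Ha).
assert (HI := ex_series_component Im (fun k => a (S k)) im_le_Cmod Ha).
assert (E : forall k, Im (Cmult (BesselJ (0, INR (S k) / 2) (2 * exp (s / 2))) (BesselJ (0, INR (S k) / 2) (2 * exp (s / 2))))
   / sinh (PI * INR (S k) / 2) = gJ (S k) s).
{ intros k. assert (Hk := pos_INR k). rewrite BesselJ_bu_bv by (rewrite S_INR; lra).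
  unfold gJ, Y. f_equal. unfold Cmult, Im; cbn [fst snd]. ring. }
apply Cseries_unique.
- apply is_series_ext with (fun k => Re (a (S k)) * gJ (S k) s).
  + intros k. cbv zeta. rewrite E. change (Re (a (S k)) * gJ (S k) s = Re (a (S k)) * gJ (S k) s - Im (a (S k)) * 0). ring.
  + apply Series_correct. now apply ex_series_Fs.
- apply is_series_ext with (fun k => Im (a (S k)) * gJ (S k) s).
  + intros k. cbv zeta. rewrite E. change (Im (a (S k)) * gJ (S k) s = Re (a (S k)) * 0 + Im (a (S k)) * gJ (S k) s). ring.
  + apply Series_correct. now apply ex_series_Fs.
Qed.

Theorem theorem5 (a : nat -> C)
  (ha : ex_series (fun k => Cmod (a (S k))))
  (n : nat) (hn : (1 <= n)%nat) :
  ex_RInt_gen (fun x => Cmod (Cmult (RtoC (Omega n x)) (ffun a x)))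
    (at_right 0) (Rbar_locally p_infty)
  /\ exists I : C,
       is_RInt_gen (fun x => Cmult (RtoC (Omega n x)) (ffun a x))
         (at_right 0) (Rbar_locally p_infty) I
       /\ a n = Cmult (RtoC (sinh (PI * INR n))) I.
Proof.
destruct n as [|n]; [lia |].
set (br := fun k => Re (a (S k))). set (bi := fun k => Im (a (S k))).
assert (HR := ex_series_component Re (fun k => a (S k)) re_le_Cmod ha).
assert (HI := ex_series_component Im (fun k => a (S k)) im_le_Cmod ha).
assert (Hf : forall s, ffun a (2 * exp (s / 2)) = (Fs br s, Fs bi s)) by (intros s; now apply ffun_log).
assert (Hs : 0 < sinh (PI * INR (S n))).
{ apply sinh_pos. assert (HP := PI_RGT_0). assert (H := lt_0_INR (S n) ltac:(lia)). nra. }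
split.
- destruct (Fs_bound br HR) as [B1 HB1]. destruct (Fs_bound bi HI) as [B2 HB2].
  (* The modulus mixes the two components, so it is treated as one bounded continuous factor of
     [|wOm|], with the sum of the two component bounds. *)
  set (G := fun s => Rabs (wOm (S n) s) * Cmod (Fs br s, Fs bi s)).
  exists (IR G). apply is_RInt_gen_log.
  + apply Good_mult_bounded with (B1 + B2).
    * apply Good_Rabs, Good_wOm.
    * intros s. apply (continuous_comp (fun s => fst (Fs br s, Fs bi s) ^ 2 + snd (Fs br s, Fs bi s) ^ 2) sqrt).
      -- apply (cont_plus (fun s => Fs br s * (Fs br s * 1)) (fun s => Fs bi s * (Fs bi s * 1)));
           (apply cont_mult; [| apply cont_mult]; try apply cont_const; now apply cont_Fs).
      -- apply continuous_sqrt.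
    * intros s. rewrite Rabs_pos_eq by apply Cmod_ge_0.
      replace ((Fs br s, Fs bi s) : C) with (Cplus (RtoC (Fs br s)) (Cmult Ci (RtoC (Fs bi s))))
        by (unfold Cplus, Cmult, Ci, RtoC; simpl; f_equal; ring).
      eapply Rle_trans; [apply Cmod_triangle |]. rewrite Cmod_mult, !Cmod_R.
      replace (Cmod Ci) with 1.
      -- rewrite Rmult_1_l. apply Rplus_le_compat; [apply HB1 | apply HB2].
      -- unfold Cmod, Ci; cbn [fst snd]. replace (0 ^ 2 + 1 ^ 2) with 1 by ring. symmetry. apply sqrt_1.
  + intros s. unfold G, wOm. rewrite Cmod_mult, Cmod_R, Hf, Rabs_mult, (Rabs_pos_eq (exp _)) by (left; apply exp_pos). ring.
- exists (br n / sinh (PI * INR (S n)), bi n / sinh (PI * INR (S n))). split.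
  + apply (is_RInt_gen_C (fun x => Cmult (RtoC (Omega (S n) x)) (ffun a x)) (at_right 0) (Rbar_locally p_infty)).
    * replace (Re (br n / sinh (PI * INR (S n)), bi n / sinh (PI * INR (S n))))
        with (IR (fun s => wOm (S n) s * Fs br s)) by now apply IR_Omega_Fs.
      apply is_RInt_gen_log; [now apply Good_Omega_Fs |].
      intros s. rewrite Hf. unfold wOm, Cmult, RtoC, Re; cbn [fst snd]. ring.
    * replace (Im (br n / sinh (PI * INR (S n)), bi n / sinh (PI * INR (S n))))
        with (IR (fun s => wOm (S n) s * Fs bi s)) by now apply IR_Omega_Fs.
      apply is_RInt_gen_log; [now apply Good_Omega_Fs |].
      intros s. rewrite Hf. unfold wOm, Cmult, RtoC, Im; cbn [fst snd]. ring.
  + unfold Cmult, RtoC; cbn [fst snd]. unfold br, bi.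
    rewrite (surjective_pairing (a (S n))) at 1. unfold Re, Im. f_equal; field; lra.
Qed.
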